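(* Let $Q$ be a finite quiver with a finite set of relations, $\mathbf{v}$ a dimension vector, $\alpha$ an admissible stability parameter, and $\nu^{-1}(0)\subset\mathrm{Rep}(Q,\mathbf{v})$ the set of representations satisfying the relations. Let $x$ be a critical point of $\|\mu-\alpha\|^2$ on $\nu^{-1}(0)$ and let $x=x_1\oplus\cdots\oplus x_n$ be its critical decomposition as a direct sum of stable representations (i.e. each summand $x_k$ of the critical decomposition is stable), ordered so that $\mathrm{slope}_\alpha(x_j)<\mathrm{slope}_\alpha(x_k)$ for all $j<k$. Then every $y\in W_x^-$ admits a filtration by subrepresentations $0=y_0\subset y_1\subset\cdots\subset y_n=y$ such that each quotient $y_k/y_{k-1}$ is isomorphic to $x_k$ for $k=1,\dots,n$. Conversely, let $y\in\nu^{-1}(0)$ be a representation admitting a filtration $0=y_0\subset y_1\subset\cdots\subset y_n=y$ such that each quotient $y_k/y_{k-1}$ is isomorphic to $x_k$ for $k=1,\dots,n$. Then there exists $g\in G_{\mathbf{v}}$ such that $g\cdot y\in W_x^-$.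
   Context: A finite quiver $Q$ has vertex set $\mathcal{I}$, edge set $\mathcal{E}$ and head/tail maps $h,t$. Fix $\mathbf{v}=(v_i)\in\mathbb{Z}_{\ge0}^{\mathcal{I}}$ and Hermitian vector spaces $V_i$ with $\dim_{\mathbb{C}}V_i=v_i$. $\mathrm{Rep}(Q,\mathbf{v})=\bigoplus_{a\in\mathcal{E}}\mathrm{Hom}(V_{t(a)},V_{h(a)})$. The groups $G_{\mathbf{v}}=\prod_i\mathrm{GL}(V_i,\mathbb{C})$ and $K_{\mathbf{v}}=\prod_i\mathrm{U}(V_i)$ (Lie algebra $\mathfrak{k}_{\mathbf{v}}$) act by $(g\cdot x)_a=g_{h(a)}x_ag_{t(a)}^{-1}$, with infinitesimal action $\rho_x^{\mathbb{C}}(u)_a=u_{h(a)}x_a-x_au_{t(a)}$. A relation is a linear combination of paths of length at least $2$ with common head and common tail; given a finite set of relations, $\nu^{-1}(0)$ is the closed $G_{\mathbf{v}}$-invariant set of $x\in\mathrm{Rep}(Q,\mathbf{v})$ on which all relations evaluate to zero. An admissible stability parameter is $\alpha=(\alpha_i)\in\mathbb{Z}^{\mathcal{I}}$ with $\sum_i\alpha_iv_i=0$; it is also regarded as the central element $(i\alpha_j\,\mathrm{id}_{V_j})_j\in\mathfrak{k}_{\mathbf{v}}$. The slope of a representation of dimension vector $\mathbf{w}$ is $\mathrm{slope}_\alpha=\sum_i\alpha_iw_i/\sum_iw_i$. A summand $x_k$ is stable (with respect to the stability parameter induced by $\alpha$, obtained by subtracting $\mathrm{slope}_\alpha(x_k)$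 from every $\alpha_i$) if every proper nonzero subrepresentation $x'$ of $x_k$ satisfies $\mathrm{slope}_\alpha(x')<\mathrm{slope}_\alpha(x_k)$. The moment map is $\mu(x)=\frac{1}{2i}\sum_{a}[x_a,x_a^*]\in\mathfrak{k}_{\mathbf{v}}$ (each $x_a$ viewed in $\mathrm{End}(\bigoplus_iV_i)$). A point $x\in\nu^{-1}(0)$ is critical for $\|\mu-\alpha\|^2$ iff it is critical on $\mathrm{Rep}(Q,\mathbf{v})$, i.e. iff $\rho_x^{\mathbb{C}}(\mu(x)-\alpha)=0$. The downwards gradient flow $\phi(y,t)$ solves $\frac{d}{dt}\phi=-i\,\rho^{\mathbb{C}}_{\phi}(\mu(\phi)-\alpha)$, $\phi(y,0)=y$; it preserves $\nu^{-1}(0)$, and the unstable set in $\nu^{-1}(0)$ is $W_x^-=\{y\in\nu^{-1}(0):\lim_{t\to-\infty}\phi(y,t)=x\}$. Critical decomposition: at a critical point $x$, the eigenspaces of the self-adjoint endomorphism $i(\mu(x)-\alpha)$ of $\bigoplus_iV_i$ are preserved by $x$ and give an orthogonal direct sum $x=x_1\oplus\cdots\oplus x_n$ with distinct eigenvalues; the eigenvalue on the summand $x_j$ equals $\mathrm{slope}_\alpha(x_j)$. *)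

(* Defs.v *)
From HB Require Import structures.
From mathcomp Require Import all_boot all_order all_algebra.
From mathcomp Require Import complex.
From mathcomp Require Import boolp classical_sets reals topology normedtype derive.

Set Implicit Arguments.
Unset Strict Implicit.
Unset Printing Implicit Defensive.

Import Order.TTheory GRing.Theory Num.Theory.
Import numFieldNormedType.Exports.

Local Open Scope ring_scope.
Local Open Scope quotient_scope.
Local Open Scope sesquilinear_scope.

(* [Quotient.quot] is the additive group of cosets; what is added here is the
   scalar multiplication and the finite dimension. *)

Section QuotientSpace.
Variables (F : fieldType) (V : vectType F) (U : {vspace V}).

Definition quotvs : Type := Quotient.quot (pred_of_vspace U).

HB.instance Definition _ := GRing.Zmodule.on quotvs.

Definition qproj (u : V) : quotvs := \pi_(Quotient.quot (pred_of_vspace U)) u.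
Definition qrepr (q : quotvs) : V :=
  repr (q : Quotient.quot (pred_of_vspace U)).

Lemma qreprK : cancel qrepr qproj.
Proof. exact: reprK. Qed.

Lemma eq_qproj u w : (qproj u == qproj w) = (u - w \in U).
Proof. by rewrite [LHS]eqmodE. Qed.

Lemma qprojD u w : qproj (u + w) = qproj u + qproj w.
Proof. exact: (raddfD \pi_(Quotient.quot (pred_of_vspace U))). Qed.

Lemma qreprP u : qrepr (qproj u) - u \in U.
Proof. by rewrite -eq_qproj qreprK. Qed.

Definition quotvs_scale (c : F) (q : quotvs) : quotvs := qproj (c *: qrepr q).

Lemma quotvs_scaleE c u : quotvs_scale c (qproj u) = qproj (c *: u).
Proof. by apply/eqP; rewrite eq_qproj -scalerBr memvZ ?qreprP. Qed.

Fact quotvs_scalerA a b q :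
  quotvs_scale a (quotvs_scale b q) = quotvs_scale (a * b) q.
Proof. by rewrite -[q]qreprK !quotvs_scaleE scalerA. Qed.

Fact quotvs_scale1r : left_id 1 quotvs_scale.
Proof. by move=> q; rewrite -[q]qreprK quotvs_scaleE scale1r. Qed.

Fact quotvs_scalerDr : right_distributive quotvs_scale +%R.
Proof.
move=> a p q; rewrite -[p]qreprK -[q]qreprK -qprojD !quotvs_scaleE scalerDr.
by rewrite qprojD.
Qed.

Fact quotvs_scalerDl q : {morph quotvs_scale^~ q : a b / a + b}.
Proof.
by move=> a b; rewrite -[q]qreprK !quotvs_scaleE scalerDl qprojD.
Qed.

HB.instance Definition _ := GRing.Zmodule_isLmodule.Build F quotvs
  quotvs_scalerA quotvs_scale1r quotvs_scalerDr quotvs_scalerDl.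

Fact qproj_is_linear : linear qproj.
Proof. by move=> a u w; rewrite qprojD -quotvs_scaleE. Qed.

HB.instance Definition _ :=
  GRing.isLinear.Build F V quotvs _ qproj qproj_is_linear.

Lemma qproj_eq0 u : (qproj u == 0) = (u \in U).
Proof. by rewrite -(linear0 qproj) eq_qproj subr0. Qed.

Import VectorInternalTheory.

Fact quotvs_vect_iso : Vector.axiom (\dim (U^C)%VS) quotvs.
Proof.
pose p u := vsproj (U^C)%VS (u - projv U u).
have p_lin : linear p.
  by move=> a u w; rewrite /p linearP opprD addrACA -scalerBr linearP.
have p_eq u w : qproj u = qproj w -> p u = p w.
  move/eqP; rewrite eq_qproj => uwU; congr vsproj; apply: subr0_eq.
  have := projv_id uwU; rewrite linearB /= => projE.
  by rewrite opprD addrACA -opprD projE subrr.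
have pK u : qproj (vsval (p u)) = qproj u.
  apply/eqP; rewrite /p vsprojK ?memv_projC // eq_qproj addrAC subrr add0r.
  by rewrite rpredN memv_proj.
exists (fun q => v2r (p (qrepr q))).
  move=> a q r; rewrite (_ : p _ = a *: p (qrepr q) + p (qrepr r)) ?linearP //.
  by rewrite -p_lin; apply: p_eq; rewrite qreprK linearP /= !qreprK.
exists (fun rw => qproj (vsval (r2v rw : subvs_of (U^C)%VS))).
  by move=> q; rewrite v2rK pK qreprK.
move=> rw; rewrite -[RHS]r2vK; congr v2r.
set w := r2v rw; rewrite (p_eq _ (vsval w)) ?qreprK //.
have wUC := subvsP w; rewrite /p (_ : projv U _ = 0) ?subr0 ?vsvalK //.
by apply/eqP; rewrite -memv_ker lker_proj.
Qed.

HB.instance Definition _ := Lmodule_hasFinDim.Build F quotvs quotvs_vect_iso.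

End QuotientSpace.

Record quiver := Quiver {
  vert : finType;
  edge : finType;
  tl : edge -> vert;
  hd : edge -> vert }.

Section Representations.
Variables (Q : quiver) (F : fieldType).

Record qrep := QRep {
  rsp : vert Q -> vectType F;
  rmap : forall a : edge Q, 'Hom(rsp (tl a), rsp (hd a)) }.

Record subrep (M : qrep) := SubRep {
  svs :> forall i, {vspace rsp M i};
  subrepP : forall a, (rmap M a @: svs (tl a) <= svs (hd a))%VS }.

(* [vsproj] only serves to land in the subspace type: by [subrepP] its argument
   already lies in [N (hd a)]. *)
Definition sub_qrep (M : qrep) (N : subrep M) : qrep :=
  @QRep (fun i => subvs_of (N i))
    (fun a => linfun (vsproj (N (hd a))) \o rmap M a
                \o linfun (@vsval _ _ (N (tl a))))%VF.

Definition quot_qrep (M : qrep) (N : subrep M) : qrep :=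
  @QRep (fun i => quotvs (N i))
    (fun a => linfun (fun q : quotvs (N (tl a)) =>
                       qproj (N (hd a)) (rmap M a (qrepr q)))).

Lemma sub_qrepE (M : qrep) (N : subrep M) a (u : subvs_of (N (tl a))) :
  vsval (rmap (sub_qrep N) a u) = rmap M a (vsval u).
Proof.
rewrite /= !comp_lfunE !lfunE /= vsprojK //.
by apply: (subvP (subrepP N a)); rewrite memv_img ?subvsP.
Qed.

Lemma quot_qrepE (M : qrep) (N : subrep M) a u :
  rmap (quot_qrep N) a (qproj (N (tl a)) u) = qproj (N (hd a)) (rmap M a u).
Proof.
have wd w w' : qproj (N (tl a)) w = qproj (N (tl a)) w' ->
    qproj (N (hd a)) (rmap M a w) = qproj (N (hd a)) (rmap M a w').
  move/eqP; rewrite eq_qproj => wN; apply/eqP; rewrite eq_qproj -linearB.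
  by apply: (subvP (subrepP N a)); rewrite memv_img.
pose g (q : quotvs (N (tl a))) := qproj (N (hd a)) (rmap M a (qrepr q)).
have g_lin : linear g.
  move=> c q r; rewrite /g (wd _ (c *: qrepr q + qrepr r)).
    by rewrite linearP /= linearP.
  by rewrite linearP /= !qreprK.
pose gL := GRing.isLinear.Build F _ _ _ g g_lin.
pose G : {linear quotvs (N (tl a)) -> quotvs (N (hd a))} := HB.pack g gL.
rewrite /= -[linfun _]/(linfun G) lfunE /= /g; apply: wd; exact: qreprK.
Qed.

Fact subrep_in_proof (M : qrep) (N N' : subrep M) a :
  (rmap (sub_qrep N) a @: (linfun (@vsval _ _ (N (tl a))) @^-1: N' (tl a))
     <= linfun (@vsval _ _ (N (hd a))) @^-1: N' (hd a))%VS.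
Proof.
apply/subvP => _ /memv_imgP[u uN' ->].
move: uN'; rewrite -!memv_preim lfunE [in X in _ -> X]lfunE [_ u]/= => uN'.
rewrite [X in X \in _](sub_qrepE (N := N)).
by apply: (subvP (subrepP N' a)); rewrite memv_img.
Qed.

(* [N'] (in the application a subrepresentation contained in [N]) seen as a
   subrepresentation of the representation [N]. *)
Definition subrep_in (M : qrep) (N N' : subrep M) : subrep (sub_qrep N) :=
  @SubRep (sub_qrep N)
    (fun i => linfun (@vsval _ _ (N i)) @^-1: N' i)%VS (subrep_in_proof N N').

Definition qiso (M N : qrep) : Prop :=
  exists f : forall i, 'Hom(rsp M i, rsp N i),
    (forall i, bijective (f i)) /\
    (forall a, (f (hd a) \o rmap M a = rmap N a \o f (tl a))%VF).

Definition dimvec (M : qrep) (i : vert Q) : nat := \dim {: rsp M i}.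

Definition slope (alpha : vert Q -> int) (M : qrep) : rat :=
  (\sum_i alpha i * (dimvec M i)%:Z)%:~R / (\sum_i dimvec M i)%N%:R.

Definition stable (alpha : vert Q -> int) (M : qrep) : Prop :=
  (exists i, dimvec M i != 0%N) /\
  forall N : subrep M,
    (exists i, N i != 0%VS) -> (exists i, N i != fullv) ->
    slope alpha (sub_qrep N) < slope alpha M.

(* A filtration 0 = Y 0 <= Y 1 <= ... <= Y n = M by subrepresentations (the
   values of [Y] beyond [n] are irrelevant) with [k]-th quotient isomorphic to
   [X k]; indices of [X] start at 0. *)
Definition has_filtration (M : qrep) (n : nat) (X : 'I_n -> qrep) : Prop :=
  exists Y : nat -> subrep M,
    [/\ forall i, Y 0 i = 0%VS,
        forall i, Y n i = fullv,
        forall (k : 'I_n) i, (Y k i <= Y k.+1 i)%VS &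
        forall k : 'I_n, qiso (quot_qrep (subrep_in (Y k.+1) (Y k))) (X k)].

(* Paths from [i] to [j], listed from the first edge travelled to the last. *)
Inductive qpath : vert Q -> vert Q -> Type :=
| qnil i : qpath i i
| qcons (a : edge Q) j of qpath (hd a) j : qpath (tl a) j.

Fixpoint qlength i j (p : qpath i j) : nat :=
  match p with qnil _ => 0 | qcons _ _ p' => (qlength p').+1 end.

Record qrelation := QRelation {
  rel_tl : vert Q;
  rel_hd : vert Q;
  rel_terms : seq (F * qpath rel_tl rel_hd);
  rel_length : all (fun c => 2 <= qlength c.2)%N rel_terms }.

End Representations.

(* V_i is C^(v i) with its standard Hermitian form. *)

Section RepSpace.
Variables (R : realType) (Q : quiver) (v : vert Q -> nat).
Notation C := R[i].

Definition Rep := forall a : edge Q, 'M[C]_(v (hd a), v (tl a)).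

Implicit Types (x y : Rep) (u : forall i, 'M[C]_(v i)) (alpha : vert Q -> int).

Definition qrep_of x : qrep Q C :=
  @QRep Q C (fun i => 'cV[C]_(v i)) (fun a => linfun (mulmx (x a))).

Fixpoint path_eval x (i j : vert Q) (p : qpath i j) : 'M[C]_(v j, v i) :=
  match p in qpath i j return 'M[C]_(v j, v i) with
  | qnil i => 1%:M
  | qcons a j p' => path_eval x p' *m x a
  end.

Definition relation_eval x (r : qrelation Q C) : 'M[C]_(v (rel_hd r), v (rel_tl r)) :=
  \sum_(c <- rel_terms r) c.1 *: path_eval x c.2.

(* x \in nu^-1(0), for a finite family of relations. *)
Definition nu0 (m : nat) (rels : 'I_m -> qrelation Q C) x : Prop :=
  forall r, relation_eval x (rels r) = 0.

Definition in_G (g : forall i, 'M[C]_(v i)) : Prop := forall i, g i \in unitmx.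

Definition gact (g : forall i, 'M[C]_(v i)) x : Rep :=
  fun a => g (hd a) *m x a *m invmx (g (tl a)).

Definition rho x u : Rep := fun a => u (hd a) *m x a - x a *m u (tl a).

(* In End(\oplus_i V_i) the commutator [x_a, x_a^*] has the two diagonal blocks
   x_a x_a^* at hd a and - x_a^* x_a at tl a, and no others.  The sizes match
   propositionally under the summation conditions, so that [conform_mx 0] is
   the corresponding cast. *)
Definition mu x (i : vert Q) : 'M[C]_(v i) :=
  (2 * 'i%C)^-1 *:
    (\sum_(a | hd a == i) conform_mx 0 (x a *m (x a)^t*)
     - \sum_(a | tl a == i) conform_mx 0 ((x a)^t* *m x a)).

Definition central alpha (i : vert Q) : 'M[C]_(v i) := ('i%C * (alpha i)%:~R)%:M.

Definition mu_sub alpha x (i : vert Q) : 'M[C]_(v i) := mu x i - central alpha i.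

Definition admissible alpha : Prop := \sum_i alpha i * (v i)%:Z = 0.

(* The gradient of ||mu - alpha||^2 at x is proportional to
   i rho_x (mu x - alpha). *)
Definition critical alpha x : Prop := forall a, rho x (mu_sub alpha x) a = 0.

(* [X] lists the eigenspaces of i (mu x - alpha), graded by the vertices, for
   its distinct eigenvalues [lam k].  This endomorphism is self-adjoint, so that
   the lam k are real and the sum is automatically direct and orthogonal. *)
Definition critical_decomposition alpha x (n : nat)
    (X : 'I_n -> subrep (qrep_of x)) : Prop :=
  exists lam : 'I_n -> C,
    [/\ injective lam,
        forall k i, X k i =
          passmx.leigenspace
            (linfun (mulmx ('i%C *: mu_sub alpha x i)) : 'End('cV[C]_(v i)))
            (lam k),
        forall k, exists i, X k i != 0%VS &
        forall i, (\sum_k X k i)%VS = fullv].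

(* d/dt phi = - i rho_phi (mu phi - alpha) on ]-oo, 0], phi 0 = y; the derivative
   is taken on the real and imaginary parts of all matrix entries. *)
Definition backward_flow_line alpha y (phi : R -> Rep) : Prop :=
  (forall a, phi 0 a = y a) /\
  forall t : R, t <= 0 -> forall a p q,
    let dphi := - ('i%C *: rho (phi t) (mu_sub alpha (phi t)) a) in
    is_derive t 1 (fun s : R => complex.Re (phi s a p q)) (complex.Re (dphi p q)) /\
    is_derive t 1 (fun s : R => complex.Im (phi s a p q)) (complex.Im (dphi p q)).

Definition unstable_set (m : nat) (rels : 'I_m -> qrelation Q C) alpha x y : Prop :=
  nu0 rels y /\
  exists phi : R -> Rep,
    backward_flow_line alpha y phi /\
    forall a p q,
      (complex.Re (phi t a p q) @[t --> -oo] --> complex.Re (x a p q))%classic /\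
      (complex.Im (phi t a p q) @[t --> -oo] --> complex.Im (x a p q))%classic.

End RepSpace.

(* Main.v *)
(** A representation z is viewed as a family of endomorphisms z_a of the sum V
    of the V_i.  With h(z) = alpha + 1/2 sum_a [z_a, z_a^*] the flow reads
    z' = z h(z) - h(z) z, and h(x) = sum_k lambda_k pi_k, where pi_k projects
    onto the summand x_k and lambda_k is its slope.

    Let phi be a flow line tending to x at -oo.  Euler products of
    1 + epsilon h(phi) converge to intertwiners from phi(-j tau) to
    phi(-(j+1) tau), which tend to some sum_k f_k pi_k with f_k increasing.  A
    graph transform gives flags that are invariant under the intertwiners, hence
    under phi, and that tend to the flag of the pi_k.  On each graded piece, the
    normalized products of the intertwiners have a nonzero limit along an
    ultrafilter, a morphism from the piece of phi(0) to x_k, and a comparison of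
    slopes shows that it is an isomorphism because x_k is stable.

    Conversely, a filtered y is conjugate to x + delta with delta strictly block
    triangular.  Since the slopes are rational, lambda_k = c_0 + c_k / M with
    natural numbers c_k, and conjugation by sum_k s^(c_k) pi_k leads to a
    polynomial curve y(s) = sum_m s^m y_m with y_0 = x and, for s = e^(t/M),
    y' = y h(x) - h(x) y.  A gauge series g(s) = 1 + sum_(m > 0) s^m g_m turns it
    into a flow line phi with phi g = g y: its coefficients solve linear equations
    that are uniformly invertible by a positivity argument, and majorants give
    the convergence for small s.  *)
From HB Require Import structures.
Require Import Defs.
From mathcomp Require Import all_boot all_order all_algebra.
From mathcomp Require Import complex.
From mathcomp Require Import boolp classical_sets reals topology normedtype derive.
From mathcomp Require Import filter sequences realfun exp.
From mathcomp Require Import ring lra.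

Set Implicit Arguments.
Unset Strict Implicit.
Unset Printing Implicit Defensive.

Import Order.TTheory GRing.Theory Num.Theory.
Import numFieldNormedType.Exports.

Local Open Scope ring_scope.
Local Open Scope sesquilinear_scope.


(** * Identities in noncommutative rings *)

(** Neither existence nor uniqueness of solutions of differential equations is invoked: a given flow
    line enters only through its first order expansion with quadratic remainder, and the flow line
    to be constructed is an explicit power series.

    The obstacle in the first half is that all [phi(t)] are isomorphic to [y], whereas [x] in
    general is not: the intertwiners degenerate towards -oo. The growth rates [f_k] separate the
    summands. Inside one summand no rates are left, and stability takes over: a kernel of the limit
    morphism would have larger slope than [x_k], and its images under the intertwiners would
    accumulate at a subrepresentation of [x_k] of that same slope.

    In the second half the coefficient [g_m] also enters through its adjoint, so that its equation
    is only real linear. Its hermitian part is governed by a positive operator, and its skew part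
    becomes trivial because the moment map is equivariant under unitary matrices. The solutions are
    bounded uniformly in [m > 0] because [m / M >= 1 / M]; this is where a common denominator of the
    slopes is used. *)

Inductive nc_expr :=
| NCvar of nat | NCzero | NCone
| NCadd of nc_expr & nc_expr | NCopp of nc_expr | NCmul of nc_expr & nc_expr.

Fixpoint nc_expand (e : nc_expr) : seq (bool * seq nat) :=
  match e with
  | NCvar n => [:: (false, [:: n])]
  | NCzero => [::]
  | NCone => [:: (false, [::])]
  | NCadd a b => nc_expand a ++ nc_expand b
  | NCopp a => [seq (~~ w.1, w.2) | w <- nc_expand a]
  | NCmul a b => [seq (u.1 (+) w.1, u.2 ++ w.2) | u <- nc_expand a, w <- nc_expand b]
  end.

(* The signed words in the expansion of [e] cancel in pairs. *)
Definition nc_norm (e : nc_expr) : bool :=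
  let l := nc_expand e in
  perm_eq [seq w.2 | w <- l & ~~ w.1] [seq w.2 | w <- l & w.1].

Section NCEval.
Variables (T : pzRingType) (env : seq T).

Fixpoint nc_eval (e : nc_expr) : T :=
  match e with
  | NCvar n => env`_n
  | NCzero => 0
  | NCone => 1
  | NCadd a b => nc_eval a + nc_eval b
  | NCopp a => - nc_eval a
  | NCmul a b => nc_eval a * nc_eval b
  end.

Definition nc_word (w : seq nat) : T := \prod_(i <- w) env`_i.
Definition nc_sign (w : bool * seq nat) : T := if w.1 then - nc_word w.2 else nc_word w.2.

Lemma nc_expandP e : nc_eval e = \sum_(w <- nc_expand e) nc_sign w.
Proof.
elim: e => [n|||a IHa b IHb|a IHa|a IHa b IHb] /=.
- by rewrite big_seq1 /nc_sign /nc_word /= big_seq1.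
- by rewrite big_nil.
- by rewrite big_seq1 /nc_sign /nc_word /= big_nil.
- by rewrite big_cat /= IHa IHb.
- rewrite IHa -sumrN big_map; apply: eq_bigr => w _; rewrite /nc_sign /=.
  by case: w.1; rewrite ?opprK.
- rewrite big_allpairs_dep IHa IHb mulr_suml; apply: eq_bigr => u _.
  rewrite mulr_sumr; apply: eq_bigr => w _.
  rewrite /nc_sign /nc_word /= big_cat /=.
  by case: u.1; case: w.1; rewrite /= ?mulrNN ?mulrN ?mulNr.
Qed.

Lemma nc_normP a b : nc_norm (NCadd a (NCopp b)) -> nc_eval a = nc_eval b.
Proof.
move=> nab; apply/eqP; rewrite -subr_eq0; apply/eqP.
rewrite -[LHS]/(nc_eval (NCadd a (NCopp b))) nc_expandP.
set l := nc_expand _; have pl : perm_eq [seq w.2 | w <- l & ~~ w.1] [seq w.2 | w <- l & w.1] := nab.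
rewrite (bigID (fun w => w.1)) /= addrC.
have pos : \sum_(w <- l | ~~ w.1) nc_sign w = \sum_(w <- [seq w.2 | w <- l & ~~ w.1]) nc_word w.
  by rewrite big_map big_filter; apply: eq_bigr => w /negbTE; rewrite /nc_sign => ->.
have neg : \sum_(w <- l | w.1) nc_sign w = - \sum_(w <- [seq w.2 | w <- l & w.1]) nc_word w.
  by rewrite big_map big_filter -sumrN; apply: eq_bigr => w; rewrite /nc_sign => ->.
by rewrite pos neg (perm_big _ pl) subrr.
Qed.

(** A substitute for rewriting modulo ring identities: [e] is a two-sided combination of differences
    that vanish by hypothesis, so that [e = 0] follows by rewriting, and [a - b = e] is left to
    [ncring]. *)
Lemma nc_lincomb (a b e : T) : e = 0 -> a - b = e -> a = b.
Proof. by move=> -> /subr0_eq. Qed.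

End NCEval.

Ltac nc_index x env :=
  lazymatch env with
  | x :: _ => constr:(0%N)
  | _ :: ?l => let n := nc_index x l in constr:(n.+1)
  end.
Ltac nc_mem x env :=
  lazymatch env with
  | nil => constr:(false)
  | x :: _ => constr:(true)
  | _ :: ?l => nc_mem x l
  end.
Ltac nc_env e env :=
  lazymatch e with
  | GRing.add ?a ?b => let env := nc_env a env in nc_env b env
  | GRing.opp ?a => nc_env a env
  | GRing.mul ?a ?b => let env := nc_env a env in nc_env b env
  | @GRing.zero _ => env
  | @GRing.one _ => env
  | _ => let m := nc_mem e env in
         lazymatch m with true => env | false => constr:(e :: env) end
  end.
Ltac nc_reify e env :=
  lazymatch e with
  | GRing.add ?a ?b => let a := nc_reify a env in let b := nc_reify b env in constr:(NCadd a b)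
  | GRing.opp ?a => let a := nc_reify a env in constr:(NCopp a)
  | GRing.mul ?a ?b => let a := nc_reify a env in let b := nc_reify b env in constr:(NCmul a b)
  | @GRing.zero _ => constr:(NCzero)
  | @GRing.one _ => constr:(NCone)
  | _ => let n := nc_index e env in constr:(NCvar n)
  end.
(** The cancellation of words is checked by computation. Every term not built from sums, opposites,
    products, 0 and 1 is an atom, so that facts such as the centrality of [rscale r 1] have to be
    supplied through [nc_lincomb]. *)
Ltac ncring :=
  lazymatch goal with
  | |- @eq ?T ?a ?b =>
    let env := nc_env a (@nil T) in let env := nc_env b env in
    let a' := nc_reify a env in let b' := nc_reify b env in
    exact (@nc_normP _ env a' b' (eq_refl true <: nc_norm (NCadd a' (NCopp b')) = true))
  end.

(** * Norms and adjoints of complex matrices *)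

Section MatrixNorm.
Variables (R : realType) (d : nat).
Notation C := R[i].
Notation A := 'M[C]_d.
Implicit Types (z w : C) (a b : A).

(** The [l^1] norm on pairs of a real and an imaginary part. It is submultiplicative, hence so is
    [nrm], and it bounds the real coordinates in which the flow equation is stated. *)
Definition abs1 z : R := `|complex.Re z| + `|complex.Im z|.

Definition nrm a : R := \sum_p \sum_q abs1 (a p q).

Definition adj a : A := a^t*.

Definition rtr a : R := complex.Re (\tr a).

(** Real scalars mostly occur as the central factor [rscale r 1], the form that noncommutative ring
    identities can handle. *)
Definition rscale (r : R) a : A := (r%:C)%C *: a.

Lemma abs1_ge0 z : 0 <= abs1 z. Proof. by rewrite addr_ge0. Qed.

Lemma abs1D z w : abs1 (z + w) <= abs1 z + abs1 w.
Proof.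
case: z w => [x y] [x' y']; rewrite /abs1 /=.
by rewrite [leRHS]addrACA lerD ?ler_normD.
Qed.

Lemma abs1M z w : abs1 (z * w) <= abs1 z * abs1 w.
Proof.
case: z w => [x y] [x' y']; rewrite /abs1 /=.
apply: (@le_trans _ _ ((`|x| * `|x'| + `|y| * `|y'|) + (`|x| * `|y'| + `|y| * `|x'|))).
  by rewrite -!normrM lerD ?ler_normD // ?(le_trans (ler_normB _ _)) // ?[y * x']mulrC ?ler_normD.
by rewrite le_eqVlt; apply/orP; left; apply/eqP; ring.
Qed.

Lemma abs1_eq0 z : abs1 z = 0 -> z = 0.
Proof.
case: z => x y; rewrite /abs1 /= => /eqP; rewrite paddr_eq0 // !normr_eq0.
by case/andP => /eqP -> /eqP ->.
Qed.

Lemma nrm_ge0 a : 0 <= nrm a.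
Proof. by do 2!apply: sumr_ge0 => ? _; exact: abs1_ge0. Qed.

Lemma nrmD a b : nrm (a + b) <= nrm a + nrm b.
Proof.
rewrite /nrm -big_split /=; apply: ler_sum => p _; rewrite -big_split /=.
by apply: ler_sum => q _; rewrite mxE abs1D.
Qed.

Lemma nrmN a : nrm (- a) = nrm a.
Proof. by apply: eq_bigr => p _; apply: eq_bigr => q _; rewrite mxE /abs1; case: (a p q) => x y /=; rewrite !normrN. Qed.

Lemma nrmB a b : nrm (a - b) <= nrm a + nrm b.
Proof. by rewrite (le_trans (nrmD _ _)) ?nrmN. Qed.

Lemma nrm0 : nrm 0 = 0.
Proof. by rewrite /nrm big1 // => p _; rewrite big1 // => q _; rewrite mxE /abs1 /= normr0 addr0. Qed.

Lemma abs1_le_nrm a p q : abs1 (a p q) <= nrm a.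
Proof.
rewrite /nrm (bigD1 p) //= (bigD1 q) //= -addrA lerDl addr_ge0 //.
  by apply: sumr_ge0 => ? _; exact: abs1_ge0.
by do 2!apply: sumr_ge0 => ? _; exact: abs1_ge0.
Qed.

Lemma nrm_eq0 a : nrm a = 0 -> a = 0.
Proof.
move=> a0; apply/matrixP => p q; rewrite mxE; apply: abs1_eq0; apply/le_anti.
by rewrite abs1_ge0 -a0 abs1_le_nrm.
Qed.

Lemma nrm_sum (I : Type) (s : seq I) (P : pred I) (F : I -> A) :
  nrm (\sum_(i <- s | P i) F i) <= \sum_(i <- s | P i) nrm (F i).
Proof.
elim/big_ind2: _ => [|u x v y ux vy|//]; first by rewrite nrm0.
exact: le_trans (nrmD _ _) (lerD ux vy).
Qed.

Lemma abs1_sum (I : Type) (s : seq I) (P : pred I) (F : I -> C) :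
  abs1 (\sum_(i <- s | P i) F i) <= \sum_(i <- s | P i) abs1 (F i).
Proof.
elim/big_ind2: _ => [|u x v y ux vy|//]; first by rewrite /abs1 /= normr0 addr0.
exact: le_trans (abs1D _ _) (lerD ux vy).
Qed.

Lemma nrmM a b : nrm (a * b) <= nrm a * nrm b.
Proof.
rewrite /nrm mulr_suml; apply: ler_sum => p _.
apply: (@le_trans _ _ (\sum_q \sum_r abs1 (a p r) * abs1 (b r q))).
  apply: ler_sum => q _; rewrite mxE; apply: (le_trans (abs1_sum _ _ _)).
  by apply: ler_sum => r _; exact: abs1M.
rewrite exchange_big /= mulr_suml; apply: ler_sum => r _.
rewrite -mulr_sumr; apply: ler_wpM2l; first exact: abs1_ge0.
rewrite [leRHS](bigD1 r) //= lerDl; do 2!apply: sumr_ge0 => ? _; exact: abs1_ge0.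
Qed.

Lemma nrm_adj a : nrm (adj a) = nrm a.
Proof.
rewrite /nrm exchange_big /=; apply: eq_bigr => p _; apply: eq_bigr => q _.
by rewrite !mxE /abs1; case: (a p q) => x y /=; rewrite normrN.
Qed.

Lemma nrm_rscale r a : nrm (rscale r a) = `|r| * nrm a.
Proof.
rewrite /nrm mulr_sumr; apply: eq_bigr => p _; rewrite mulr_sumr; apply: eq_bigr => q _.
by rewrite !mxE /abs1; case: (a p q) => x y /=; rewrite !mul0r addr0 subr0 !normrM mulrDr.
Qed.

Lemma rscaleE r a : rscale r a = rscale r 1 * a.
Proof. by have := scalemxAl (r%:C)%C 1%:M a; rewrite mul1mx. Qed.

Lemma rscale_comm r a : rscale r 1 * a = a * rscale r 1.
Proof.
by have := scalemxAr (r%:C)%C a 1%:M; rewrite mulmx1 -/(rscale r a) rscaleE => ->.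
Qed.

Lemma rscaleD r s : rscale (r + s) 1 = rscale r 1 + rscale s 1.
Proof. by rewrite /rscale rmorphD scalerDl. Qed.
Lemma rscaleN r : rscale (- r) 1 = - rscale r 1.
Proof. by rewrite /rscale rmorphN scaleNr. Qed.
Lemma rscaleM r s : rscale (r * s) 1 = rscale r 1 * rscale s 1.
Proof. by rewrite -rscaleE /rscale rmorphM scalerA. Qed.
Lemma rscale1 : rscale 1 1 = 1. Proof. by rewrite /rscale scale1r. Qed.
Lemma rscale0 : rscale 0 1 = 0. Proof. by rewrite /rscale scale0r. Qed.

Lemma adjD a b : adj (a + b) = adj a + adj b.
Proof. by apply/matrixP => p q; rewrite !mxE rmorphD. Qed.
Lemma adjN a : adj (- a) = - adj a.
Proof. by apply/matrixP => p q; rewrite !mxE rmorphN. Qed.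
Lemma adjB a b : adj (a - b) = adj a - adj b.
Proof. by rewrite adjD adjN. Qed.
Lemma adjM a b : adj (a * b) = adj b * adj a.
Proof.
apply/matrixP => p q; rewrite !mxE rmorph_sum; apply: eq_bigr => r _.
by rewrite !mxE rmorphM mulrC.
Qed.
Lemma adjK a : adj (adj a) = a. Proof. exact: trmxCK. Qed.
Lemma adj0 : adj 0 = 0. Proof. by apply/matrixP => p q; rewrite !mxE rmorph0. Qed.
Lemma adj1 : adj 1 = 1.
Proof. by apply/matrixP => p q; rewrite !mxE rmorph_nat eq_sym. Qed.
Lemma adj_rscale r a : adj (rscale r a) = rscale r (adj a).
Proof.
apply/matrixP => p q; rewrite !mxE rmorphM; congr (_ * _).
by apply/eqP; rewrite eq_complex /= oppr0 !eqxx.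
Qed.
Lemma adj_sum (I : Type) (s : seq I) (P : pred I) (F : I -> A) :
  adj (\sum_(i <- s | P i) F i) = \sum_(i <- s | P i) adj (F i).
Proof. by elim/big_ind2: _ => [|u x v y <- <-|//]; rewrite ?adj0 ?adjD. Qed.

Lemma rtrD a b : rtr (a + b) = rtr a + rtr b.
Proof. by rewrite /rtr mxtraceD raddfD. Qed.
Lemma rtrN a : rtr (- a) = - rtr a.
Proof. by rewrite /rtr raddfN /= raddfN. Qed.
Lemma rtrB a b : rtr (a - b) = rtr a - rtr b.
Proof. by rewrite rtrD rtrN. Qed.
Lemma rtr0 : rtr 0 = 0. Proof. by rewrite /rtr mxtrace0. Qed.
Lemma rtrC a b : rtr (a * b) = rtr (b * a).
Proof. by rewrite /rtr [\tr (a * b)]mxtrace_mulC. Qed.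
Lemma rtr_rscale r a : rtr (rscale r a) = r * rtr a.
Proof. by rewrite /rtr mxtraceZ; case: (\tr a) => x y /=; rewrite mul0r subr0. Qed.
Lemma rtr_sum (I : Type) (s : seq I) (P : pred I) (F : I -> A) :
  rtr (\sum_(i <- s | P i) F i) = \sum_(i <- s | P i) rtr (F i).
Proof. by elim/big_ind2: _ => [|u x v y <- <-|//]; rewrite ?rtr0 ?rtrD. Qed.

Lemma rtr_le_nrm a : `|rtr a| <= nrm a.
Proof.
apply: (@le_trans _ _ (abs1 (\tr a))); first by rewrite /abs1 lerDl.
apply: (le_trans (abs1_sum _ _ _)); apply: ler_sum => p _.
rewrite (bigD1 p) //= lerDl; apply: sumr_ge0 => ? _; exact: abs1_ge0.
Qed.

(** The square of the Hilbert-Schmidt norm. *)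
Definition sqn a : R := rtr (adj a * a).

Lemma sqnE a : sqn a = \sum_q \sum_p (complex.Re (a p q) ^+ 2 + complex.Im (a p q) ^+ 2).
Proof.
rewrite /sqn /rtr /mxtrace raddf_sum /=; apply: eq_bigr => q _.
rewrite mxE raddf_sum /=; apply: eq_bigr => p _; rewrite !mxE.
by case: (a p q) => x y /=; rewrite !expr2 mulNr opprK.
Qed.

Lemma abs1_sq z : abs1 z ^+ 2 <= 2 * (complex.Re z ^+ 2 + complex.Im z ^+ 2).
Proof.
case: z => x y; rewrite /abs1 /= -(real_normK (num_real x)) -(real_normK (num_real y)).
have := sqr_ge0 (`|x| - `|y|); nra.
Qed.

Lemma sqn_ge0 a : 0 <= sqn a.
Proof. by rewrite sqnE; do 2!apply: sumr_ge0 => ? _; rewrite addr_ge0 ?sqr_ge0. Qed.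

Lemma abs1_le_sqn a p q : abs1 (a p q) ^+ 2 <= 2 * sqn a.
Proof.
apply: (le_trans (abs1_sq _)); apply: ler_wpM2l => //.
rewrite sqnE (bigD1 q) //= (bigD1 p) //= -addrA lerDl addr_ge0 //.
  by apply: sumr_ge0 => ? _; rewrite addr_ge0 ?sqr_ge0.
by do 2!apply: sumr_ge0 => ? _; rewrite addr_ge0 ?sqr_ge0.
Qed.

Lemma nrm_le_sqn a : nrm a <= (d * d)%:R * Num.sqrt (2 * sqn a).
Proof.
have le1 p q : abs1 (a p q) <= Num.sqrt (2 * sqn a).
  by apply: le_trans (ler_wsqrtr (abs1_le_sqn a p q)); rewrite sqrtr_sqr ler_norm.
apply: (@le_trans _ _ (\sum_(p < d) \sum_(q < d) Num.sqrt (2 * sqn a))).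
  by do 2!apply: ler_sum => ? _.
under eq_bigr do rewrite sumr_const card_ord.
by rewrite sumr_const card_ord -mulrnA -[leLHS]mulr_natl.
Qed.

Lemma sqn_eq0 a : sqn a = 0 -> a = 0.
Proof.
move=> a0; apply: nrm_eq0; apply/le_anti; rewrite nrm_ge0 andbT.
by rewrite (le_trans (nrm_le_sqn _)) // a0 mulr0 sqrtr0 mulr0.
Qed.

(** The Hilbert-Schmidt norm of [a * b] is computed from [adj b * (adj a * a * b)]. *)
Lemma adj_mul_eq0 a b : adj a * a * b = 0 -> a * b = 0.
Proof.
move=> ab0; apply: sqn_eq0; rewrite /sqn adjM.
by rewrite -mulrA [adj a * _]mulrA ab0 mulr0 rtr0.
Qed.

(** A matrix [k] with [k * (1 + a) = 0] satisfies [k = - (k * a)], hence [nrm k <= nrm k / 2]. *)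
Lemma unit_near1 a : nrm a <= 1 / 2 -> (1 + a) \in unitmx.
Proof.
move=> a2; rewrite -row_free_unit -kermx_eq0.
suff -> : kermx (1 + a) = 0 by [].
have k0 : kermx (1 + a) *m (1 + a) = 0 by exact: mulmx_ker.
set k := kermx _ in k0 *; have ka : k = - (k * a).
  by apply/eqP; rewrite -subr_eq0 opprK -[X in X + _]mulr1 -mulrDr; apply/eqP.
apply: nrm_eq0; apply/le_anti; rewrite nrm_ge0 andbT.
have := le_trans (eq_ind_r (fun x => nrm x <= nrm (k * a)) (eq_ind_r (fun x => x <= _) (lexx _) (nrmN _)) ka) (nrmM k a).
have := nrm_ge0 k; nra.
Qed.

Lemma idem_rtr_eq0 p : p * p = p -> adj p = p -> rtr p = 0 -> p = 0.
Proof. by move=> pp pa p0; apply: sqn_eq0; rewrite /sqn pa pp. Qed.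

Lemma idem_rtr_ge0 p : p * p = p -> adj p = p -> 0 <= rtr p.
Proof. by move=> pp pa; have := sqn_ge0 p; rewrite /sqn pa pp. Qed.

(** For an orthogonal projection [sqn p] is [rtr p], and [rtr p <= rtr 1] because [1 - p] is an
    orthogonal projection too. This boundedness gives limits of subspaces along an ultrafilter. *)
Lemma idem_nrm_le p : p * p = p -> adj p = p -> nrm p <= (d * d)%:R * Num.sqrt (2 * nrm (1 : A)).
Proof.
move=> pp pa; apply: (le_trans (nrm_le_sqn _)); apply: ler_wpM2l; first exact: ler0n.
rewrite ler_wsqrtr // ler_wpM2l // /sqn pa pp.
have q0 : 0 <= rtr (1 - p).
  apply: idem_rtr_ge0; last by rewrite adjB adj1 pa.
  by rewrite mulrBr mulrBl mulr1 mul1r mulrBl mul1r pp subrr subr0.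
by apply: (le_trans _ (rtr_le_nrm 1)); apply: (le_trans _ (ler_norm _)); rewrite -subr_ge0 -rtrB.
Qed.

(* For any generalized inverse G of h^* h, the element G h^* works. *)
Lemma exists_pinv h : exists g, h * g * h = h /\ adj (h * g) = h * g.
Proof.
pose s := adj h * h; pose G := (pinvmx s : A).
have sGs : s * G * s = s by exact: mulmxKpV.
have s_adj : adj s = s by rewrite /s adjM adjK.
have hX X : s * X * s = s -> h * X * adj h * h = h.
  move=> sXs; apply/eqP; rewrite -subr_eq0; apply/eqP.
  have -> : h * X * adj h * h - h = h * (X * s - 1) by rewrite /s; ncring.
  by apply: adj_mul_eq0; rewrite -/s mulrBr mulr1 mulrA sXs subrr.
have e1 := hX _ sGs.
have e2 : h * adj G * adj h * h = h.
  by apply: hX; rewrite -{1 2}s_adj -mulrA -!adjM sGs s_adj.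
exists (G * adj h); split; first by rewrite mulrA.
(* With [u = h * G * adj h] one has [adj u * u = u], and the left-hand side is self-adjoint. *)
have uE : adj (h * (G * adj h)) = h * adj G * adj h by rewrite adjM [adj (G * _)]adjM adjK.
have pE : adj (h * (G * adj h)) * (h * (G * adj h)) = h * (G * adj h).
  by rewrite {1}uE mulrA e2.
by rewrite -[RHS]pE -{1}pE adjM adjK.
Qed.

(** For [g] from [exists_pinv], [p * g] is the orthogonal projection onto the image of [p], and it
    has the same trace as [p]. *)
Lemma idem_rtr0 p : p * p = p -> rtr p = 0 -> p = 0.
Proof.
have [g [pgp ga]] := exists_pinv p => pp p0.
have gg : (p * g) * (p * g) = p * g by rewrite mulrA pgp.
have q0 : p * g = 0.
  apply: idem_rtr_eq0 => //; rewrite -p0 -[in RHS]pgp [RHS]rtrC.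
  by rewrite mulrA pp.
by rewrite -pgp q0 mul0r.
Qed.

End MatrixNorm.
Arguments nrm {R d}.
Arguments adj {R d}.
Arguments rtr {R d}.
Arguments rscale {R d}.

(** * Limits of matrices along filters *)

Section MatrixLimits.
Variables (R : realType) (d : nat).
Notation A := 'M[R[i]]_d.
Variables (I : Type) (F : set_system I).

Definition cvA (u : I -> A) (a : A) : Prop := (nrm (u s - a) @[s --> F] --> (0 : R))%classic.

Context {FF : Filter F}.
Implicit Types (u v : I -> A) (a b : A).

Lemma cvg_toE (f : I -> R) (l l' : R) : (f s @[s --> F] --> l)%classic -> l = l' ->
  (f s @[s --> F] --> l')%classic.
Proof. by move=> fl <-. Qed.

Lemma cv0_le (f g : I -> R) : (\forall s \near F, 0 <= f s <= g s)%classic ->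
  (g s @[s --> F] --> (0 : R))%classic -> (f s @[s --> F] --> (0 : R))%classic.
Proof. by move=> fg g0; apply: (squeeze_cvgr fg) => //; exact: cvg_cst. Qed.

Lemma cvA_le_near u a (g : I -> R) : (\forall s \near F, nrm (u s - a) <= g s)%classic ->
  (g s @[s --> F] --> (0 : R))%classic -> cvA u a.
Proof.
move=> ug; apply: cv0_le; apply: filterS ug => s ->; by rewrite nrm_ge0.
Qed.

Lemma cvA_cst a : cvA (fun=> a) a.
Proof. by rewrite /cvA subrr nrm0; exact: cvg_cst. Qed.

Lemma cvA_near u v a : (\forall s \near F, u s = v s)%classic -> cvA u a -> cvA v a.
Proof.
by move=> uv; apply: cvA_le_near; apply: filterS uv => s ->.
Qed.

Lemma cvAD u v a b : cvA u a -> cvA v b -> cvA (fun s => u s + v s) (a + b).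
Proof.
move=> ua vb; apply: (@cvA_le_near _ _ (fun s => nrm (u s - a) + nrm (v s - b))).
  by apply: nearW => s; rewrite opprD addrACA nrmD.
by apply: (cvg_toE (cvgD ua vb)); rewrite addr0.
Qed.

Lemma cvAN u a : cvA u a -> cvA (fun s => - u s) (- a).
Proof. by apply: cvA_le_near; apply: nearW => s; rewrite -opprD nrmN. Qed.

Lemma cvAB u v a b : cvA u a -> cvA v b -> cvA (fun s => u s - v s) (a - b).
Proof. by move=> ua vb; apply: cvAD => //; exact: cvAN. Qed.

Lemma cvAM u v a b : cvA u a -> cvA v b -> cvA (fun s => u s * v s) (a * b).
Proof.
move=> ua vb.
apply: (@cvA_le_near _ _ (fun s => nrm (u s - a) * nrm (v s - b) +
   (nrm a * nrm (v s - b) + nrm (u s - a) * nrm b))).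
  apply: nearW => s.
  have -> : u s * v s - a * b = (u s - a) * (v s - b) + (a * (v s - b) + (u s - a) * b) by ncring.
  by do 2!apply: le_trans (nrmD _ _) (lerD (nrmM _ _) _); exact: nrmM.
apply: (@cvg_toE _ (0 * 0 + (nrm a * 0 + 0 * nrm b))); last by rewrite !(mul0r, mulr0) !addr0.
by apply: cvgD; [exact: cvgM | apply: cvgD; apply: cvgM => //; exact: cvg_cst].
Qed.

Lemma cvAMl b u a : cvA u a -> cvA (fun s => b * u s) (b * a).
Proof. by move=> ua; apply: cvAM => //; exact: cvA_cst. Qed.

Lemma cvAMr b u a : cvA u a -> cvA (fun s => u s * b) (a * b).
Proof. by move=> ua; apply: cvAM => //; exact: cvA_cst. Qed.

Lemma cvA_adj u a : cvA u a -> cvA (fun s => adj (u s)) (adj a).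
Proof. by apply: cvA_le_near; apply: nearW => s; rewrite -adjB nrm_adj. Qed.

Lemma cvA_sum (J : Type) (s : seq J) (P : pred J) (u : J -> I -> A) (a : J -> A) :
  (forall j, P j -> cvA (u j) (a j)) ->
  cvA (fun i => \sum_(j <- s | P j) u j i) (\sum_(j <- s | P j) a j).
Proof.
move=> ua; elim: s => [|j s IHs].
  by apply: (@cvA_near (fun=> 0)); [apply: nearW => i; rewrite big_nil|rewrite big_nil; exact: cvA_cst].
rewrite big_cons; case: ifP => Pj.
  apply: cvA_near (cvAD (ua j Pj) IHs); by apply: nearW => i; rewrite big_cons Pj.
by apply: cvA_near IHs; apply: nearW => i; rewrite big_cons Pj.
Qed.

Lemma cvA_lt u a (e : R) : cvA u a -> 0 < e -> (\forall s \near F, nrm (u s - a) < e)%classic.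
Proof.
move=> /cvgrPdist_lt ua /ua; apply: filterS => s.
by rewrite sub0r normrN ger0_norm ?nrm_ge0.
Qed.

Lemma cvA_nrm u a : cvA u a -> (nrm (u s) @[s --> F] --> nrm a)%classic.
Proof.
move=> ua; apply/cvgrPdist_lt => e e0.
have := cvA_lt ua e0; apply: filterS => s h.
have h1 : nrm a <= nrm (u s) + nrm (u s - a).
  by rewrite -[X in _ + X]nrmN (le_trans _ (nrmD _ _)) // opprB addrC subrK.
have h2 : nrm (u s) <= nrm a + nrm (u s - a).
  by rewrite (le_trans _ (nrmD _ _)) // addrC subrK.
by rewrite ltr_norml; apply/andP; split; lra.
Qed.

Lemma cvA_rtr b u a : cvA u a -> (rtr (b * u s) @[s --> F] --> rtr (b * a))%classic.
Proof.
move=> ua; apply/cvgrPdist_lt => e e0.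
have := cvA_lt (cvAM (cvA_cst b) ua) e0; apply: filterS => s h.
by rewrite distrC -rtrB (le_lt_trans (rtr_le_nrm _)).
Qed.

End MatrixLimits.

Section ProperLimits.
Variables (R : realType) (d : nat).
Notation A := 'M[R[i]]_d.
Variables (I : Type) (F : set_system I).
Context {FF : ProperFilter F}.
Implicit Types (u v : I -> A) (a b : A).

Lemma cvA_unique u a b : cvA F u a -> cvA F u b -> a = b.
Proof.
move=> ua ub; apply: subr0_eq; apply: nrm_eq0.
have h : (nrm (u s - u s) @[s --> F] --> nrm (a - b))%classic by exact: (cvA_nrm (cvAB ua ub)).
apply: (@cvg_unique R^o _ _ _ _ _ h) => //.
have -> : (fun s => nrm (u s - u s)) = fun=> 0 by apply/funext => s; rewrite subrr nrm0.
exact: cvg_cst.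
Qed.

Lemma cvA_eq u v a b : cvA F u a -> cvA F v b ->
  (\forall s \near F, u s = v s)%classic -> a = b.
Proof. by move=> ua vb uv; exact: (cvA_unique (cvA_near uv ua) vb). Qed.

Lemma cvA_nrm_le u a (B : R) : (\forall s \near F, nrm (u s) <= B)%classic ->
  cvA F u a -> nrm a <= B.
Proof. by move=> uB /cvA_nrm; move/cvgr_to_le; apply. Qed.

Lemma cvA_rtr_cst b u a (r : R) : (\forall s \near F, rtr (b * u s) = r)%classic ->
  cvA F u a -> rtr (b * a) = r.
Proof.
move=> ur ua; have h : (rtr (b * u s) @[s --> F] --> rtr (b * a))%classic by exact: cvA_rtr.
by apply: (@cvg_unique R^o _ _ _ _ _ h) => //; apply: cvg_near_cst.
Qed.

End ProperLimits.

(** * Compactness along an ultrafilter *)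

Section UltraLimits.
Variables (R : realType) (d : nat).
Notation A := 'M[R[i]]_d.
Variables (U : set_system nat).
Context {UU : UltraFilter U}.

(** The image of [U] is an ultrafilter on a compact interval. One fixed ultrafilter makes all
    bounded sequences converge at once, compatibly with sums and products, which replaces the
    extraction of common subsequences. *)
Lemma ultra_cvg (f : nat -> R) (B : R) : (forall s, `|f s| <= B) ->
  exists l : R, (f s @[s --> U] --> l)%classic.
Proof.
move=> fB; have := @segment_compact R (- B) B; rewrite compact_ultra /=.
have FU : UltraFilter (f @ U)%classic.
  split; first exact: fmap_proper_filter.
  move=> G GF UG; rewrite predeqE => S; split; last exact: UG.
  move=> GS; have [//|US] := in_ultra_setVsetC (f @^-1` S)%classic UU.
  have : G (~` S)%classic by apply: UG.
  by move=> /(filterI GS); rewrite setICr => /filter_ex [].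
move=> /(_ _ FU); case.
  by apply: nearW => s /=; rewrite in_itv /= -ler_norml.
by move=> l [_ fl]; exists l.
Qed.

Lemma ultra_cvA (u : nat -> A) (B : R) : (forall s, nrm (u s) <= B) ->
  exists a, cvA U u a.
Proof.
move=> uB.
have entry p q : exists z : R[i], (abs1 (u s p q - z) @[s --> U] --> (0 : R))%classic.
  have [x ux] : exists l : R, (complex.Re (u s p q) @[s --> U] --> l)%classic.
    apply: (@ultra_cvg _ B) => s; apply: le_trans (uB s).
    by apply: le_trans (abs1_le_nrm _ p q); rewrite lerDl.
  have [y uy] : exists l : R, (complex.Im (u s p q) @[s --> U] --> l)%classic.
    apply: (@ultra_cvg _ B) => s; apply: le_trans (uB s).
    by apply: le_trans (abs1_le_nrm _ p q); rewrite lerDr.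
  exists (Complex x y).
  have -> : (fun s => abs1 (u s p q - Complex x y)) =
            (fun s => `|complex.Re (u s p q) - x| + `|complex.Im (u s p q) - y|).
    by apply/funext => s; rewrite /abs1; case: (u s p q).
  have c0 (g : nat -> R) l : (g s @[s --> U] --> l)%classic -> (`|g s - l| @[s --> U] --> (0 : R))%classic.
    move=> gl; apply/cvgrPdist_lt => e e0; move/cvgrPdist_lt: gl => /(_ e e0).
    by apply: filterS => s; rewrite sub0r normrN normr_id distrC.
  by apply: (cvg_toE (cvgD (c0 _ _ ux) (c0 _ _ uy))); rewrite addr0.
pose a p := projT1 (choice (entry p)); have ua p := projT2 (choice (entry p)).
exists (\matrix_(p, q) a p q); rewrite /cvA /nrm.
apply: (@cvg_toE _ _ _ _ (\sum_(p < d) \sum_(q < d) 0)); last by rewrite big1 // => p _; rewrite big1.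
have sum0 (J : finType) (g : J -> nat -> R) : (forall j, (g j s @[s --> U] --> (0 : R))%classic) ->
    (\sum_j g j s @[s --> U] --> \sum_(j : J) (0 : R))%classic.
  move=> g0; elim: (index_enum J) => [|j s IHs].
    by rewrite big_nil; under eq_fun do rewrite big_nil; exact: cvg_cst.
  by rewrite big_cons; under eq_fun do rewrite big_cons; exact: (cvgD (g0 j) IHs).
apply: (@cvg_toE _ _ _ _ (\sum_(p < d) 0)); last by apply: eq_bigr => p _; rewrite big1.
apply: (sum0) => p; apply: (@cvg_toE _ _ _ _ (\sum_(q < d) 0)); last by rewrite big1.
by apply: (sum0) => q; have := ua p q; under [in X in _ -> X]eq_fun do rewrite !mxE.
Qed.

End UltraLimits.

(** * Limits of isomorphic representations *)

Section StableLimit.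
Variables (R : realType) (d : nat).
Notation A := 'M[R[i]]_d.
Variables (U : set_system nat).
Context {UU : UltraFilter U}.
Variables (T : Type) (Q : nat -> A) (M : nat -> T -> A) (S : nat -> A).
Variables (pi : A) (X : T -> A) (beta : A).
Hypothesis QQ : forall j, Q j * Q j = Q j.
Hypothesis Qpi : cvA U Q pi.
Hypothesis MX : forall t, cvA U (fun j => M j t) (X t).
Hypothesis pi0 : pi != 0.
Hypothesis QM : forall j t, Q j * M j t = M j t.
Hypothesis MQ : forall j t, M j t * Q j = M j t.
Hypothesis QS : forall j, Q j.+1 * S j = S j.
Hypothesis SM : forall j t, S j * M j t = M j.+1 t * S j.
Hypothesis S_inj : forall j v, Q j * v = v -> S j * v = 0 -> v = 0.
Hypothesis Sbeta : forall j, S j * beta = beta * S j.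
Hypothesis Qbeta : forall j, Q j * beta = beta * Q j.
Hypothesis trQ : rtr (Q 0) = rtr pi.
Hypothesis trbQ : rtr (beta * Q 0) = rtr (beta * pi).
Hypothesis trb : rtr (beta * pi) = 0.
(* [beta] is the stability parameter shifted to slope 0 on the image of [pi], so that
   [rtr (beta * s)] has the sign of the slope of the subrepresentation that is the
   image of the idempotent [s]. *)
Hypothesis stab : forall s, s * s = s -> pi * s = s -> (forall t, X t * s = s * X t * s) ->
  s != 0 -> s * pi != pi -> rtr (beta * s) < 0.

Fixpoint transport J : A := if J is J'.+1 then S J' * transport J' else Q 0.

Lemma transportQl J : Q J * transport J = transport J.
Proof. by case: J => [|J] /=; rewrite ?QQ // mulrA QS. Qed.
Lemma transportQr J : transport J * Q 0 = transport J.
Proof. by elim: J => [|J IH] /=; rewrite ?QQ // -mulrA IH. Qed.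
Lemma transport_inj J v : Q 0 * v = v -> transport J * v = 0 -> v = 0.
Proof.
move=> Qv; elim: J => [|J IH] /=; first by rewrite Qv.
rewrite -mulrA => h; apply: IH; apply: S_inj h.
by rewrite mulrA transportQl.
Qed.
Lemma transportM J t : transport J * M 0 t = M J t * transport J.
Proof. by elim: J => [|J IH] /=; rewrite ?QM ?MQ // -mulrA IH !mulrA SM. Qed.
Lemma transport_beta J : transport J * beta = beta * transport J.
Proof. by elim: J => [|J IH] /=; rewrite ?Qbeta // -mulrA IH !mulrA Sbeta. Qed.

(** [M j] is a representation on the image of [Q j], and [S j] an injective morphism to the next
    one. Injectivity of the limit [f] comes from [stab]; its surjectivity onto the image of [pi]
    then follows from the equality of ranks [trQ]. *)
Lemma stable_limit_iso : exists f g,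
  [/\ forall t, f * M 0 t = X t * f, pi * f = f, f * Q 0 = f & Q 0 * g = g] /\
  [/\ g * pi = g, f * g = pi & g * f = Q 0].
Proof.
have pipi : pi * pi = pi.
  by apply: (cvA_eq (cvAM Qpi Qpi) Qpi); apply: nearW => j; exact: QQ.
have pib : pi * beta = beta * pi.
  apply: (cvA_eq (cvAMr beta Qpi) (cvAMl beta Qpi)).
  by apply: nearW => j; exact: Qbeta.
have Q0 : Q 0 != 0.
  apply/eqP => Q00; case/eqP: pi0; apply: idem_rtr0 => //.
  by rewrite -trQ Q00 rtr0.
have tr_neq0 J : nrm (transport J) != 0.
  apply/eqP => /nrm_eq0 h; case/eqP: Q0; apply: (@transport_inj J) => //.
  by rewrite transportQr.
pose u J := rscale (nrm (transport J))^-1 (transport J).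
have u1 J : nrm (u J) = 1.
  by rewrite nrm_rscale ger0_norm ?invr_ge0 ?nrm_ge0 // mulVf.
have [f uf] : exists a, cvA U u a by apply: (@ultra_cvA _ _ _ _ _ 1) => s; rewrite u1.
have f1 : nrm f = 1.
  have h : (nrm (u s) @[s --> U] --> nrm f)%classic by exact: cvA_nrm.
  by apply: (@cvg_unique R^o _ _ _ _ _ h) => //; apply: cvg_near_cst; apply: nearW.
have f0 : f != 0 by apply/eqP => f0; move: f1; rewrite f0 nrm0 => /eqP; rewrite eq_sym oner_eq0.
have fM t : f * M 0 t = X t * f.
  apply: (cvA_eq (cvAMr (M 0 t) uf) (cvAM (MX t) uf)).
  apply: nearW => J; rewrite /u rscaleE -[LHS]mulrA transportM.
  by rewrite mulrA rscale_comm -mulrA.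
have pif : pi * f = f.
  apply: (cvA_eq (cvAM Qpi uf) uf); apply: nearW => J.
  by rewrite /u rscaleE mulrA -rscale_comm -mulrA transportQl.
have fQ : f * Q 0 = f.
  apply: (cvA_eq (cvAMr (Q 0) uf) uf); apply: nearW => J.
  by rewrite /u rscaleE -mulrA transportQr.
have fb : f * beta = beta * f.
  apply: (cvA_eq (cvAMr beta uf) (cvAMl beta uf)); apply: nearW => J.
  by rewrite /u rscaleE -mulrA transport_beta mulrA rscale_comm mulrA.
have [g0 [fgf _]] := exists_pinv f.
(* Placed between [Q 0] and [pi], the generalized inverse of [f] becomes a map from the image of
   [pi] to that of [Q 0]. *)
pose g := Q 0 * g0 * pi.
have {}fgf : f * g * f = f by rewrite /g !mulrA fQ -mulrA pif.
have Qg : Q 0 * g = g by rewrite /g !mulrA QQ.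
have gpi : g * pi = g by rewrite /g -!mulrA pipi.
clearbody g.
(* If f is not injective, its image has negative slope and its kernel, the image of
   the idempotent r below, positive slope.  The images of r under the transports then
   tend to a subrepresentation of X of positive slope. *)
suff gf : g * f = Q 0.
  exists f, g; split; split => //.
  apply/esym/subr0_eq/idem_rtr0.
    apply: (@nc_lincomb _ _ _ ((pi * pi - pi) - (pi * f - f) * g - f * (g * pi - g) + (f * g * f - f) * g)).
      by rewrite pipi pif gpi fgf !subrr !(mul0r, mulr0) !(subr0, addr0).
    by ncring.
  by rewrite rtrB rtrC gf trQ subrr.
pose r := Q 0 - g * f.
have rr : r * r = r.
  apply: (@nc_lincomb _ _ _ ((Q 0 * Q 0 - Q 0) - (Q 0 * g - g) * f - g * (f * Q 0 - f) + g * (f * g * f - f))).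
    by rewrite QQ Qg fQ fgf !subrr !(mul0r, mulr0) !(subr0, addr0).
  by rewrite /r; ncring.
have fr : f * r = 0 by rewrite /r mulrBr fQ mulrA fgf subrr.
have Qr : Q 0 * r = r by rewrite /r mulrBr QQ mulrA Qg.
have [r0|r0] := eqVneq r 0; first by apply/esym/subr0_eq.
have rtrr : rtr r != 0 by apply: contra_neq r0; exact: idem_rtr0.
pose s := f * g.
have ss : s * s = s by rewrite /s mulrA fgf.
have rtrs : rtr (beta * s) = - rtr (beta * r).
  rewrite /r mulrBr rtrB trbQ trb sub0r opprK /s.
  by rewrite mulrA -fb -mulrA rtrC mulrA.
have sneg : rtr (beta * s) < 0.
  apply: stab => //.
  - by rewrite /s mulrA pif.
  - move=> t; have Xs : X t * s = f * M 0 t * g by rewrite /s mulrA fM.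
    rewrite -mulrA Xs; apply: (@nc_lincomb _ _ _ (- (f * g * f - f) * M 0 t * g)).
      by rewrite fgf subrr !(oppr0, mul0r).
    by rewrite /s; ncring.
  - by apply: contra_neq f0 => s0; rewrite -fgf -/s s0 mul0r.
  rewrite /s -mulrA gpi; apply: contra_neq rtrr => sp.
  by rewrite /r rtrB trQ -sp rtrC subrr.
have {sneg} rpos : 0 < rtr (beta * r) by rewrite -oppr_lt0 -rtrs.
(* [p J] below is the orthogonal projection onto the image of [transport J * r]. Orthogonality keeps
   it bounded whatever the size of the transport, so that it has a limit [q] along [U]. *)
have hex J : exists k, transport J * r * k * (transport J * r) = transport J * r /\
    adj (transport J * r * k) = transport J * r * k by exact: exists_pinv.
have [k kP] := choice hex; pose p J := transport J * r * k J.
have pp J : p J * p J = p J by rewrite /p mulrA (kP J).1.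
have [q pq] : exists a, cvA U p a.
  apply: (@ultra_cvA _ _ _ _ _ ((d * d)%:R * Num.sqrt (2 * nrm (1 : A)))) => J.
  by apply: idem_nrm_le => //; exact: (kP J).2.
have qq : q * q = q by apply: (cvA_eq (cvAM pq pq) pq); apply: nearW.
have rkh J : r * k J * (transport J * r) = r.
  apply/subr0_eq/(@transport_inj J).
    by rewrite mulrBr !mulrA Qr.
  apply: (@nc_lincomb _ _ _ (transport J * r * k J * (transport J * r) - transport J * r)).
    by rewrite (kP J).1 subrr.
  by ncring.
(* The transport identifies the image of [r] with that of [p J]; hence the trace on it of an
   operator commuting with the transports does not depend on [J]. This is used for [beta] and for
   1. *)
have rtrp b : (forall J, transport J * b = b * transport J) -> r * b * r = b * r ->
    rtr (b * q) = rtr (b * r).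
  move=> tb rb; apply: (@cvA_rtr_cst _ _ _ _ _ _ _ _ _ _ pq); apply: nearW => J.
  have -> : b * p J = transport J * r * (b * r * k J).
    apply: (@nc_lincomb _ _ _ (- transport J * (r * b * r - b * r) * k J + (b * transport J - transport J * b) * r * k J)).
      by rewrite rb tb !subrr mulr0 !mul0r addr0.
    by rewrite /p; ncring.
  rewrite rtrC; congr rtr; rewrite -[in RHS](rkh J); ncring.
have rbr : r * beta * r = beta * r.
  rewrite {1}/r mulrBl Qbeta -[X in (X - _) * _]/(beta * Q 0) mulrBl -!mulrA Qr.
  by rewrite [f * (beta * r)]mulrA fb -mulrA fr !mulr0 subr0.
have rq : rtr (beta * q) = rtr (beta * r) by apply: rtrp rbr; exact: transport_beta.
have rq1 : rtr q = rtr r.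
  by have := rtrp 1; rewrite !mul1r mulr1 rr; apply => // J; rewrite mulr1 mul1r.
have piq : pi * q = q.
  by apply: (cvA_eq (cvAM Qpi pq) pq); apply: nearW => J; rewrite /p !mulrA transportQl.
have Xq t : X t * q = q * X t * q.
  apply: (cvA_eq (cvAM (MX t) pq) (cvAM (cvAM pq (MX t)) pq)); apply: nearW => J.
  have rMr : r * M 0 t * r = M 0 t * r.
    by rewrite {1}/r mulrBl QM mulrBl -!mulrA [f * (_ * r)]mulrA fM -mulrA fr !mulr0 subr0.
  have Mp : M J t * p J = transport J * r * (M 0 t * r * k J).
    rewrite /p !mulrA -transportM -[transport J * M 0 t * r]mulrA -{1}rMr.
    by ncring.
  rewrite -mulrA Mp.
  apply: (@nc_lincomb _ _ _ (- (transport J * r * k J * (transport J * r) - transport J * r) * (M 0 t * r * k J))).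
    by rewrite (kP J).1 subrr oppr0 mul0r.
  by rewrite /p; ncring.
have q0 : q != 0 by apply: contra_neq rtrr => q0; rewrite -rq1 q0 rtr0.
(* Either [q] is a proper subrepresentation of positive slope, against [stab], or its image is that
   of [pi], where the trace of [beta] is 0. *)
have [qpi|qpi] := eqVneq (q * pi) pi; last first.
  by have := stab qq piq Xq q0 qpi; rewrite rq ltNge (ltW rpos).
by move: rpos; rewrite -rq -piq mulrA -pib -mulrA rtrC -mulrA qpi trb ltxx.
Qed.
End StableLimit.

(** * Invariant flags of almost constant sequences of matrices *)


Lemma bound_drop_factor (R : realFieldType) (c s x : R) : 0 <= x -> 0 <= c -> x * (c + 1) <= s -> x <= s.
Proof. nra. Qed.
Lemma bound_half (R : realFieldType) (s t : R) : 0 <= t -> s <= (1 - t) / 4 -> s <= 1 / 2.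
Proof. lra. Qed.
Lemma bound_prod1 (R : realFieldType) (c x y : R) : 0 <= c -> 0 <= x -> y <= c -> y + x <= (c + 1) * (1 + x).
Proof. nra. Qed.
Lemma bound_absorb1 (R : realFieldType) (s t x y : R) : x <= t * y + s * (1 + x) -> x * (1 - s) <= t * y + s.
Proof. lra. Qed.
Lemma bound_absorb2 (R : realFieldType) (s t x y : R) : x <= t * y + (s * y + s * x) -> x * (1 - s) <= (t + s) * y.
Proof. lra. Qed.
Lemma bound_weaken (R : realFieldType) (a c e : R) : 0 <= a -> 0 <= c -> 0 <= e -> a * (c + 1) * e <= a * (c + 1) * (c + 1) * e.
Proof.
move=> a0 c0 e0; have : 0 <= a * (c + 1) * e by rewrite !mulr_ge0 ?addr_ge0.
nra.
Qed.
Lemma bound_regroup (R : realFieldType) (a c e s x : R) : 0 <= x -> a * (c + 1) * e <= s -> a * x * e * (c + 1) <= s * x.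
Proof. by move=> x0 h; have := ler_wpM2r x0 h; lra. Qed.

Lemma bound_mono (R : realFieldType) (e s x y : R) : 0 <= x -> x * (1 - s) <= y + s -> s <= e -> x * (1 - e) <= y + e.
Proof. nra. Qed.
Lemma bound_fix (R : realFieldType) (b s t x y : R) : 0 <= t -> t < 1 -> s <= (1 - t) / 4 -> s * (1 + b) <= (1 - t) * b -> y <= b ->
  x * (1 - s) <= t * y + s -> x <= b.
Proof.
move=> t0 t1 s4 sb yb xs; have s1 : 0 < 1 - s by lra.
rewrite -(ler_pM2r s1); apply: le_trans xs _; have := ler_wpM2l t0 yb; lra.
Qed.
Lemma bound_ratio (R : realFieldType) (s t x y : R) : 0 <= t -> t < 1 -> 0 <= s -> s <= (1 - t) / 4 ->
  x * (1 - s) <= (t + s) * y -> x <= (t + s) / (1 - s) * y.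
Proof.
move=> t0 t1 s0 s4 xs; have s1 : 0 < 1 - s by lra.
by rewrite mulrAC ler_pdivlMr.
Qed.
Lemma bound_ratio_lt1 (R : realFieldType) (s t : R) : 0 <= t -> t < 1 -> 0 <= s -> s <= (1 - t) / 4 -> 0 <= (t + s) / (1 - s) < 1.
Proof.
move=> t0 t1 s0 s4; have s1 : 0 < 1 - s by lra.
apply/andP; split; first by apply: divr_ge0; [exact: addr_ge0 | exact: ltW].
by rewrite ltr_pdivrMr // mul1r; lra.
Qed.


Lemma bound_two (R : realFieldType) (s t : R) : t < 1 -> s <= (1 - t) / 4 -> s * (1 + 1) <= (1 - t) * 1.
Proof. lra. Qed.
Lemma bound_small (R : realFieldType) (b u : R) : 0 <= u -> b <= 1 -> u / 4 * (1 + b) <= u.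
Proof. by move=> u0 b1; have := ler_wpM2l u0 b1; lra. Qed.

Section InvariantFlags.
Variables (R : realType) (d n : nat).
Notation A := 'M[R[i]]_d.
Variables (pi : 'I_n -> A) (f : 'I_n -> R) (th : R).
Hypothesis piM : forall k l, pi k * pi l = if k == l then pi k else 0.
Hypothesis pi_sum : \sum_k pi k = 1.
Hypothesis f_gt0 : forall k, 0 < f k.
Hypothesis th_ge0 : 0 <= th.
Hypothesis th_lt1 : th < 1.
Hypothesis f_th : forall k l : 'I_n, (k < l)%N -> f k <= th * f l.

(** The sum over blocks is used because block scalars act on each block separately:
    [block_contraction] then has the ratio [th] itself, with no constant from a comparison of
    norms. *)
Definition nb (a : A) : R := \sum_k \sum_l nrm (pi k * a * pi l).

Lemma nb_ge0 a : 0 <= nb a.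
Proof. by do 2!apply: sumr_ge0 => ? _; exact: nrm_ge0. Qed.

Lemma nbD a b : nb (a + b) <= nb a + nb b.
Proof.
rewrite /nb -big_split /=; apply: ler_sum => k _; rewrite -big_split /=.
by apply: ler_sum => l _; rewrite mulrDr mulrDl nrmD.
Qed.

Lemma nbN a : nb (- a) = nb a.
Proof. by apply: eq_bigr => k _; apply: eq_bigr => l _; rewrite mulrN mulNr nrmN. Qed.

Lemma nbB a b : nb (a - b) <= nb a + nb b.
Proof. by rewrite (le_trans (nbD _ _)) ?nbN. Qed.

Lemma nb0 : nb 0 = 0.
Proof. by rewrite /nb big1 // => k _; rewrite big1 // => l _; rewrite mulr0 mul0r nrm0. Qed.

Lemma nb_sum (I : Type) (s : seq I) (P : pred I) (F : I -> A) :
  nb (\sum_(i <- s | P i) F i) <= \sum_(i <- s | P i) nb (F i).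
Proof.
elim/big_ind2: _ => [|u x v y ux vy|//]; first by rewrite nb0.
exact: le_trans (nbD _ _) (lerD ux vy).
Qed.

Lemma nrm_le_nb a : nrm a <= nb a.
Proof.
have {1}-> : a = \sum_k \sum_l pi k * a * pi l.
  rewrite -[LHS]mul1r -[LHS]mulr1 -pi_sum !mulr_suml; apply: eq_bigr => k _.
  by rewrite mulr_sumr.
apply: le_trans (nrm_sum _ _ _) _; apply: ler_sum => k _; exact: nrm_sum.
Qed.

Lemma nb_le : exists2 K : R, 0 <= K & forall a, nb a <= K * nrm a.
Proof.
exists (\sum_k \sum_l nrm (pi k) * nrm (pi l)).
  by do 2!apply: sumr_ge0 => ? _; rewrite mulr_ge0 ?nrm_ge0.
move=> a; rewrite mulr_suml; apply: ler_sum => k _; rewrite mulr_suml; apply: ler_sum => l _.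
apply: le_trans (nrmM _ _) _; rewrite mulrAC ler_wpM2r ?nrm_ge0 //.
exact: nrmM.
Qed.

Lemma nbM a b : nb (a * b) <= nb a * nb b.
Proof.
rewrite /nb mulr_suml; apply: ler_sum => k _.
apply: (@le_trans _ _ (\sum_l \sum_m nrm (pi k * a * pi m) * nrm (pi m * b * pi l))).
  apply: ler_sum => l _.
  have -> : pi k * (a * b) * pi l = \sum_m (pi k * a * pi m) * (pi m * b * pi l).
    have -> : \sum_m pi k * a * pi m * (pi m * b * pi l) = \sum_m pi k * a * (pi m) * b * pi l.
      apply: eq_bigr => m _; rewrite !mulrA -[pi k * a * pi m * pi m]mulrA.
      by rewrite piM eqxx.
    by rewrite -!mulr_suml -mulr_sumr pi_sum mulr1 !mulrA.
  by apply: le_trans (nrm_sum _ _ _) _; apply: ler_sum => m _; exact: nrmM.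
rewrite exchange_big /= mulr_suml; apply: ler_sum => m _.
rewrite -mulr_sumr; apply: ler_wpM2l; first exact: nrm_ge0.
rewrite [leRHS](bigD1 m) //= lerDl; do 2!apply: sumr_ge0 => ? _; exact: nrm_ge0.
Qed.

Definition lowp (c : nat) : A := \sum_(k < n | (k < c)%N) pi k.
Definition highp (c : nat) : A := \sum_(k < n | (c <= k)%N) pi k.
Definition blockD : A := \sum_k rscale (f k) (pi k).
Definition blockI (c : nat) : A := \sum_(k < n | (c <= k)%N) rscale (f k)^-1 (pi k).

Lemma pi_pick k (P : pred 'I_n) (r : 'I_n -> R) :
  pi k * (\sum_(l | P l) rscale (r l) (pi l)) = if P k then rscale (r k) (pi k) else 0.
Proof.
rewrite mulr_sumr big_mkcond (bigD1 k) //= big1 ?addr0.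
  by case: ifP => // _; rewrite rscaleE mulrA -rscale_comm -mulrA piM eqxx -rscaleE.
move=> l lk; case: ifP => // _; rewrite rscaleE mulrA -rscale_comm -mulrA piM.
by rewrite eq_sym (negbTE lk) mulr0.
Qed.

Lemma pi_pick_r k (P : pred 'I_n) (r : 'I_n -> R) :
  (\sum_(l | P l) rscale (r l) (pi l)) * pi k = if P k then rscale (r k) (pi k) else 0.
Proof.
rewrite mulr_suml big_mkcond (bigD1 k) //= big1 ?addr0.
  by case: ifP => // _; rewrite rscaleE -mulrA piM eqxx -rscaleE.
move=> l lk; case: ifP => // _; rewrite rscaleE -mulrA piM.
by rewrite (negbTE lk) mulr0.
Qed.

Lemma sum_scale1 (P : pred 'I_n) : \sum_(k | P k) pi k = \sum_(k | P k) rscale 1 (pi k).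
Proof. by apply: eq_bigr => k _; rewrite /rscale scale1r. Qed.

Lemma eq_pi a b : (forall k, pi k * a = pi k * b) -> a = b.
Proof.
by move=> ab; rewrite -[a]mul1r -[b]mul1r -pi_sum !mulr_suml; apply: eq_bigr => k _.
Qed.

Lemma prod_pick (P P' : pred 'I_n) (r r' : 'I_n -> R) :
  (\sum_(l | P l) rscale (r l) (pi l)) * (\sum_(l | P' l) rscale (r' l) (pi l)) =
  \sum_(l | P l && P' l) rscale (r l * r' l) (pi l).
Proof.
apply: eq_pi => k; rewrite mulrA !pi_pick; case: ifP => Pk /=; last by rewrite mul0r.
rewrite rscaleE -mulrA pi_pick; case: ifP => P'k; last by rewrite mulr0.
by rewrite [rscale (r' k) _]rscaleE mulrA -rscaleM -rscaleE.
Qed.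

Lemma lowp_high c : highp c = 1 - lowp c.
Proof.
apply/esym/eqP; rewrite subr_eq -pi_sum [X in _ == X + _]/highp /lowp.
rewrite (bigID (fun k : 'I_n => (c <= k)%N)) /=; apply/eqP; congr (_ + _).
by apply: eq_bigl => k; rewrite ltnNge.
Qed.

Lemma lowp_nest c c' : (c <= c')%N -> lowp c * lowp c' = lowp c.
Proof.
move=> cc; rewrite /lowp !sum_scale1 prod_pick.
apply: eq_big => [k|k _]; last by rewrite mul1r.
by case: ltnP => //= kc; rewrite (leq_trans kc).
Qed.
Lemma lowpD c : lowp c * blockD = blockD * lowp c.
Proof.
rewrite /lowp sum_scale1 !prod_pick; apply: eq_big => [k|k _]; first by rewrite andbT.
by rewrite mulrC.
Qed.
Lemma blockID c : blockI c * blockD = highp c.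
Proof.
rewrite prod_pick /highp sum_scale1; apply: eq_big => [k|k _]; first by rewrite andbT.
by rewrite mulVf // gt_eqF.
Qed.
Lemma blockDI c : blockD * blockI c = highp c.
Proof.
rewrite prod_pick /highp sum_scale1; apply: eq_big => [k|k _] //.
by rewrite mulfV // gt_eqF.
Qed.
Lemma highpI c : highp c * blockI c = blockI c.
Proof.
rewrite /highp sum_scale1 prod_pick; apply: eq_big => [k|k _]; first by rewrite andbb.
by rewrite mul1r.
Qed.
Lemma highpIr c : blockI c * highp c = blockI c.
Proof.
rewrite /highp sum_scale1 prod_pick; apply: eq_big => [k|k _]; first by rewrite andbb.
by rewrite mulr1.
Qed.

Lemma highp_idem c : highp c * highp c = highp c.
Proof.
rewrite /highp sum_scale1 prod_pick; apply: eq_big => [k|k _]; first by rewrite andbb.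
by rewrite mul1r.
Qed.

Definition cI : R := \sum_k nb (rscale (f k)^-1 (pi k)).
Definition cp : R := \sum_k nb (pi k).
(** If [nb N' <= 1], the error term [blockI c * (highp c - N') * E * (lowp c + N)] is at most
    [kap * nb E * (1 + nb N)]; each of the two sums contributes one factor [cp + 1]. *)
Definition kap : R := cI * (cp + 1) * (cp + 1).

Lemma sum_nb_le (P : pred 'I_n) (F : 'I_n -> A) : nb (\sum_(k | P k) F k) <= \sum_k nb (F k).
Proof.
apply: le_trans (nb_sum _ _ _) _.
rewrite [leRHS](bigID P) /= lerDl; apply: sumr_ge0 => k _; exact: nb_ge0.
Qed.
Lemma nb_I c : nb (blockI c) <= cI. Proof. exact: sum_nb_le. Qed.
Lemma nb_p c : nb (lowp c) <= cp. Proof. exact: sum_nb_le. Qed.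
Lemma nb_q c : nb (highp c) <= cp. Proof. exact: sum_nb_le. Qed.
Lemma cI_ge0 : 0 <= cI. Proof. by apply: sumr_ge0 => k _; exact: nb_ge0. Qed.
Lemma cp_ge0 : 0 <= cp. Proof. by apply: sumr_ge0 => k _; exact: nb_ge0. Qed.

(** [N] maps summands of index [k < c] to summands of index [l >= c'], and the block from [k] to [l]
    is multiplied by [f k / f l], which is at most [th] as [k < l]. *)
Lemma block_contraction c c' N : (c <= c')%N -> highp c' * N = N -> N * lowp c = N ->
  nb (blockI c' * N * blockD) <= th * nb N.
Proof.
move=> cc qN Np; rewrite /nb [leRHS]mulr_sumr; apply: ler_sum => l _.
rewrite [leRHS]mulr_sumr; apply: ler_sum => k _.
rewrite -!mulrA [blockD * pi k]pi_pick_r !mulrA pi_pick.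
have rhs0 : 0 <= th * nrm (pi l * N * pi k) by rewrite mulr_ge0 ?nrm_ge0.
case: leqP => cl; last by rewrite !mul0r nrm0.
case: (ltnP k c) => kc; last first.
  suff -> : rscale (f l)^-1 (pi l) * N * rscale (f k) (pi k) = 0 by rewrite nrm0.
  rewrite -Np [rscale (f k) _]rscaleE mulrA -rscale_comm -mulrA -[X in _ * X]mulrA.
  rewrite -[N * lowp c * pi k]mulrA /lowp sum_scale1 pi_pick_r ltnNge kc /=.
  by rewrite !mulr0.
have -> : rscale (f l)^-1 (pi l) * N * rscale (f k) (pi k) = rscale (f k / f l) (pi l * N * pi k).
  rewrite [rscale (f l)^-1 _]rscaleE [rscale (f k) _]rscaleE [RHS]rscaleE rscaleM.
  by rewrite mulrA -rscale_comm !mulrA.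
rewrite nrm_rscale ger0_norm; last by rewrite divr_ge0 ?ltW.
apply: ler_wpM2r; first exact: nrm_ge0.
by rewrite ler_pdivrMr // f_th // (leq_trans kc) // (leq_trans cc).
Qed.

Section Step.
Variables (c : nat) (E : A) (s : R).
Hypothesis Es : kap * nb E <= s.
Hypothesis s_small : s <= (1 - th) / 4.
Local Notation p := (lowp c).
Local Notation q := (highp c).

(** The vanishing product says that [blockD + E] maps the graph of [N] over the image of [p] into
    the graph of [N']. For given [N'] this is linear in [N], namely [(1 + S) * N = blockI c * N' *
    blockD - S * p] with a small [S]. Graphs are pulled back and not pushed forward: [f] is larger
    on the upper part, so that the pullback contracts. *)
Lemma graph_step N' : q * N' = N' -> N' * p = N' -> nb N' <= 1 ->
  exists N, [/\ q * N = N, N * p = N, (q - N') * (blockD + E) * (p + N) = 0 &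
     nb N * (1 - s) <= th * nb N' + s].
Proof.
move=> qN' N'p N'1; pose S := blockI c * (q - N') * E; have SE : S = blockI c * (q - N') * E by []; clearbody S.
have cI0 := cI_ge0; have cp0 := cp_ge0; have E0 := nb_ge0 E.
have S_le : nb S <= cI * (cp + 1) * nb E.
  rewrite SE.
  apply: le_trans (nbM _ _) _; apply: ler_wpM2r => //.
  apply: le_trans (nbM _ _) _; apply: ler_pM; rewrite ?nb_ge0 ?nb_I //.
  by apply: le_trans (nbB _ _) _; rewrite lerD ?nb_q.
have kS : nb S * (cp + 1) <= s.
  apply: le_trans Es; rewrite /kap mulrAC; apply: ler_wpM2r => //.
  by rewrite addr_ge0.
have S_s : nb S <= s by apply: bound_drop_factor kS; rewrite ?nb_ge0.
have Su : 1 + S \in unitmx.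
  by apply: unit_near1; apply: (le_trans (nrm_le_nb _)); apply: (le_trans S_s); exact: bound_half s_small.
have Dp : p * blockD = blockD * p by exact: lowpD.
have qE : q = 1 - p by exact: lowp_high.
have pp : p * p = p by exact: lowp_nest.
have qq : q * q = q by rewrite qE mulrBr mulr1 mulrBl mul1r pp subrr subr0.
pose N0 := blockI c * N' * blockD - S * p.
have N0E : N0 = blockI c * N' * blockD - S * p by []; clearbody N0.
pose N : A := invmx (1 + S) *m N0.
have NN0 : N = invmx (1 + S) *m N0 by []; clearbody N.
have NE : N = N0 - S * N.
  have : (1 + S) * N = N0 by rewrite NN0 -[LHS]/((1 + S) *m _) mulmxA mulmxV // mul1mx.
  by rewrite mulrDl mul1r => <-; rewrite addrK.
have qS : q * S = S by rewrite SE !mulrA highpI.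
have qN : q * N = N.
  apply: (@nc_lincomb _ _ _ (q * (N - (N0 - S * N)) + (q * blockI c - blockI c) * N' * blockD
     - (q * S - S) * p - (q * S - S) * N - (N - (N0 - S * N)))).
    by rewrite -NE highpI qS !subrr; ncring.
  by rewrite N0E; ncring.
have N0p : N0 * p = N0.
  apply: (@nc_lincomb _ _ _ (blockI c * N' * (blockD * p - p * blockD) + blockI c * (N' * p - N') * blockD
     - S * (p * p - p))).
    by rewrite Dp N'p pp !subrr; ncring.
  by rewrite N0E; ncring.
have Np : N * p = N by rewrite NN0 -[LHS]mulmxA [N0 *m p]N0p.
have pN : p * N = 0 by rewrite -qN qE mulrA mulrBr mulr1 pp subrr mul0r.
exists N; split => //.
  set Z := (q - N') * (blockD + E) * (p + N).
  have e1 : q * Z = Z.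
    apply: (@nc_lincomb _ _ _ ((q * q - q) * (blockD + E) * (p + N) - (q * N' - N') * (blockD + E) * (p + N))).
      by rewrite qq qN' !subrr; ncring.
    by rewrite /Z; ncring.
  suff IZ : blockI c * Z = 0 by rewrite -e1 -(blockDI c) -mulrA IZ mulr0.
  have IE : blockI c * q = blockI c by exact: highpIr.
  have ID : blockI c * blockD = q by exact: blockID.
  apply: (@nc_lincomb _ _ _ ((blockI c * q - blockI c) * blockD * (p + N) + (blockI c * blockD - q) * (p + N)
      + (q - (1 - p)) * p + (p - p * p) + (q * N - N) + (N - (N0 - S * N))
      + blockI c * (N' - N' * p) * blockD + blockI c * N' * (p * blockD - blockD * p)
      - blockI c * (N' - N' * p) * blockD * N - blockI c * N' * (p * blockD - blockD * p) * N
      - blockI c * N' * blockD * (p * N))).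
    by rewrite IE ID N'p Dp -qE pp pN qN -NE !subrr; ncring.
  rewrite /Z N0E SE; ncring.
have IN : nb (blockI c * N' * blockD) <= th * nb N' by exact: (@block_contraction c c).
have SpN : nb (S * (p + N)) <= s * (1 + nb N).
  apply: le_trans (nbM _ _) _; apply: (@le_trans _ _ (nb S * ((cp + 1) * (1 + nb N)))).
    apply: ler_wpM2l; first exact: nb_ge0.
    apply: le_trans (nbD _ _) _; apply: bound_prod1 => //; first exact: nb_ge0.
    exact: nb_p.
  by rewrite mulrA; apply: ler_wpM2r => //; rewrite addr_ge0 ?nb_ge0.
apply: bound_absorb1; rewrite {1}NE.
rewrite (_ : N0 - S * N = blockI c * N' * blockD - S * (p + N)); last by rewrite N0E; ncring.
by apply: le_trans (nbB _ _) _; rewrite lerD.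
Qed.

(** [u] and [u'] will be consecutive terms of a sequence that measures how far the flags are from
    being nested or invariant. Each term is at most a fixed fraction of the next one, which forces a
    bounded sequence to vanish. *)
Lemma block_step c' N N' u u' : (c <= c')%N -> q * N = N -> nb N <= 1 ->
  N' * lowp c' = N' -> nb N' <= 1 ->
  highp c' * u = u -> highp c' * u' = u' -> u * p = u -> u' * p = u' ->
  (highp c' - N') * (blockD + E) * u = u' * (blockD + E) * (p + N) ->
  nb u * (1 - s) <= (th + s) * nb u'.
Proof.
move=> cc qN N1 N'p N'1 qu qu' up u'p uu'.
have cI0 := cI_ge0; have cp0 := cp_ge0; have E0 := nb_ge0 E.
have u0 := nb_ge0 u; have u'0 := nb_ge0 u'.
have qE : q = 1 - p by exact: lowp_high.
have qE' : highp c' = 1 - lowp c' by exact: lowp_high.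
have pp : p * p = p by exact: lowp_nest.
have pp' : lowp c' * lowp c' = lowp c' by exact: lowp_nest.
have pN : p * N = 0 by rewrite -qN qE mulrA mulrBr mulr1 pp subrr mul0r.
have pu : lowp c' * u = 0 by rewrite -qu qE' mulrA mulrBr mulr1 pp' subrr mul0r.
have uE : u = blockI c' * u' * blockD + (blockI c' * u' * E * (p + N) - blockI c' * (highp c' - N') * E * u).
  have IE : blockI c' * highp c' = blockI c' by exact: highpIr.
  have ID : blockI c' * blockD = highp c' by exact: blockID.
  have Dp : p * blockD = blockD * p by exact: lowpD.
  have Dp' : lowp c' * blockD = blockD * lowp c' by exact: lowpD.
  apply: (@nc_lincomb _ _ _ (
     blockI c' * ((highp c' - N') * (blockD + E) * u - u' * (blockD + E) * (p + N))
     - (blockI c' * highp c' - blockI c') * blockD * u - (blockI c' * blockD - highp c') * u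
     - (highp c' * u - u)
     + blockI c' * (N' - N' * lowp c') * blockD * u + blockI c' * N' * (lowp c' * blockD - blockD * lowp c') * u
     + blockI c' * N' * blockD * (lowp c' * u)
     + blockI c' * u' * (blockD * p - p * blockD) + blockI c' * (u' * p - u') * blockD
     + blockI c' * (u' - u' * p) * blockD * N + blockI c' * u' * (p * blockD - blockD * p) * N
     + blockI c' * u' * blockD * (p * N))).
    by rewrite uu' IE ID qu N'p Dp' pu Dp u'p pN !subrr; ncring.
  by ncring.
have h1 : nb (blockI c' * u' * blockD) <= th * nb u' by exact: (@block_contraction c c').
have kE : cI * (cp + 1) * nb E <= s.
  by apply: le_trans Es; exact: bound_weaken.
have h2 : nb (blockI c' * u' * E * (p + N)) <= s * nb u'.
  apply: (@le_trans _ _ (cI * nb u' * nb E * (cp + 1))); last exact: bound_regroup.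
  apply: le_trans (nbM _ _) _; apply: ler_pM; rewrite ?nb_ge0 //.
    apply: le_trans (nbM _ _) _; rewrite ler_wpM2r //.
    by apply: le_trans (nbM _ _) _; rewrite ler_wpM2r ?nb_I.
  by apply: le_trans (nbD _ _) _; rewrite lerD ?nb_p.
have h3 : nb (blockI c' * (highp c' - N') * E * u) <= s * nb u.
  apply: le_trans (nbM _ _) _; rewrite ler_wpM2r //; apply: le_trans kE.
  apply: le_trans (nbM _ _) _; rewrite ler_wpM2r //.
  apply: le_trans (nbM _ _) _; apply: ler_pM; rewrite ?nb_ge0 ?nb_I //.
  by apply: le_trans (nbB _ _) _; rewrite lerD ?nb_q.
apply: bound_absorb2; rewrite {1}uE; apply: le_trans (nbD _ _) _; rewrite lerD //.
by apply: le_trans (nbB _ _) _; rewrite lerD.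
Qed.

End Step.

Lemma geometric_zero (x r B : R) : 0 <= x -> 0 <= r < 1 -> (forall m, x <= r ^+ m * B) -> x = 0.
Proof.
move=> x0 /andP[r0 r1] xB; apply/le_anti; rewrite x0 andbT.
have h : (r ^+ m * B @[m --> \oo] --> 0 * B)%classic.
  by apply: cvgMr_tmp; apply: cvg_expr; rewrite ger0_norm.
rewrite mul0r in h; apply: (cvgr_to_ge h).
by apply: nearW.
Qed.

Lemma nb_limit (U : set_system nat) {UF : ProperFilter U} u a B :
  cvA U u a -> (\forall s \near U, nb (u s) <= B)%classic -> nb a <= B.
Proof.
move=> ua uB; have [K K0 nbK] := nb_le.
apply/ler_addgt0Pr => e e0.
have K1 : 0 < K + 1 by rewrite ltr_wpDl.
have : (\forall s \near U, nb (u s) <= B /\ nrm (u s - a) < e / (K + 1))%classic.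
  by apply: filterI => //; apply: cvA_lt => //; rewrite divr_gt0.
move=> /filter_ex [s [us usa]].
have -> : a = u s - (u s - a) by rewrite opprB addrC subrK.
apply: le_trans (nbB _ _) _; rewrite lerD //; apply: le_trans (nbK _) _.
have := ltW usa; rewrite ler_pdivlMr // mulrC => h; apply: le_trans h.
by rewrite ler_wpM2r ?nrm_ge0 // lerDl.
Qed.

Section Flags.
Variables (F : nat -> A) (U : set_system nat).
Context {UU : UltraFilter U}.
Hypothesis Uoo : (\oo `<=` U)%classic.
Hypothesis F_small : forall j, kap * nb (F j - blockD) <= (1 - th) / 4.
Hypothesis F_lim : cvA \oo%classic F blockD.

Lemma graph_transform c j N' : exists N,
  highp c * N' = N' -> N' * lowp c = N' -> nb N' <= 1 ->
  [/\ highp c * N = N, N * lowp c = N, (highp c - N') * F j * (lowp c + N) = 0 &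
    forall s, kap * nb (F j - blockD) <= s -> s <= (1 - th) / 4 -> nb N * (1 - s) <= th * nb N' + s].
Proof.
(* Outside the domain of the graph transform the value 0 is a default, so that [choice] applies to
   all arguments. *)
have [h|h] := pselect [/\ highp c * N' = N', N' * lowp c = N' & nb N' <= 1]; last first.
  by exists 0 => h1 h2 h3; case: h.
have [h1 h2 h3] := h.
have [N [qN Np FN NB]] := graph_step (lexx _) (F_small j) h1 h2 h3.
exists N => _ _ _; split => //; first by rewrite -FN [blockD + _]addrC subrK.
by move=> s s1 s2; apply: bound_mono NB s1; exact: nb_ge0.
Qed.

(** The graph at time [j] obtained from the zero graph at time [j + m] by [m] pullbacks. *)
Fixpoint pullback (G : nat * nat * A -> A) c j m : A :=
  if m is m'.+1 then G (c, j, pullback G c j.+1 m') else 0.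

(** The zero graph is placed at time [J] and pulled back to time [j]; [N j] is the limit as [J]
    tends to infinity along [U]. *)
Lemma limit_graph c : exists N : nat -> A,
  [/\ forall j, [/\ highp c * N j = N j, N j * lowp c = N j & nb (N j) <= 1],
      forall j, (highp c - N j.+1) * F j * (lowp c + N j) = 0 &
      cvA \oo%classic N 0].
Proof.
have [G GP] := choice (fun x : nat * nat * A => graph_transform x.1.1 x.1.2 x.2).
pose N j m := pullback G c j m.
have N1 m : forall j, [/\ highp c * N j m = N j m, N j m * lowp c = N j m & nb (N j m) <= 1].
  elim: m => [|m IH] j; first by rewrite /N /= mulr0 mul0r nb0.
  have [h1 h2 h3] := IH j.+1.
  have := GP (c, j, N j.+1 m); rewrite /= => /(_ h1 h2 h3) [g1 g2 _ g4]; split => //.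
  have s0 : kap * nb (F j - blockD) <= (1 - th) / 4 by exact: F_small.
  apply: bound_fix (g4 _ (lexx _) s0) => //.
  exact: bound_two.
have NF m j : (highp c - N j.+1 m) * F j * (lowp c + N j m.+1) = 0.
  by have [h1 h2 h3] := N1 m j.+1; have [_ _ g3 _] := GP (c, j, N j.+1 m) h1 h2 h3.
(* With [s = (1 - th) * b / 4] the pullback preserves the ball of radius [b] as soon as the error is
   at most [s]. This makes the limit graphs tend to 0. *)
have Nsmall b : 0 < b -> b <= 1 -> exists j0, forall j m, (j0 <= j)%N -> nb (N j m) <= b.
  move=> b0 b1; have [K K0 nbK] := nb_le.
  pose s := (1 - th) * b / 4.
  have s0 : 0 < s by rewrite /s divr_gt0 // mulr_gt0 // subr_gt0.
  have k0 : 0 <= kap by rewrite /kap !mulr_ge0 ?addr_ge0 ?cI_ge0 ?cp_ge0.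
  have kK : 0 < kap * K + 1 by apply: ltr_wpDl => //; exact: mulr_ge0.
  have [j0 _ j0P] := cvA_lt F_lim (divr_gt0 s0 kK).
  exists j0 => j m; elim: m j => [|m IH] j jj; first by rewrite /N /= nb0 ltW.
  have [h1 h2 h3] := N1 m j.+1.
  have := GP (c, j, N j.+1 m); rewrite /= => /(_ h1 h2 h3) [_ _ _ g4].
  have s4 : s <= (1 - th) / 4.
    by rewrite /s ler_pM2r ?invr_gt0 // -[leRHS]mulr1 ler_pM2l // subr_gt0.
  have Fs : kap * nb (F j - blockD) <= s.
    have : nrm (F j - blockD) < s / (kap * K + 1) by exact: j0P.
    rewrite ltr_pdivlMr // => /ltW; apply: le_trans.
    apply: (@le_trans _ _ (kap * (K * nrm (F j - blockD)))); first by rewrite ler_wpM2l.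
    by rewrite mulrA [leRHS]mulrC ler_wpM2r ?nrm_ge0 // lerDl.
  apply: bound_fix (IH j.+1 (leqW jj)) (g4 _ Fs s4) => //.
  by apply: bound_small => //; rewrite mulr_ge0 // ltW // subr_gt0.
(* The subtraction indexes the pullbacks by the time [J], which is the same for [j] and [j.+1];
   hence invariance passes to the limit. *)
have lim j : exists a, cvA U (fun J => N j (J - j)%N) a.
  apply: (@ultra_cvA _ _ _ _ _ 1) => J; apply: le_trans (nrm_le_nb _) _.
  by have [_ _] := N1 (J - j)%N j.
have [Ni NiP] := choice lim; exists Ni; split.
- move=> j; split.
  + by apply: (cvA_eq (cvAMl _ (NiP j)) (NiP j)); apply: nearW => J; have [] := N1 (J - j)%N j.
  + by apply: (cvA_eq (cvAMr _ (NiP j)) (NiP j)); apply: nearW => J; have [] := N1 (J - j)%N j.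
  + by apply: (nb_limit (NiP j)); apply: nearW => J; have [] := N1 (J - j)%N j.
- move=> j.
  have h1 : cvA U (fun J => (highp c - N j.+1 (J - j.+1)%N) * F j * (lowp c + N j (J - j)%N))
      ((highp c - Ni j.+1) * F j * (lowp c + Ni j)).
    apply: cvAM; first by apply: cvAMr; apply: cvAB; [exact: cvA_cst|exact: NiP].
    by apply: cvAD; [exact: cvA_cst|exact: NiP].
  have h0 : cvA U (fun=> 0 : A) 0 by exact: cvA_cst.
  apply: (cvA_eq h1 h0).
  have : (\oo `<=` U)%classic by exact: Uoo.
  (* Up to [j] the truncated subtraction breaks the recursion; these finitely many [J] are ignored
     by [U]. *)
  apply; exists j.+1 => // J /= jJ.
  by have -> : (J - j = (J - j.+1).+1)%N; [rewrite -subSn // subSS | exact: NF].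
- apply/cvgrPdist_lt => e e0.
  pose b := Num.min 1 (e / 2).
  have b0 : 0 < b by rewrite lt_min ltr01 divr_gt0.
  have b1 : b <= 1 by rewrite ge_min lexx.
  have [j0 j0P] := Nsmall b b0 b1; exists j0 => // j /= jj.
  rewrite subr0 sub0r normrN ger0_norm ?nrm_ge0 //.
  apply: (@le_lt_trans _ _ b); last by rewrite gt_min ltr_pdivrMr // ltr_pMr // ltr1n orbT.
  apply: (cvA_nrm_le _ (NiP j)); apply: nearW => J; apply: le_trans (nrm_le_nb _) _.
  exact: j0P.
Qed.

(** [Q j c] is the projection onto the graph of [N c j] along the image of [highp c]. That the flags
    are nested and invariant under [phi] is not visible in the pullbacks; it holds because the
    components that violate it form bounded sequences which the step from [j] to [j.+1] would expand
    by a fixed factor. *)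
Theorem invariant_flags (T : Type) (phi : nat -> T -> A) (B : T -> R) :
  (forall j t, nrm (phi j t) <= B t) ->
  (forall j t, F j * phi j t = phi j.+1 t * F j) ->
  exists Q : nat -> nat -> A,
  [/\ forall j c, lowp c * Q j c = lowp c /\ Q j c * lowp c = Q j c,
     forall j c, (1 - Q j.+1 c) * F j * Q j c = 0,
     forall j c c', (c <= c')%N -> (1 - Q j c') * Q j c = 0,
     forall j c t, (1 - Q j c) * phi j t * Q j c = 0 &
     forall c, cvA \oo%classic (Q^~ c) (lowp c)].
Proof.
move=> phiB Fphi; have [N NP] := choice limit_graph.
have N1 c j : highp c * N c j = N c j by have [h _ _] := NP c; have [] := h j.
have N2 c j : N c j * lowp c = N c j by have [h _ _] := NP c; have [] := h j.
have N3 c j : nb (N c j) <= 1 by have [h _ _] := NP c; have [] := h j.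
have N4 c j : (highp c - N c j.+1) * F j * (lowp c + N c j) = 0 by have [_ h _] := NP c.
have pN c j : lowp c * N c j = 0.
  by rewrite -N1 lowp_high mulrA mulrBr mulr1 lowp_nest // subrr mul0r.
have QE c j : 1 - (lowp c + N c j) = highp c - N c j by rewrite lowp_high; ncring.
(* Applied to [(1 - Q j c') * Q j c] for nestedness and to [(1 - Q j c) * phi j t * Q j c] for
   invariance. *)
have zero (u : nat -> A) c c' (B' : R) : (c <= c')%N -> (forall j, nb (u j) <= B') ->
    (forall j, highp c' * u j = u j) -> (forall j, u j * lowp c = u j) ->
    (forall j, (highp c' - N c' j.+1) * F j * u j = u j.+1 * F j * (lowp c + N c j)) ->
    forall j, u j = 0.
  move=> cc uB qu up uu j; apply: nrm_eq0; apply/le_anti; rewrite nrm_ge0 andbT.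
  rewrite (le_trans (nrm_le_nb _)) //.
  pose s := (1 - th) / 4; have s0 : 0 <= s by rewrite divr_ge0 // subr_ge0 ltW.
  have step i : nb (u i) <= (th + s) / (1 - s) * nb (u i.+1).
    apply: bound_ratio => //; apply: (block_step (c := c) (F_small i) cc (N := N c i) (N' := N c' i.+1)) => //.
    by rewrite [blockD + _]addrC subrK.
  have rlt : 0 <= (th + s) / (1 - s) < 1 by exact: bound_ratio_lt1.
  suff -> : nb (u j) = 0 by [].
  apply: (geometric_zero (nb_ge0 _) rlt (B := B')) => m.
  elim: m j => [|m IH] j; first by rewrite expr0 mul1r.
  apply: le_trans (step j) _; rewrite exprS -[leRHS]mulrA; apply: ler_wpM2l => //.
  by case/andP: rlt.
have nbQ c j : nb (lowp c + N c j) <= cp + 1 by apply: le_trans (nbD _ _) _; rewrite lerD ?nb_p.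
have nbQ' c j : nb (1 - (lowp c + N c j)) <= cp + 1.
  by rewrite QE; apply: le_trans (nbB _ _) _; rewrite lerD ?nb_q.
have pp c : lowp c * lowp c = lowp c by exact: lowp_nest.
exists (fun j c => lowp c + N c j); split => [j c|j c|j c c' cc|j c t|c].
- by rewrite mulrDr mulrDl pp N2 pN addr0.
- by rewrite QE N4.
- move: j; apply: (zero _ c c' ((cp + 1) * (cp + 1)) cc) => j.
  + by apply: le_trans (nbM _ _) _; rewrite ler_pM ?nb_ge0.
  + rewrite QE; apply: (@nc_lincomb _ _ _ ((highp c' * highp c' - highp c') * (lowp c + N c j)
       - (highp c' * N c' j - N c' j) * (lowp c + N c j))); last by ncring.
    by rewrite N1 highp_idem !subrr; ncring.
  + by rewrite -[LHS]mulrA [(lowp c + _) * lowp c]mulrDl pp N2.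
  + apply: (@nc_lincomb _ _ _ (- ((highp c' - N c' j.+1) * F j * (lowp c' + N c' j)) * (lowp c + N c j)
       + (1 - (lowp c' + N c' j.+1)) * ((highp c - N c j.+1) * F j * (lowp c + N c j)))).
      by rewrite !N4; ncring.
    by rewrite !lowp_high; ncring.
- move: j; have [K K0 nbK] := nb_le.
  have nbphi j : nb (phi j t) <= K * B t by apply: le_trans (nbK _) _; rewrite ler_wpM2l.
  apply: (zero _ c c ((cp + 1) * (K * B t) * (cp + 1)) (leqnn _)) => j.
  + apply: le_trans (nbM _ _) _; rewrite ler_pM ?nb_ge0 //.
    by apply: le_trans (nbM _ _) _; rewrite ler_pM ?nb_ge0.
  + rewrite QE; apply: (@nc_lincomb _ _ _ ((highp c * highp c - highp c) * phi j t * (lowp c + N c j)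
       - (highp c * N c j - N c j) * phi j t * (lowp c + N c j))); last by ncring.
    by rewrite N1 highp_idem !subrr; ncring.
  + by rewrite -[LHS]mulrA [(lowp c + _) * lowp c]mulrDl pp N2.
  + apply: (@nc_lincomb _ _ _ (- ((highp c - N c j.+1) * F j * (lowp c + N c j)) * phi j t * (lowp c + N c j)
       + (1 - (lowp c + N c j.+1)) * (F j * phi j t - phi j.+1 t * F j) * (lowp c + N c j)
       + (1 - (lowp c + N c j.+1)) * phi j.+1 t * ((highp c - N c j.+1) * F j * (lowp c + N c j)))).
      by rewrite !N4 Fphi subrr; ncring.
    by rewrite !lowp_high; ncring.
- have [_ _ h] := NP c; rewrite -[X in cvA _ _ X]addr0.
  by apply: cvAD => //; exact: cvA_cst.
Qed.

End Flags.
End InvariantFlags.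

(** * Intertwiners along a flow line, as limits of Euler products *)

(** A discrete Gronwall inequality with the exponential replaced by a linear bound, which is
    legitimate while the elapsed time [w] satisfies [2 * c * w <= 1]. *)
Lemma euler_bound1 (R : realFieldType) (a c D e w : R) : 0 <= c -> 0 <= D -> 0 <= e ->
  a <= 2 * D * c * w -> 2 * c * w <= 1 -> a + e * (c * (D + a)) <= 2 * D * c * (w + e).
Proof.
move=> c0 D0 e0 aw cw.
have aD : a <= D by apply: le_trans aw _; have := ler_wpM2l D0 cw; lra.
have : e * (c * (D + a)) <= e * (c * (D + D)) by do 2!apply: ler_wpM2l => //; lra.
lra.
Qed.

Lemma euler_bound2 (R : realFieldType) (a c k e w : R) : 0 <= c -> 0 <= k -> 0 <= e ->
  a <= 2 * k * w -> 2 * c * w <= 1 -> a + e * (c * a) + e * k <= 2 * k * (w + e).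
Proof.
move=> c0 k0 e0 aw cw.
have : c * a <= k by apply: le_trans (ler_wpM2l c0 aw) _; have := ler_wpM2l k0 cw; lra.
move=> /(ler_wpM2l e0); lra.
Qed.

Lemma expr_bounds (R : realFieldType) (y : R) i : `|y| * i%:R <= 1 / 2 ->
  1 - `|y| * i%:R <= (1 + y) ^+ i <= 1 + 2 * (`|y| * i%:R).
Proof.
elim: i => [|i IH]; first by rewrite expr0 mulr0 mulr0 subr0 addr0 lexx.
rewrite -natr1 mulrDr mulr1 => yi; have y0 := normr_ge0 y.
have i0 : 0 <= `|y| * i%:R by rewrite mulr_ge0.
have yi' : `|y| * i%:R <= 1 / 2 by lra.
have {IH} /andP[h1 h2] := IH yi'.
have y1 := ler_norm y; have y2 : - `|y| <= y by rewrite lerNnormlW.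
rewrite exprS; move: ((1 + y) ^+ i) h1 h2 => x h1 h2.
have x0 : 0 <= x by lra.
have e1 := ler_wpM2r x0 y1; have e2 := ler_wpM2r x0 y2.
have e3 := ler_wpM2l y0 h2; have e4 := ler_wpM2l y0 yi'.
have e5 : 0 <= (x - (1 - `|y| * i%:R)) * (1 - `|y|) by rewrite mulr_ge0; lra.
have e6 : 0 <= `|y| * (`|y| * i%:R) by rewrite mulr_ge0.
by apply/andP; split; lra.
Qed.

Lemma bernoulli (R : realFieldType) (y : R) i : 0 <= y -> 1 + i%:R * y <= (1 + y) ^+ i.
Proof.
move=> y0; elim: i => [|i IH]; first by rewrite expr0 mul0r addr0.
rewrite exprS -natr1; have i0 : 0 <= i%:R * y by rewrite mulr_ge0.
have := ler_wpM2l (addr_ge0 ler01 y0) IH; have := mulr_ge0 y0 i0; lra.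
Qed.

Section Euler.
Variables (R : realType) (d : nat).
Notation A := 'M[R[i]]_d.
Implicit Types (h : R -> A) (t e c : R).

(** The Euler scheme backwards in time from [t] to [t - i * e]. By the flow equation [phi (t - e)]
    is [phi t + e (h phi - phi h)] to first order, so that [1 + e h] intertwines [phi t] with
    [phi (t - e)] up to order [e^2]. *)
Fixpoint euler h t e i : A :=
  if i is i'.+1 then (1 + rscale e 1 * h (t - i'%:R * e)) * euler h t e i' else 1.

Lemma nrm_rscale1 e a : 0 <= e -> nrm (rscale e 1 * a : A) = e * nrm a.
Proof. by move=> e0; rewrite -rscaleE nrm_rscale ger0_norm. Qed.

Let D : R := nrm (1 : A).

Lemma euler_near1 h t e c i : 0 <= c -> 0 <= e -> (forall s, s <= t -> nrm (h s) <= c) ->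
  2 * c * (i%:R * e) <= 1 -> nrm (euler h t e i - 1) <= 2 * D * c * (i%:R * e).
Proof.
move=> c0 e0 hc; elim: i => [|i IH]; first by rewrite /= mulr0n subrr nrm0 mul0r !mulr0.
rewrite -[i.+1%:R]natr1 [(i%:R + 1) * e]mulrDl mul1r => hi.
have i0 : 0 <= i%:R * e by rewrite mulr_ge0.
have hi' : 2 * c * (i%:R * e) <= 1.
  by apply: le_trans hi; rewrite ler_wpM2l ?mulr_ge0 // lerDl.
have {}IH := IH hi'.
rewrite /= (_ : _ * _ - 1 = (euler h t e i - 1) + rscale e 1 * (h (t - i%:R * e) * (1 + (euler h t e i - 1)))); last by ncring.
apply: le_trans (nrmD _ _) _; apply: le_trans (euler_bound1 c0 (nrm_ge0 _) e0 IH hi').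
rewrite lerD2l nrm_rscale1 // ler_wpM2l //.
apply: le_trans (nrmM _ _) _; apply: ler_pM; rewrite ?nrm_ge0 //.
  by apply: hc; rewrite gerBl.
exact: nrmD.
Qed.

Lemma euler_le h t e c i : 0 <= c -> 0 <= e -> (forall s, s <= t -> nrm (h s) <= c) ->
  2 * c * (i%:R * e) <= 1 -> nrm (euler h t e i) <= 2 * D.
Proof.
move=> c0 e0 hc ci; have h1 := euler_near1 c0 e0 hc ci.
have -> : euler h t e i = 1 + (euler h t e i - 1) by ncring.
apply: le_trans (nrmD _ _) _; rewrite -/D.
have D0 : 0 <= D by exact: nrm_ge0.
have := ler_wpM2l D0 ci; move: h1; clear -D0; move: (nrm _) => x; lra.
Qed.

Lemma euler_compare h h' t e c sg i : 0 <= c -> 0 <= e -> 0 <= sg ->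
  (forall s, s <= t -> nrm (h s) <= c) -> (forall s, s <= t -> nrm (h' s) <= c) ->
  (forall s, s <= t -> nrm (h s - h' s) <= sg) ->
  2 * c * (i%:R * e) <= 1 ->
  nrm (euler h t e i - euler h' t e i) <= 2 * (2 * D * sg) * (i%:R * e).
Proof.
move=> c0 e0 sg0 hc hc' hh; elim: i => [|i IH]; first by rewrite /= mulr0n subrr nrm0 mul0r !mulr0.
rewrite -[i.+1%:R]natr1 [(i%:R + 1) * e]mulrDl mul1r => hi.
have i0 : 0 <= i%:R * e by rewrite mulr_ge0.
have hi' : 2 * c * (i%:R * e) <= 1.
  by apply: le_trans hi; rewrite ler_wpM2l ?mulr_ge0 // lerDl.
have {}IH := IH hi'; have D0 : 0 <= D by exact: nrm_ge0.
have k0 : 0 <= 2 * D * sg by rewrite !mulr_ge0.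
have ti : t - i%:R * e <= t by rewrite gerBl.
rewrite /= (_ : _ * _ - _ * _ = (euler h t e i - euler h' t e i) +
   rscale e 1 * (h (t - i%:R * e) * (euler h t e i - euler h' t e i)) +
   rscale e 1 * ((h (t - i%:R * e) - h' (t - i%:R * e)) * euler h' t e i)); last by ncring.
apply: le_trans (nrmD _ _) _; apply: le_trans (euler_bound2 c0 k0 e0 IH hi').
apply: lerD.
  apply: le_trans (nrmD _ _) _; rewrite lerD2l nrm_rscale1 // ler_wpM2l //.
  by apply: le_trans (nrmM _ _) _; rewrite ler_wpM2r ?nrm_ge0 ?hc.
rewrite nrm_rscale1 // ler_wpM2l //; apply: le_trans (nrmM _ _) _.
rewrite [leRHS]mulrC; apply: ler_pM; rewrite ?nrm_ge0 ?hh //.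
exact: euler_le hi'.
Qed.

(** The products stay bounded, so that the errors of order [e^2] of the single steps add up to order
    [e] over a fixed time. *)
Lemma euler_intertwine h (phi : R -> A) t e c K i : 0 <= c -> 0 <= e -> 0 <= K ->
  (forall s, s <= t -> nrm (h s) <= c) ->
  (forall s, s <= t -> nrm (phi (s - e) - phi s) <= K * e) ->
  (forall s, s <= t -> nrm (phi (s - e) - phi s - rscale e 1 * (h s * phi s - phi s * h s)) <= K * (e * e)) ->
  2 * c * (i%:R * e) <= 1 ->
  nrm (euler h t e i * phi t - phi (t - i%:R * e) * euler h t e i)
    <= 2 * (K * (1 + c) * (2 * D) * e) * (i%:R * e).
Proof.
move=> c0 e0 K0 hc h1 h2; elim: i => [|i IH].
  by rewrite /= mulr0n !mul0r subr0 mul1r mulr1 subrr nrm0 !mulr0.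
rewrite -[i.+1%:R]natr1 [(i%:R + 1) * e]mulrDl mul1r => hi.
have i0 : 0 <= i%:R * e by rewrite mulr_ge0.
have hi' : 2 * c * (i%:R * e) <= 1.
  by apply: le_trans hi; rewrite ler_wpM2l ?mulr_ge0 // lerDl.
have {}IH := IH hi'; have D0 : 0 <= D by exact: nrm_ge0.
have k0 : 0 <= K * (1 + c) * (2 * D) * e by rewrite !mulr_ge0 ?addr_ge0.
have ti : t - i%:R * e <= t by rewrite gerBl.
have hs := hc _ ti; have h1s := h1 _ ti; have h2s := h2 _ ti.
have EB := euler_le c0 e0 hc hi'.
have -> : t - (i%:R * e + e) = t - i%:R * e - e by rewrite opprD addrA.
rewrite /=.
move: IH hs h1s h2s EB; set s := t - i%:R * e; set E := euler h t e i.
clearbody s E => IH hs h1s h2s EB.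
have comm x : rscale e 1 * x = x * rscale e 1 by exact: rscale_comm.
rewrite (_ : (1 + rscale e 1 * h s) * E * phi t - phi (s - e) * ((1 + rscale e 1 * h s) * E) =
   (E * phi t - phi s * E) + rscale e 1 * (h s * (E * phi t - phi s * E)) +
   - ((phi (s - e) - phi s - rscale e 1 * (h s * phi s - phi s * h s)) +
      rscale e 1 * ((phi (s - e) - phi s) * h s)) * E); last first.
  apply: (@nc_lincomb _ _ _ ((rscale e 1 * phi (s - e) - phi (s - e) * rscale e 1) * h s * E)).
    by rewrite comm subrr !mul0r.
  by ncring.
apply: le_trans (nrmD _ _) _; apply: le_trans (euler_bound2 c0 k0 e0 IH hi').
apply: lerD.
  apply: le_trans (nrmD _ _) _; rewrite lerD2l nrm_rscale1 // ler_wpM2l //.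
  by apply: le_trans (nrmM _ _) _; rewrite ler_wpM2r ?nrm_ge0.
apply: le_trans (nrmM _ _) _.
have -> : e * (K * (1 + c) * (2 * D) * e) = (K * (e * e) + e * (K * e * c)) * (2 * D) by ring.
apply: ler_pM; rewrite ?nrm_ge0 // nrmN; apply: le_trans (nrmD _ _) _; apply: lerD => //.
rewrite nrm_rscale1 // ler_wpM2l //; apply: le_trans (nrmM _ _) _.
by apply: ler_pM; rewrite ?nrm_ge0.
Qed.

Lemma euler_comm h t e i b : (forall s, h s * b = b * h s) -> euler h t e i * b = b * euler h t e i.
Proof.
move=> hb; elim: i => [|i IH] /=; first by rewrite mul1r mulr1.
apply: (@nc_lincomb _ _ _ ((1 + rscale e 1 * h (t - i%:R * e)) * (euler h t e i * b - b * euler h t e i)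
  + rscale e 1 * (h (t - i%:R * e) * b - b * h (t - i%:R * e)) * euler h t e i
  + (rscale e 1 * b - b * rscale e 1) * h (t - i%:R * e) * euler h t e i)).
  by rewrite IH hb [rscale e 1 * b]rscale_comm !subrr; ncring.
by ncring.
Qed.

Variables (n : nat) (pi : 'I_n -> A) (lam : 'I_n -> R).
Hypothesis piM : forall k l, pi k * pi l = if k == l then pi k else 0.
Hypothesis pi_sum : \sum_k pi k = 1.
Let H : A := \sum_k rscale (lam k) (pi k).

Lemma euler_diag t e i : euler (fun=> H) t e i = \sum_k rscale ((1 + e * lam k) ^+ i) (pi k).
Proof.
elim: i => [|i IH] /=.
  by rewrite -pi_sum; apply: eq_bigr => k _; rewrite expr0 rscaleE rscale1 mul1r.
rewrite IH; have -> : 1 + rscale e 1 * H = \sum_k rscale (1 + e * lam k) (pi k).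
  rewrite -[X in X + _]pi_sum /H mulr_sumr -big_split /=; apply: eq_bigr => k _.
  rewrite [RHS]rscaleE rscaleD rscale1 mulrDl mul1r; congr (_ + _).
  by rewrite rscaleM -mulrA -[rscale (lam k) 1 * _]rscaleE.
rewrite (prod_pick piM pi_sum xpredT xpredT).
by apply: eq_bigr => k _; rewrite exprS.
Qed.

End Euler.

Section Intertwiners.
Variables (R : realType) (d n : nat).
Notation A := 'M[R[i]]_d.
Variables (pi : 'I_n -> A) (lam : 'I_n -> R) (T : Type) (h : R -> A) (phi : R -> T -> A).
Variables (c gap : R) (K : T -> R).
Hypothesis piM : forall k l, pi k * pi l = if k == l then pi k else 0.
Hypothesis pi_sum : \sum_k pi k = 1.
Let H : A := \sum_k rscale (lam k) (pi k).
Hypothesis c_ge0 : 0 <= c.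
Hypothesis h_le : forall t, t <= 0 -> nrm (h t) <= c.
Hypothesis H_le : nrm H <= c.
Hypothesis lam_le : forall k, `|lam k| <= c.
Hypothesis h_lim : forall e, 0 < e -> exists t0, forall t, t <= t0 -> nrm (h t - H) <= e.
Hypothesis gap_gt0 : 0 < gap.
Hypothesis lam_gap : forall k l : 'I_n, (k < l)%N -> lam k + gap <= lam l.
Hypothesis K_ge0 : forall a, 0 <= K a.
Hypothesis phi_lip : forall a t e, t <= 0 -> 0 <= e -> nrm (phi (t - e) a - phi t a) <= K a * e.
Hypothesis phi_taylor : forall a t e, t <= 0 -> 0 <= e ->
  nrm (phi (t - e) a - phi t a - rscale e 1 * (h t * phi t a - phi t a * h t)) <= K a * (e * e).

(** [f k] is the limit of the powers [(1 + tau lam_k / m)^m], that is, the exponential of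
    [tau lam_k]; what is recorded of it is positivity and growth in [k]. *)
Theorem exists_intertwiners : exists (tau : R) (F : nat -> A) (f : 'I_n -> R) (th : R),
  [/\ 0 < tau, forall k, 0 < f k, 0 <= th < 1 & forall k l : 'I_n, (k < l)%N -> f k <= th * f l] /\
  [/\ forall j, F j \in unitmx,
     forall j a, F j * phi (- (j%:R * tau)) a = phi (- (j.+1%:R * tau)) a * F j,
     forall b, (forall t, h t * b = b * h t) -> forall j, F j * b = b * F j &
     cvA \oo%classic F (blockD pi f)].
Proof.
have [U [UU Uoo]] := @ultraFilterLemma _ (\oo%classic : set_system nat) _.
pose D : R := nrm (1 : A); have D0 : 0 <= D by exact: nrm_ge0.
have den0 : 0 < 4 * (1 + D) * (1 + c) by apply: mulr_gt0; [apply: mulr_gt0 => //|]; exact: ltr_pwDl.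
(* This choice gives [2 * D * c * tau <= 1 / 2]: the Euler products over a time [tau] stay within
   1/2 of 1, and so do their limits, which are therefore invertible. *)
pose tau := (4 * (1 + D) * (1 + c))^-1.
have tau0 : 0 < tau by rewrite invr_gt0.
have tau1 : 4 * (1 + D) * (1 + c) * tau = 1 by rewrite mulfV // gt_eqF.
have ct0 : 0 <= c * tau by rewrite mulr_ge0 // ltW.
have Dct0 : 0 <= D * (c * tau) by rewrite mulr_ge0.
have Dt0 : 0 <= D * tau by rewrite mulr_ge0 // ltW.
have ct1 : 2 * c * tau <= 1 by lra.
have ct4 : c * tau <= 1 / 2 by lra.
have Dct : 2 * D * c * tau <= 1 / 2 by lra.
clearbody tau.
pose e (m : nat) : R := tau / m.+1%:R.
have e0 m : 0 <= e m by rewrite divr_ge0 // ltW.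
have em m : m.+1%:R * e m = tau by rewrite /e mulrC divfK // pnatr_eq0.
have toU (g : nat -> R) (l : R) : (g @ \oo --> l)%classic -> (g @ U --> l)%classic.
  by move=> gl V /gl; exact: Uoo.
have e_lim : (e m @[m --> U] --> (0 : R))%classic.
  apply: toU; rewrite -(mulr0 tau); apply: cvgMl_tmp; exact: cvg_harmonic.
clearbody e.
pose Eu j m := euler h (- (j%:R * tau)) (e m) m.+1.
have t0 j : - (j%:R * tau) <= 0 by rewrite oppr_le0 mulr_ge0 // ltW.
have hj j s : s <= - (j%:R * tau) -> nrm (h s) <= c.
  by move=> sj; apply: h_le; exact: le_trans sj (t0 j).
have Eu1 j m : nrm (Eu j m - 1) <= 1 / 2.
  by apply: le_trans (euler_near1 c_ge0 (e0 m) (hj j) _) _; rewrite em.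
have Flim j : exists a, cvA U (Eu j) a.
  apply: (@ultra_cvA _ _ _ _ _ (1 / 2 + D)) => m.
  by rewrite -[Eu j m](subrK 1); apply: le_trans (nrmD _ _) _; rewrite lerD2r.
have [F FP] := choice Flim.
have wbd m k : 1 - 1 / 2 <= (1 + e m * lam k) ^+ m.+1 <= 1 + 2 * (1 / 2).
  have w : `|e m * lam k| * m.+1%:R <= 1 / 2.
    rewrite normrM (ger0_norm (e0 m)) mulrAC [e m * _]mulrC em mulrC.
    by apply: le_trans ct4; apply: ler_wpM2r => //; exact: ltW.
  have /andP[h1 h2] := expr_bounds w.
  by apply/andP; split; [apply: le_trans h1 | apply: le_trans h2 _]; move: w; move: (_ * m.+1%:R) => w; lra.
have flim k : exists l : R, ((1 + e m * lam k) ^+ m.+1 @[m --> U] --> l)%classic.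
  apply: (@ultra_cvg _ _ _ _ 2) => m; have /andP[h1 h2] := wbd m k.
  by move: h1 h2; move: (_ ^+ _) => w h1 h2; rewrite ger0_norm; lra.
have [f fP] := choice flim.
(* With [g = gap / 2], the bound [1 + e m * lam k <= 2] gives [(1 + e m * lam k) * (1 + e m * g) <=
   1 + e m * lam l] for [k < l], and the power of the second factor is at least [1 + tau * g] by the
   Bernoulli inequality. *)
pose th := (1 + tau * (gap / 2))^-1.
have tg0 : 0 < tau * (gap / 2) by rewrite mulr_gt0 // divr_gt0.
have tg1 : 0 < 1 + tau * (gap / 2) by rewrite addr_gt0.
exists tau, F, f, th; split; split => //.
- move=> k; apply: (@lt_le_trans _ _ (1 - 1 / 2)); first by lra.
  by apply: (cvgr_to_ge (fP k)); apply: nearW => m; have /andP[] := wbd m k.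
- by rewrite invr_ge0 ltW //= invf_lt1 // ltrDl.
- move=> k l kl; rewrite /th mulrC ler_pdivlMr //.
  have fk : ((1 + e m * lam k) ^+ m.+1 * (1 + tau * (gap / 2)) @[m --> U] --> f k * (1 + tau * (gap / 2)))%classic.
    by apply: cvgMr_tmp; exact: fP.
  apply: (ler_cvg_to fk (fP l)); apply: nearW => m.
  have lk := lam_le k; have kn : 1 / 2 <= 1 + e m * lam k <= 2.
    have : `|e m * lam k| <= 1 / 2.
      rewrite normrM (ger0_norm (e0 m)); apply: le_trans ct4; rewrite mulrC.
      apply: ler_pM => //; rewrite -(em m) -[leLHS]mul1r ler_wpM2r //.
      by rewrite ler1n.
    by rewrite ler_norml => /andP[]; move: (e m * lam k) => x; lra.
  case/andP: kn => kn1 kn2.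
  apply: (@le_trans _ _ ((1 + e m * lam k) ^+ m.+1 * (1 + e m * (gap / 2)) ^+ m.+1)).
    rewrite ler_wpM2l ?exprn_ge0 //; first by move: kn1; move: (e m * lam k) => x; lra.
    rewrite -(em m) -mulrA; apply: bernoulli; rewrite mulr_ge0 // divr_ge0 // ltW //.
  rewrite -exprMn; apply: lerXn2r; rewrite ?nnegrE.
  + rewrite mulr_ge0 //; first by move: kn1; move: (e m * lam k) => x; lra.
    by rewrite addr_ge0 // mulr_ge0 // divr_ge0 // ltW.
  + have /andP[+ _] := wbd m l; rewrite exprS => _.
    have := ler_wpM2l (e0 m) (lam_gap kl); have := mulr_ge0 (e0 m) (ltW gap_gt0).
    by rewrite mulrDr; move: kn1; move: (e m * lam k) (e m * lam l) (e m * gap) => x y z; lra.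
  have := ler_wpM2l (e0 m) (lam_gap kl).
  have eg : 0 <= e m * (gap / 2) by rewrite mulr_ge0 // divr_ge0 // ltW.
  have := ler_wpM2r eg kn2; rewrite mulrDr (_ : e m * gap = 2 * (e m * (gap / 2))); last by field.
  move: (e m * lam k) (e m * lam l) (e m * (gap / 2)) => x y z; lra.
- move=> j; rewrite -[F j](subrK 1) addrC; apply: unit_near1.
  have F1 : cvA U (fun m => Eu j m - 1) (F j - 1) by apply: cvAB => //; exact: cvA_cst.
  by apply: (cvA_nrm_le _ F1); apply: nearW.
- move=> j a; apply: subr0_eq.
  have E0 : cvA U (fun m => Eu j m * phi (- (j%:R * tau)) a - phi (- (j.+1%:R * tau)) a * Eu j m) 0.
    apply: (@cvA_le_near _ _ _ _ _ _ _ (fun m => 2 * (K a * (1 + c) * (2 * D) * e m) * tau)).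
      apply: nearW => m; rewrite subr0.
      have -> : - (j.+1%:R * tau) = - (j%:R * tau) - m.+1%:R * e m by rewrite em -[j.+1%:R]natr1; ring.
      rewrite -[X in _ <= _ * X](em m).
      apply: (@euler_intertwine _ _ h (fun s => phi s a) _ _ c) => //.
      - exact: hj.
      - by move=> s sj; apply: phi_lip => //; exact: le_trans sj (t0 j).
      - by move=> s sj; apply: phi_taylor => //; exact: le_trans sj (t0 j).
      by rewrite em.
    rewrite -(mul0r tau); apply: cvgMr_tmp; rewrite -(mulr0 2); apply: cvgMl_tmp.
    rewrite -(mulr0 (K a * (1 + c) * (2 * D))); exact: cvgMl_tmp.
  apply: (cvA_unique _ E0); apply: cvAB; [exact: cvAMr | exact: cvAMl].
- move=> b hb j; apply: (cvA_eq (cvAMr b (FP j)) (cvAMl b (FP j))); apply: nearW => m.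
  exact: euler_comm.
pose Dm m := \sum_k rscale ((1 + e m * lam k) ^+ m.+1) (pi k).
have Dlim : cvA U Dm (blockD pi f).
  apply: cvA_sum => k _; rewrite /cvA.
  have -> : (fun m => nrm (rscale ((1 + e m * lam k) ^+ m.+1) (pi k) - rscale (f k) (pi k))) =
            (fun m => `|(1 + e m * lam k) ^+ m.+1 - f k| * nrm (pi k)).
    by apply/funext => m; rewrite -nrm_rscale /rscale -scalerBl -rmorphB.
  rewrite -(mul0r (nrm (pi k))); apply: cvgMr_tmp; apply/norm_cvg0P.
  rewrite -(subrr (f k)); apply: cvgB; [exact: fP|exact: cvg_cst].
(* The Euler products for [h] and for its limit [H] differ by a multiple of the bound on
   [nrm (h s - H)], uniformly in the step size. *)
have close j sg : 0 <= sg -> (forall s, s <= - (j%:R * tau) -> nrm (h s - H) <= sg) ->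
    nrm (F j - blockD pi f) <= 2 * (2 * D * sg) * tau.
  move=> sg0 hH; apply: (cvA_nrm_le _ (cvAB (FP j) Dlim)); apply: nearW => m.
  rewrite /Dm -(euler_diag lam piM pi_sum (- (j%:R * tau))) -[X in _ <= _ * X](em m).
  by apply: (euler_compare c_ge0) => //; [exact: hj | rewrite em].
apply/cvgrPdist_lt => eps eps0.
have k0 : 0 < 4 * D * tau + 1 by rewrite ltr_wpDl // mulr_ge0 ?mulr_ge0 // ltW.
have [s0 s0P] := h_lim (divr_gt0 eps0 k0).
exists (Num.bound (`|s0| / tau)) => // j /= jb.
rewrite sub0r normrN ger0_norm ?nrm_ge0 //.
have sg0 : 0 <= eps / (4 * D * tau + 1) by rewrite divr_ge0 // ltW.
apply: le_lt_trans (close j _ sg0 _) _.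
  move=> s sj; apply: s0P; apply: le_trans sj _.
  rewrite lerNl; apply: le_trans (ler_norm _) _; rewrite normrN.
  rewrite -ler_pdivrMr //; apply: ltW; apply: lt_le_trans (archi_boundP _) _.
    by rewrite divr_ge0 // ltW.
  by rewrite ler_nat.
rewrite (_ : 2 * _ * tau = (4 * D * tau) * (eps / (4 * D * tau + 1))); last by ring.
by rewrite mulrCA mulrA ltr_pdivrMr // mulrDr mulr1 ltrDl.
Qed.

End Intertwiners.

(** * A priori estimates along the flow *)

Section FlowEstimates.
Variables (R : realType) (d : nat) (T : finType).
Notation A := 'M[R[i]]_d.

(* i (mu - alpha) in the notation of the statement. *)
Definition moment (al : A) (z : T -> A) : A :=
  al + rscale (1 / 2) 1 * \sum_a (z a * adj (z a) - adj (z a) * z a).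

Lemma cvA_entries (I : Type) (F : set_system I) (FF : Filter F) (u : I -> A) (a : A) :
  (forall p q, (complex.Re (u s p q) @[s --> F] --> complex.Re (a p q))%classic /\
               (complex.Im (u s p q) @[s --> F] --> complex.Im (a p q))%classic) -> cvA F u a.
Proof.
move=> ua; rewrite /cvA /nrm.
have c0 (g : I -> R) l : (g s @[s --> F] --> l)%classic -> (`|g s - l| @[s --> F] --> (0 : R))%classic.
  move=> gl; apply/cvgrPdist_lt => e e0; move/cvgrPdist_lt: gl => /(_ e e0).
  by apply: filterS => s; rewrite sub0r normrN normr_id distrC.
have sum0 (J : finType) (g : J -> I -> R) : (forall j, (g j s @[s --> F] --> (0 : R))%classic) ->
    (\sum_j g j s @[s --> F] --> (0 : R))%classic.
  move=> g0; elim: (index_enum J) => [|j s IHs].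
    by under eq_fun do rewrite big_nil; exact: cvg_cst.
  under eq_fun do rewrite big_cons.
  by apply: (@cvg_toE _ _ _ _ (0 + 0)); [exact: (cvgD (g0 j) IHs) | rewrite addr0].
apply: (sum0) => p; apply: (sum0) => q; have [h1 h2] := ua p q.
have -> : (fun s => abs1 ((u s - a) p q)) =
    (fun s => `|complex.Re (u s p q) - complex.Re (a p q)| + `|complex.Im (u s p q) - complex.Im (a p q)|).
  by apply/funext => s; rewrite /abs1 !mxE; case: (u s p q) (a p q) => ? ? [].
by apply: (@cvg_toE _ _ _ _ (0 + 0)); [exact: (cvgD (c0 _ _ h1) (c0 _ _ h2)) | rewrite addr0].
Qed.

Variables (al : A) (x : T -> A) (phi : R -> T -> A).
Let h t := moment al (phi t).
Let v t a := phi t a * h t - h t * phi t a.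
Hypothesis phiD : forall (t : R) a p q, t <= 0 ->
  is_derive t 1 (fun s => complex.Re (phi s a p q)) (complex.Re (v t a p q)) /\
  is_derive t 1 (fun s => complex.Im (phi s a p q)) (complex.Im (v t a p q)).
Hypothesis phi_lim : forall a p q,
  (complex.Re (phi t a p q) @[t --> -oo] --> complex.Re (x a p q))%classic /\
  (complex.Im (phi t a p q) @[t --> -oo] --> complex.Im (x a p q))%classic.

Lemma flow_cvA a : cvA (-oo)%classic (fun t => phi t a) (x a).
Proof. exact: cvA_entries. Qed.

Lemma moment_cvA : cvA (-oo)%classic h (moment al x).
Proof.
rewrite /h /moment; apply: cvAD; first exact: cvA_cst.
apply: cvAMl; apply: cvA_sum => a _.
have hx := flow_cvA a; have hx' : cvA (-oo)%classic (fun t => adj (phi t a)) (adj (x a)) by exact: cvA_adj.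
by apply: cvAB; exact: cvAM.
Qed.

Lemma derive_bounded (g dg : R -> R) (t0 : R) :
  (forall t : R, t <= 0 -> is_derive t 1 g (dg t)) -> exists B, forall t, t0 <= t -> t <= 0 -> `|g t| <= B.
Proof.
move=> gD; have [t00|t00] := leP t0 0; last first.
  by exists 0 => t h1 h2; move: (le_trans h1 h2); rewrite leNgt t00.
have cont : ({within `[t0, 0], continuous g})%classic.
  apply: derivable_within_continuous => t; rewrite in_itv /= => /andP[_ t1].
  by have := gD _ t1 => -[].
have contN : ({within `[t0, 0], continuous (fun t => - g t)})%classic.
  by move=> t; apply: continuousN; exact: cont.
have [c1 _ h1] := EVT_max t00 cont; have [c2 _ h2] := EVT_max t00 contN.
exists (Num.max (g c1) (- g c2)) => t ht0 ht; rewrite ler_norml; apply/andP; split.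
  by rewrite lerNl le_max h2 ?orbT // in_itv /= ht0 ht.
by rewrite le_max h1 // in_itv /= ht0 ht.
Qed.

(** Near -oo by convergence, and on the remaining compact interval by continuity of the entries. *)
Lemma flow_bounded : exists2 B, 0 <= B & forall t a, t <= 0 -> nrm (phi t a) <= B.
Proof.
suff ha a : exists B, forall t, t <= 0 -> nrm (phi t a) <= B.
  have [B BP] := choice ha; exists (\sum_a `|B a|); first exact: sumr_ge0.
  move=> t a t0; apply: le_trans (BP a t t0) _; apply: le_trans (ler_norm _) _.
  by rewrite (bigD1 a) //= lerDl sumr_ge0.
have [t0 t0P] : exists t0, forall t, t <= t0 -> nrm (phi t a) <= nrm (x a) + 1.
  have [t0 [_ t0P]] := cvA_lt (flow_cvA a) ltr01; exists (t0 - 1) => t tt.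
  have /t0P/ltW h1 : t < t0 by apply: le_lt_trans tt _; rewrite gtrBl.
  by rewrite -[phi t a](subrK (x a)) addrC; apply: le_trans (nrmD _ _) _; rewrite lerD2l.
have reb p q : exists B, forall t, t0 <= t -> t <= 0 -> `|complex.Re (phi t a p q)| <= B.
  by apply: (@derive_bounded _ (fun t => complex.Re (v t a p q))) => t t1; have [] := phiD a p q t1.
have imb p q : exists B, forall t, t0 <= t -> t <= 0 -> `|complex.Im (phi t a p q)| <= B.
  by apply: (@derive_bounded _ (fun t => complex.Im (v t a p q))) => t t1; have [] := phiD a p q t1.
pose B1 p q := projT1 (cid (reb p q)); pose B2 p q := projT1 (cid (imb p q)).
exists (nrm (x a) + 1 + \sum_p \sum_q `|B1 p q + B2 p q|) => t t1.
have s0 : 0 <= \sum_p \sum_q `|B1 p q + B2 p q| by do 2!apply: sumr_ge0 => ? _.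
have [tt|tt] := leP t t0; first by apply: le_trans (t0P t tt) _; rewrite lerDl.
apply: (@le_trans _ _ (\sum_p \sum_q `|B1 p q + B2 p q|)); last by rewrite lerDr addr_ge0 ?nrm_ge0.
apply: ler_sum => p _; apply: ler_sum => q _; apply: le_trans (ler_norm _); apply: lerD.
  exact: (projT2 (cid (reb p q))) (ltW tt) t1.
exact: (projT2 (cid (imb p q))) (ltW tt) t1.
Qed.

Lemma moment_le (B : R) (z : T -> A) : (forall a, nrm (z a) <= B) -> 0 <= B ->
  nrm (moment al z) <= nrm al + #|T|%:R * (B * B).
Proof.
move=> zB B0; apply: le_trans (nrmD _ _) _; rewrite lerD2l -rscaleE nrm_rscale.
rewrite ger0_norm ?divr_ge0 //.
have : nrm (\sum_a (z a * adj (z a) - adj (z a) * z a)) <= \sum_(a : T) 2 * (B * B).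
  apply: le_trans (nrm_sum _ _ _) _; apply: ler_sum => a _; apply: le_trans (nrmB _ _) _.
  have h1 : nrm (z a) * nrm (z a) <= B * B by apply: ler_pM; rewrite ?nrm_ge0.
  have := nrmM (z a) (adj (z a)); have := nrmM (adj (z a)) (z a); rewrite nrm_adj.
  by move: h1; lra.
by rewrite sumr_const -mulr_natl => h1; have := ler_wpM2l (ltW (divr_gt0 ltr01 (ltr0n R 2))) h1; lra.
Qed.

Lemma moment_lip (B e : R) (z w : T -> A) : 0 <= B -> 0 <= e ->
  (forall a, nrm (z a) <= B) -> (forall a, nrm (w a) <= B) -> (forall a, nrm (z a - w a) <= e) ->
  nrm (moment al z - moment al w) <= #|T|%:R * (2 * B * e).
Proof.
move=> B0 e0 zB wB zw.
have -> : moment al z - moment al w = rscale (1 / 2) (\sum_a ((z a - w a) * adj (z a) + w a * adj (z a - w a)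
    - (adj (z a - w a) * z a + adj (w a) * (z a - w a)))).
  rewrite rscaleE /moment opprD addrACA subrr add0r -mulrBr; congr (_ * _).
  by rewrite -sumrB; apply: eq_bigr => a _; rewrite adjB; ncring.
rewrite nrm_rscale ger0_norm ?divr_ge0 //.
have : nrm (\sum_a ((z a - w a) * adj (z a) + w a * adj (z a - w a)
    - (adj (z a - w a) * z a + adj (w a) * (z a - w a)))) <= \sum_(a : T) 4 * (B * e).
  apply: le_trans (nrm_sum _ _ _) _; apply: ler_sum => a _.
  have h1 : nrm ((z a - w a) * adj (z a)) <= e * B.
    by apply: le_trans (nrmM _ _) _; rewrite nrm_adj ler_pM ?nrm_ge0.
  have h2 : nrm (w a * adj (z a - w a)) <= B * e.
    by apply: le_trans (nrmM _ _) _; rewrite nrm_adj ler_pM ?nrm_ge0.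
  have h3 : nrm (adj (z a - w a) * z a) <= e * B.
    by apply: le_trans (nrmM _ _) _; rewrite nrm_adj ler_pM ?nrm_ge0.
  have h4 : nrm (adj (w a) * (z a - w a)) <= B * e.
    by apply: le_trans (nrmM _ _) _; rewrite nrm_adj ler_pM ?nrm_ge0.
  apply: le_trans (nrmB _ _) _; have := lerD (le_trans (nrmD _ _) (lerD h1 h2)) (le_trans (nrmD _ _) (lerD h3 h4)).
  by move/le_trans; apply; lra.
by rewrite sumr_const -mulr_natl => h1; have := ler_wpM2l (ltW (divr_gt0 ltr01 (ltr0n R 2))) h1; lra.
Qed.

Lemma nrm_entries (a : A) (B : R) : (forall p q, `|complex.Re (a p q)| <= B /\ `|complex.Im (a p q)| <= B) ->
  nrm a <= (d * d)%:R * (2 * B).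
Proof.
move=> aB; apply: (@le_trans _ _ (\sum_(p < d) \sum_(q < d) (2 * B))).
  apply: ler_sum => p _; apply: ler_sum => q _; have [h1 h2] := aB p q.
  by apply: le_trans (lerD h1 h2) _; lra.
under eq_bigr do rewrite sumr_const card_ord.
by rewrite sumr_const card_ord -mulrnA -[leLHS]mulr_natl.
Qed.

Lemma entry_mvt (g dg : R -> R) t e : t <= 0 -> 0 <= e ->
  (forall s : R, s <= 0 -> is_derive s 1 g (dg s)) ->
  exists s, [/\ t - e <= s, s <= t & g (t - e) - g t = - (e * dg s)].
Proof.
move=> t0 e0 gD; have te : t - e <= t by rewrite gerBl.
have cont : ({within `[t - e, t], continuous g})%classic.
  apply: derivable_within_continuous => s; rewrite in_itv /= => /andP[_ s1].
  by have := gD _ (le_trans s1 t0) => -[].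
have gD' (s : R) : s \in `]t - e, t[%R -> is_derive s 1 g (dg s).
  by rewrite in_itv /= => /andP[_ s1]; apply: gD; apply: le_trans t0; exact: ltW.
have [s] := MVT_segment te gD' cont; rewrite in_itv /= => /andP[h1 h2] gE; exists s; split => //.
by rewrite -opprB gE opprB addrC subrK mulrC.
Qed.

Lemma abs1_Re (a : A) p q : `|complex.Re (a p q)| <= nrm a.
Proof. by apply: le_trans (abs1_le_nrm a p q); rewrite lerDl. Qed.
Lemma abs1_Im (a : A) p q : `|complex.Im (a p q)| <= nrm a.
Proof. by apply: le_trans (abs1_le_nrm a p q); rewrite lerDr. Qed.

(** No second derivative is taken for the quadratic remainder: by the mean value theorem each real
    entry of [phi (t - e) a - phi t a] is [- e] times that of [v s a] for some [s] between [t - e]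
    and [t], and [v] is Lipschitz along the flow. *)
Lemma flow_estimates : exists c K : R, [/\ 0 <= c, 0 <= K, forall t, t <= 0 -> nrm (h t) <= c,
  forall a t e, t <= 0 -> 0 <= e -> nrm (phi (t - e) a - phi t a) <= K * e &
  forall a t e, t <= 0 -> 0 <= e ->
    nrm (phi (t - e) a - phi t a - rscale e 1 * (h t * phi t a - phi t a * h t)) <= K * (e * e)].
Proof.
have [B B0 phiB] := flow_bounded.
pose c := nrm al + #|T|%:R * (B * B).
have c0 : 0 <= c by rewrite addr_ge0 ?nrm_ge0 ?mulr_ge0.
have hc t : t <= 0 -> nrm (h t) <= c by move=> t0; apply: moment_le => // a; exact: phiB.
pose V := 2 * (B * c).
have V0 : 0 <= V by rewrite !mulr_ge0.
have vV t a : t <= 0 -> nrm (v t a) <= V.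
  move=> t0; apply: le_trans (nrmB _ _) _.
  have h1 : nrm (phi t a * h t) <= B * c by apply: le_trans (nrmM _ _) _; rewrite ler_pM ?nrm_ge0 ?phiB ?hc.
  have h2 : nrm (h t * phi t a) <= B * c.
    by apply: le_trans (nrmM _ _) _; rewrite mulrC ler_pM ?nrm_ge0 ?phiB ?hc.
  by have := lerD h1 h2; rewrite /V; lra.
pose K1 := (d * d)%:R * (2 * V).
have K10 : 0 <= K1 by rewrite !mulr_ge0.
have lip a t e : t <= 0 -> 0 <= e -> nrm (phi (t - e) a - phi t a) <= K1 * e.
  move=> t0 e0; have -> : K1 * e = (d * d)%:R * (2 * (V * e)) by rewrite /K1; ring.
  apply: nrm_entries => p q; rewrite !mxE; split.
    have [s [s1 s2 sE]] := @entry_mvt (fun s => complex.Re (phi s a p q)) (fun t => complex.Re (v t a p q)) t e t0 e0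
      (fun s s0 => (phiD a p q s0).1).
    have -> : complex.Re (phi (t - e) a p q - phi t a p q) = complex.Re (phi (t - e) a p q) - complex.Re (phi t a p q).
      by case: (phi (t - e) a p q) (phi t a p q) => ? ? [].
    rewrite sE normrN normrM ger0_norm // mulrC ler_wpM2r //.
    by apply: le_trans (abs1_Re _ _ _) _; apply: vV; exact: le_trans s2 t0.
  have [s [s1 s2 sE]] := @entry_mvt (fun s => complex.Im (phi s a p q)) (fun t => complex.Im (v t a p q)) t e t0 e0
      (fun s s0 => (phiD a p q s0).2).
  have -> : complex.Im (phi (t - e) a p q - phi t a p q) = complex.Im (phi (t - e) a p q) - complex.Im (phi t a p q).
    by case: (phi (t - e) a p q) (phi t a p q) => ? ? [].
  rewrite sE normrN normrM ger0_norm // mulrC ler_wpM2r //.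
  by apply: le_trans (abs1_Im _ _ _) _; apply: vV; exact: le_trans s2 t0.
pose L := 2 * (K1 * c + B * (#|T|%:R * (2 * B * K1))).
have L0 : 0 <= L by rewrite !mulr_ge0 ?addr_ge0 ?mulr_ge0.
have vlip a s t e : t <= 0 -> 0 <= e -> t - e <= s -> s <= t -> nrm (v s a - v t a) <= L * e.
  move=> t0 e0 es st; have s0 := le_trans st t0.
  have ts : nrm (phi s a - phi t a) <= K1 * e.
    have := lip a t (t - s) t0; rewrite subr_ge0 => /(_ st); rewrite subKr => /le_trans; apply.
    by rewrite ler_wpM2l // lerBlDr addrC -lerBlDr.
  have hs : nrm (h s - h t) <= #|T|%:R * (2 * B * (K1 * e)).
    apply: moment_lip => // [|b|b|b]; rewrite ?mulr_ge0 ?phiB //.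
    have := lip b t (t - s) t0; rewrite subr_ge0 => /(_ st); rewrite subKr => /le_trans; apply.
    by rewrite ler_wpM2l // lerBlDr addrC -lerBlDr.
  have -> : v s a - v t a = ((phi s a - phi t a) * h s + phi t a * (h s - h t))
      - ((h s - h t) * phi s a + h t * (phi s a - phi t a)) by rewrite /v; ncring.
  have g1 : nrm ((phi s a - phi t a) * h s) <= K1 * e * c by apply: le_trans (nrmM _ _) _; rewrite ler_pM ?nrm_ge0 ?hc.
  have g2 : nrm (phi t a * (h s - h t)) <= B * (#|T|%:R * (2 * B * (K1 * e))).
    by apply: le_trans (nrmM _ _) _; rewrite ler_pM ?nrm_ge0 ?phiB.
  have g3 : nrm ((h s - h t) * phi s a) <= B * (#|T|%:R * (2 * B * (K1 * e))).
    by apply: le_trans (nrmM _ _) _; rewrite mulrC ler_pM ?nrm_ge0 ?phiB.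
  have g4 : nrm (h t * (phi s a - phi t a)) <= K1 * e * c.
    by apply: le_trans (nrmM _ _) _; rewrite mulrC ler_pM ?nrm_ge0 ?hc.
  apply: le_trans (nrmB _ _) _; have := lerD (le_trans (nrmD _ _) (lerD g1 g2)) (le_trans (nrmD _ _) (lerD g3 g4)).
  by move/le_trans; apply; rewrite /L le_eqVlt; apply/orP; left; apply/eqP; ring.
pose K2 := (d * d)%:R * (2 * L).
have K20 : 0 <= K2 by rewrite /K2 mulr_ge0 // mulr_ge0.
exists c, (K1 + K2); split => //; first exact: addr_ge0.
  by move=> a t e t0 e0; apply: le_trans (lip a t e t0 e0) _; rewrite ler_wpM2r // lerDl.
move=> a t e t0 e0; apply: (@le_trans _ _ (K2 * (e * e))); last by rewrite ler_wpM2r ?mulr_ge0 // lerDr.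
have -> : phi (t - e) a - phi t a - rscale e 1 * (h t * phi t a - phi t a * h t) =
  phi (t - e) a - phi t a + rscale e (v t a) by rewrite [rscale e (v _ _)]rscaleE /v; ncring.
have -> : K2 * (e * e) = (d * d)%:R * (2 * (L * e * e)) by rewrite /K2; ring.
apply: nrm_entries => p q; split.
  have [s [s1 s2 sE]] := @entry_mvt (fun s => complex.Re (phi s a p q)) (fun t => complex.Re (v t a p q)) t e t0 e0
      (fun s s0 => (phiD a p q s0).1).
  have -> : complex.Re ((phi (t - e) a - phi t a + rscale e (v t a)) p q) =
      - (e * complex.Re ((v s a - v t a) p q)).
    move: sE; move: (v s a) (v t a) => w1 w2; rewrite !mxE; case: (phi (t - e) a p q) (phi t a p q) (w1 p q) (w2 p q) => ? ? [? ?] [? ?] [? ?] /= ->.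
    by ring.
  rewrite normrN normrM ger0_norm // mulrC ler_wpM2r //.
  by apply: le_trans (abs1_Re _ _ _) _; exact: vlip.
have [s [s1 s2 sE]] := @entry_mvt (fun s => complex.Im (phi s a p q)) (fun t => complex.Im (v t a p q)) t e t0 e0
      (fun s s0 => (phiD a p q s0).2).
have -> : complex.Im ((phi (t - e) a - phi t a + rscale e (v t a)) p q) =
    - (e * complex.Im ((v s a - v t a) p q)).
  move: sE; move: (v s a) (v t a) => w1 w2; rewrite !mxE; case: (phi (t - e) a p q) (phi t a p q) (w1 p q) (w2 p q) => ? ? [? ?] [? ?] [? ?] /= ->.
  by ring.
rewrite normrN normrM ger0_norm // mulrC ler_wpM2r //.
by apply: le_trans (abs1_Im _ _ _) _; exact: vlip.
Qed.

End FlowEstimates.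

(** * Flow lines are triangular with respect to the limit *)

Section GradedAlgebra.
Variable (T : pzRingType).
Implicit Types (P Q X Y : T).

(** [X] respects the larger step of the flag and [Y] the smaller one, so that on the graded piece
    the projection in the middle may be dropped. *)
Lemma graded_mul (P0 P1 P0' P1' P0'' P1'' X Y : T) :
  P1 * P1 = P1 -> P1 * P0 = P0 -> P0'' * P0'' = P0'' -> P1'' * P0'' = P0'' ->
  (1 - P1') * X * P1 = 0 -> (1 - P0'') * Y * P0' = 0 ->
  (P1'' - P0'') * Y * (P1' - P0') * X * (P1 - P0) = (P1'' - P0'') * (Y * X) * (P1 - P0).
Proof.
move=> p11 p10 q00 q10 hX hY.
apply: (@nc_lincomb _ _ _ (- (P1'' - P0'') * Y * ((1 - P1') * X * P1) * (P1 - P0)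
  + (P1'' - P0'') * Y * (1 - P1') * X * ((P1 * P1 - P1) - (P1 * P0 - P0))
  - (P1'' - P0'') * ((1 - P0'') * Y * P0') * X * (P1 - P0)
  - ((P1'' * P0'' - P0'') - (P0'' * P0'' - P0'')) * Y * P0' * X * (P1 - P0))).
  by rewrite hX hY p11 p10 q00 q10 !subrr; ncring.
by ncring.
Qed.

End GradedAlgebra.

Section Forward.
Variables (R : realType) (d n : nat) (T : finType) (S : Type).
Notation A := 'M[R[i]]_d.
Variables (al : A) (x : T -> A) (phi : R -> T -> A).
Variables (pi : 'I_n -> A) (lam : 'I_n -> R) (gap : R) (E : S -> A) (beta : 'I_n -> A).
Let h t := moment al (phi t).
Hypothesis phiD : forall (t : R) a p q, t <= 0 ->
  is_derive t 1 (fun s => complex.Re (phi s a p q)) (complex.Re ((phi t a * h t - h t * phi t a) p q)) /\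
  is_derive t 1 (fun s => complex.Im (phi s a p q)) (complex.Im ((phi t a * h t - h t * phi t a) p q)).
Hypothesis phi_lim : forall a p q,
  (complex.Re (phi t a p q) @[t --> -oo] --> complex.Re (x a p q))%classic /\
  (complex.Im (phi t a p q) @[t --> -oo] --> complex.Im (x a p q))%classic.
Hypothesis piM : forall k l, pi k * pi l = if k == l then pi k else 0.
Hypothesis pi_sum : \sum_k pi k = 1.
Hypothesis pi_neq0 : forall k, pi k != 0.
Hypothesis moment_x : moment al x = \sum_k rscale (lam k) (pi k).
Hypothesis gap_gt0 : 0 < gap.
Hypothesis lam_gap : forall k l : 'I_n, (k < l)%N -> lam k + gap <= lam l.
Hypothesis pi_x : forall k a, pi k * x a = x a * pi k.
Hypothesis pi_E : forall k s, pi k * E s = E s * pi k.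
Hypothesis pi_beta : forall k l, pi k * beta l = beta l * pi k.
(* In the application the [E s] are the projections onto the spaces V_i. *)
Hypothesis h_E : forall t s, h t * E s = E s * h t.
Hypothesis h_beta : forall t l, h t * beta l = beta l * h t.
Hypothesis beta_tr : forall k, rtr (beta k * pi k) = 0.
Hypothesis stab : forall k s, s * s = s -> pi k * s = s -> (forall a, x a * s = s * x a * s) ->
  (forall e, E e * s = s * E e * s) -> s != 0 -> s * pi k != pi k -> rtr (beta k * s) < 0.

Theorem flow_triangular : exists G G' : A,
  [/\ G * G' = 1, G' * G = 1, forall s, G * E s = E s * G &
     forall a (k l : 'I_n), (l <= k)%N ->
       pi k * (G * phi 0 a * G') * pi l = if k == l then x a * pi k else 0].
Proof.
have [c [K [c0 K0 hc lip tay]]] := flow_estimates phiD phi_lim.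
pose c1 := c + nrm (moment al x) + \sum_k `|lam k|.
have s0 : 0 <= \sum_k `|lam k| by apply: sumr_ge0.
have c10 : 0 <= c1 by rewrite !addr_ge0 ?nrm_ge0.
have h_lim e : 0 < e -> exists t0, forall t, t <= t0 -> nrm (h t - \sum_k rscale (lam k) (pi k)) <= e.
  move=> e0; have mc : cvA (-oo)%classic h (moment al x) by exact: moment_cvA phi_lim.
  have [t0 [_ t0P]] := cvA_lt mc e0; exists (t0 - 1) => t tt.
  by rewrite -moment_x ltW //; apply: t0P; apply: le_lt_trans tt _; rewrite gtrBl.
have H_le : nrm (\sum_k rscale (lam k) (pi k)) <= c1.
  by rewrite -moment_x /c1 addrAC lerDr addr_ge0.
have lam_le k : `|lam k| <= c1.
  rewrite /c1 (bigD1 k) //= addrCA lerDl !addr_ge0 ?nrm_ge0 //.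
  by apply: sumr_ge0.
have hc1 t : t <= 0 -> nrm (h t) <= c1.
  by move=> t0; apply: le_trans (hc t t0) _; rewrite /c1 -addrA lerDl addr_ge0 ?nrm_ge0.
have [tau [F [f [th [[tau0 f0 /andP[th0 th1] fth] [Fu Fphi Fcomm Flim]]]]]] :=
  exists_intertwiners piM pi_sum c10 hc1 H_le lam_le h_lim gap_gt0 lam_gap (fun=> K0) lip tay.
have [B B0 phiB] := flow_bounded phiD phi_lim.
(* The constant maps [E s] and [beta l] are treated as additional arrows, so that the flags and the
   isomorphisms of graded pieces respect them as well. *)
pose T' := (T + (S + 'I_n))%type.
pose Phi j (t : T') : A := match t with
  | inl a => phi (- (j%:R * tau)) a | inr (inl s) => E s | inr (inr l) => beta l end.
pose X (t : T') : A := match t with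
  | inl a => x a | inr (inl s) => E s | inr (inr l) => beta l end.
have FPhi j t : F j * Phi j t = Phi j.+1 t * F j.
  case: t => [a|[s|l]] /=; first exact: Fphi.
    by apply: Fcomm => t; exact: h_E.
  by apply: Fcomm => t; exact: h_beta.
have PhiX t : cvA \oo%classic (fun j => Phi j t) (X t).
  case: t => [a|[s|l]] /=; try exact: cvA_cst.
  apply/cvgrPdist_lt => e e0.
  have [s1 [_ s1P]] := cvA_lt (flow_cvA phi_lim a) e0.
  exists (Num.bound ((`|s1| + 1) / tau)) => // j /= jb.
  rewrite sub0r normrN ger0_norm ?nrm_ge0 //; apply: s1P.
  rewrite ltrNl; apply: le_lt_trans (ler_norm _) _; rewrite normrN.
  rewrite -ltr_pdivrMr //; apply: (@lt_le_trans _ _ ((`|s1| + 1) / tau)).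
    by rewrite ltr_pM2r ?invr_gt0 // ltrDl.
  apply: ltW; apply: lt_le_trans (archi_boundP _) _; last by rewrite ler_nat.
  by rewrite divr_ge0 ?addr_ge0 // ltW.
have PhiB j t : nrm (Phi j t) <= match t with
    | inl a => B | inr (inl s) => nrm (E s) | inr (inr l) => nrm (beta l) end.
  by case: t => [a|[s|l]] //=; apply: phiB; rewrite oppr_le0 mulr_ge0 // ltW.
have piX k t : pi k * X t = X t * pi k by case: t => [a|[s|l]] /=.
have [U [UU Uoo]] := @ultraFilterLemma _ (\oo%classic : set_system nat) _.
(* From [j1] on the intertwiners are close enough to [blockD] for the graph transform; the flags
   [Q j] below belong to the index [j + j1]. *)
have [j1 j1P] : exists j1, forall j, (j1 <= j)%N -> kap pi f * nb pi (F j - blockD pi f) <= (1 - th) / 4.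
  have [K' K'0 nbK] := nb_le pi.
  have k0 : 0 <= kap pi f by rewrite /kap !mulr_ge0 ?addr_ge0 ?cI_ge0 ?cp_ge0.
  have kK : 0 < kap pi f * K' + 1 by apply: ltr_wpDl => //; exact: mulr_ge0.
  have s40 : 0 < (1 - th) / 4 by rewrite divr_gt0 // subr_gt0.
  have [j0 _ j0P] := cvA_lt Flim (divr_gt0 s40 kK).
  exists j0 => j jj; have : nrm (F j - blockD pi f) < (1 - th) / 4 / (kap pi f * K' + 1) by exact: j0P.
  rewrite ltr_pdivlMr // => /ltW; apply: le_trans.
  apply: (@le_trans _ _ (kap pi f * (K' * nrm (F j - blockD pi f)))); first by rewrite ler_wpM2l.
  by rewrite mulrA [leRHS]mulrC ler_wpM2r ?nrm_ge0 // lerDl.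
have shift (u : nat -> A) a j : cvA \oo%classic u a -> cvA \oo%classic (fun i => u (i + j)%N) a.
  move=> ua; apply/cvgrPdist_lt => e e0; have [j0 _ j0P] := cvA_lt ua e0.
  exists j0 => // i /= ij; rewrite sub0r normrN ger0_norm ?nrm_ge0 //; apply: j0P => /=.
  exact: leq_trans ij (leq_addr _ _).
have toU (u : nat -> A) a : cvA \oo%classic u a -> cvA U u a.
  by move=> ua V /ua; exact: Uoo.
have [Q [q12 q3 q4 q5 q6]] := @invariant_flags R d n pi f th piM pi_sum f0 th0 th1 fth
  (fun j => F (j + j1)%N) U UU Uoo (fun j => j1P _ (leq_addl _ _)) (shift _ _ _ Flim)
  T' (fun j => Phi (j + j1)%N) _ (fun j t => PhiB _ t) (fun j t => FPhi _ t).
have q1 j c' : lowp pi c' * Q j c' = lowp pi c' by case: (q12 j c').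
have q2 j c' : Q j c' * lowp pi c' = Q j c' by case: (q12 j c').
have Qd j c' c'' : (c' <= c'')%N -> Q j c'' * Q j c' = Q j c'.
  by move=> cc; have := q4 j c' c'' cc; rewrite mulrBl mul1r => /subr0_eq.
have Qd' j c' c'' : (c' <= c'')%N -> Q j c' * Q j c'' = Q j c'.
  move=> cc; have pp := lowp_nest piM pi_sum cc.
  apply: (@nc_lincomb _ _ _ (- (Q j c' * lowp pi c' - Q j c') * Q j c''
    - Q j c' * (lowp pi c' * lowp pi c'' - lowp pi c') * Q j c''
    + Q j c' * lowp pi c' * (lowp pi c'' * Q j c'' - lowp pi c'')
    + Q j c' * (lowp pi c' * lowp pi c'' - lowp pi c') + (Q j c' * lowp pi c' - Q j c'))).
    by rewrite pp q1 q2 !subrr; ncring.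
  by ncring.
have lowX c' t : lowp pi c' * X t = X t * lowp pi c'.
  by rewrite /lowp mulr_suml mulr_sumr; apply: eq_bigr => k _.
(* The image of [Q j c'] is invariant under the constant maps by [q5], and its kernel is that of
   [lowp pi c'], with which they commute. *)
have Qcomm j c' (t : S + 'I_n) : Q j c' * X (inr t) = X (inr t) * Q j c'.
  have := q5 j c' (inr t); have -> : Phi (j + j1)%N (inr t) = X (inr t) by case: t.
  move=> h5; apply: (@nc_lincomb _ _ _ (- ((1 - Q j c') * X (inr t) * Q j c')
    - (Q j c' * lowp pi c' - Q j c') * X (inr t) * (1 - Q j c')
    + Q j c' * (lowp pi c' * X (inr t) - X (inr t) * lowp pi c') * (1 - Q j c')
    - Q j c' * X (inr t) * (lowp pi c' * Q j c' - lowp pi c'))).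
    by rewrite h5 q2 q1 lowX !subrr; ncring.
  by ncring.
pose QE (k : 'I_n) j := Q j k.+1 - Q j k.
have lowpS (k : 'I_n) : lowp pi k.+1 - lowp pi k = pi k.
  rewrite /lowp (bigD1 k) //= [X in _ - X](eq_bigl (fun i : 'I_n => (i < k.+1)%N && (i != k))).
    by rewrite addrK.
  by move=> i; rewrite ltnS [(i <= k)%N]leq_eqVlt; case: eqP => [/val_inj -> |/eqP ik];
    rewrite ?eqxx ?ltnn ?andbF //= -val_eqE ik andbT.
have QElim k : cvA \oo%classic (QE k) (pi k).
  by rewrite -lowpS; apply: cvAB; exact: q6.
have QQ k j : QE k j * QE k j = QE k j.
  apply: (@nc_lincomb _ _ _ ((Q j k.+1 * Q j k.+1 - Q j k.+1) - (Q j k.+1 * Q j k - Q j k)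
    - (Q j k * Q j k.+1 - Q j k) + (Q j k * Q j k - Q j k))).
    by rewrite (Qd' j k k.+1) // (Qd j k k.+1) // (Qd j k k) // (Qd j k.+1 k.+1) // !subrr; ncring.
  by rewrite /QE; ncring.
have QQ0 (k l : 'I_n) j : k != l -> QE k j * QE l j = 0.
  have -> : QE k j * QE l j = Q j k.+1 * Q j l.+1 - Q j k.+1 * Q j l - (Q j k * Q j l.+1 - Q j k * Q j l).
    by rewrite /QE; ncring.
  have lt_le (a b : nat) : (a < b)%N -> [/\ (a.+1 <= b.+1)%N, (a <= b.+1)%N & (a <= b)%N].
    by move=> ab; rewrite ltnS (ltnW ab) (leqW (ltnW ab)).
  rewrite neq_ltn => /orP[kl|kl]; have [h1 h2 h3] := lt_le _ _ kl.
    by rewrite (Qd' j k.+1 l.+1) // (Qd' j k.+1 l) // (Qd' j k l.+1) // (Qd' j k l) // !subrr.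
  by rewrite (Qd j l.+1 k.+1) // (Qd j l k.+1) // (Qd j l.+1 k) // (Qd j l k) // subrr.
have Q1 j : Q j n = 1.
  have l1 : lowp pi n = 1 by rewrite /lowp -pi_sum; apply: eq_bigl => k; rewrite ltn_ord.
  by have := q1 j n; rewrite l1 mul1r.
have Q0 j : Q j 0 = 0.
  have l0 : lowp pi 0 = 0 by rewrite /lowp big1.
  by have := q2 j 0; rewrite l0 mulr0.
have QEsum j : \sum_k QE k j = 1.
  have := telescope_sumr (fun i => Q j i) (leq0n n).
  by rewrite big_mkord Q1 Q0 subr0.
(* On the [k]-th graded piece the intertwiners tend to the scalar [f k], which makes them injective
   there from some index on. *)
have inj k : exists j2, forall j, (j2 <= j)%N ->
    nrm (QE k j.+1 * F (j + j1)%N * QE k j - rscale (f k) 1 * QE k j) <= f k / 2.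
  have l2 : cvA \oo%classic (fun j => QE k j.+1 * F (j + j1)%N * QE k j - rscale (f k) 1 * QE k j) 0.
    rewrite (_ : 0 = pi k * blockD pi f * pi k - rscale (f k) 1 * pi k).
      apply: cvAB; last by apply: cvAMl; exact: QElim.
      apply: cvAM; last exact: QElim.
      apply: cvAM; last exact: shift.
      apply: cvA_near (shift _ _ 1%N (QElim k)); apply: nearW => j; by rewrite addn1.
    rewrite /blockD (pi_pick piM) rscaleE -mulrA piM eqxx subrr //.
  have [j2 _ j2P] := cvA_lt l2 (divr_gt0 (f0 k) (ltr0n R 2)).
  by exists j2 => j jj; have := j2P j jj; rewrite subr0 => /ltW.
have [j2f j2fP] := choice inj; pose j2 := \max_k j2f k.
have j2P k j : nrm (QE k (j + j2).+1 * F (j + j2 + j1)%N * QE k (j + j2)%N - rscale (f k) 1 * QE k (j + j2)%N) <= f k / 2.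
  by apply: j2fP; apply: leq_trans (leq_bigmax k) (leq_addl _ _).
have SMk k j t : QE k j.+1 * F (j + j1)%N * QE k j * (QE k j * Phi (j + j1)%N t * QE k j) =
    (QE k j.+1 * Phi (j + j1).+1 t * QE k j.+1) * (QE k j.+1 * F (j + j1)%N * QE k j).
  have e1 : QE k j.+1 * F (j + j1)%N * QE k j * (QE k j * Phi (j + j1)%N t * QE k j) =
      QE k j.+1 * (F (j + j1)%N * Phi (j + j1)%N t) * QE k j.
    have g0 : QE k j.+1 * F (j + j1)%N * QE k j * Phi (j + j1)%N t * QE k j =
        QE k j.+1 * (F (j + j1)%N * Phi (j + j1)%N t) * QE k j.
      by apply: graded_mul; rewrite ?Qd // ?q5 ?q3.
    by rewrite -g0 !mulrA -[QE k j.+1 * _ * _ * _]mulrA QQ.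
  have e2 : (QE k j.+1 * Phi (j + j1).+1 t * QE k j.+1) * (QE k j.+1 * F (j + j1)%N * QE k j) =
      QE k j.+1 * (Phi (j + j1).+1 t * F (j + j1)%N) * QE k j.
    have g0 : QE k j.+1 * Phi (j + j1).+1 t * QE k j.+1 * F (j + j1)%N * QE k j =
        QE k j.+1 * (Phi (j + j1).+1 t * F (j + j1)%N) * QE k j.
      by apply: graded_mul; rewrite ?Qd // ?q3 //; exact: (q5 j.+1).
    by rewrite -g0 !mulrA -[QE k j.+1 * _ * _ * QE k j.+1]mulrA QQ.
  by rewrite e1 e2 FPhi.
(* [Q j c'] and [lowp pi c'] have the same kernel, hence the same trace against any [b] that
   commutes with [lowp pi c']. *)
have rtrE (b : A) k j : (forall c', lowp pi c' * b = b * lowp pi c') -> rtr (b * QE k j) = rtr (b * pi k).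
  move=> lb; have e1 c' : rtr (b * Q j c') = rtr (b * lowp pi c').
    by rewrite -q2 mulrA rtrC mulrA lb -mulrA q1.
  by rewrite /QE mulrBr rtrB !e1 -rtrB -mulrBr lowpS.
have sl k : exists f' g' : A,
  [/\ forall t, f' * (QE k j2 * Phi (j2 + j1)%N t * QE k j2) = (pi k * X t * pi k) * f',
      pi k * f' = f', f' * QE k j2 = f' & QE k j2 * g' = g'] /\
  [/\ g' * pi k = g', f' * g' = pi k & g' * f' = QE k j2].
  apply: (@stable_limit_iso R d U UU T' (fun j => QE k (j + j2)%N)
    (fun j t => QE k (j + j2)%N * Phi (j + j2 + j1)%N t * QE k (j + j2)%N)
    (fun j => QE k (j + j2).+1 * F (j + j2 + j1)%N * QE k (j + j2)%N) (pi k)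
    (fun t => pi k * X t * pi k) (beta k)).
  - by move=> j; exact: QQ.
  - by apply: toU; exact: shift.
  - move=> t; apply: toU; have h1 : cvA \oo%classic (fun j => QE k (j + j2)%N) (pi k) by exact: shift.
    apply: cvAM => //; apply: cvAM => //.
    exact: (shift (fun j => Phi (j + j1)%N t) _ _ (shift _ _ _ (PhiX t))).
  - exact: pi_neq0.
  - by move=> j t; rewrite !mulrA QQ.
  - by move=> j t; rewrite -!mulrA QQ.
  - by move=> j; rewrite !mulrA QQ.
  - by move=> j t; exact: SMk.
  - move=> j v Qv Sv; apply: nrm_eq0; apply/le_anti; rewrite nrm_ge0 andbT.
    have : nrm (rscale (f k) v) <= f k / 2 * nrm v.
      have -> : rscale (f k) v = - ((QE k (j + j2).+1 * F (j + j2 + j1)%N * QE k (j + j2)%N - rscale (f k) 1 * QE k (j + j2)%N) * v).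
        by rewrite mulrBl Sv sub0r opprK -mulrA Qv -rscaleE.
      by rewrite nrmN; apply: le_trans (nrmM _ _) _; rewrite ler_wpM2r ?nrm_ge0.
    rewrite nrm_rscale gtr0_norm // mulrAC => h1.
    by rewrite -(pmulr_rle0 _ (f0 k)); move: h1; lra.
  - move=> j; have h1 : F (j + j2 + j1)%N * beta k = beta k * F (j + j2 + j1)%N.
      by apply: Fcomm => t; exact: h_beta.
    have h2 i : QE k i * beta k = beta k * QE k i.
      by rewrite /QE mulrBl mulrBr !(Qcomm _ _ (inr k)).
    by rewrite -mulrA h2 !mulrA -[X in X * _ = _]mulrA h1 !mulrA h2.
  - by move=> j; rewrite /QE mulrBl mulrBr !(Qcomm _ _ (inr k)).
  - by have := rtrE 1 k (0 + j2)%N; rewrite !mul1r; apply=> c'; rewrite mul1r mulr1.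
  - by apply: rtrE => c'; exact: (lowX c' (inr (inr k))).
  - exact: beta_tr.
  - move=> s ss ps Xs s_neq0 sp.
    have Xs' t : X t * s = s * X t * s.
      apply: (@nc_lincomb _ _ _ ((pi k * X t * pi k * s - s * (pi k * X t * pi k) * s)
        - (pi k * X t * (pi k * s - s) + (pi k * X t - X t * pi k) * s + X t * (pi k * s - s))
        + s * (pi k * X t * (pi k * s - s) + (pi k * X t - X t * pi k) * s + X t * (pi k * s - s)))).
        by rewrite Xs ps piX !subrr; ncring.
      by ncring.
    by apply: stab => //; [move=> a; exact: (Xs' (inl a)) | move=> e; exact: (Xs' (inr (inl e)))].
have [f1 f1P] := choice sl; have [g1 g1P] := choice f1P.
(* [W] assembles the isomorphisms from the graded pieces at the index [j2 + j1] to the summands of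
   [x], and [W'] their inverses. *)
pose W : A := \sum_k f1 k; pose W' : A := \sum_k g1 k.
have fQ k : f1 k * QE k j2 = f1 k by case: (g1P k) => [[]].
have Qg k : QE k j2 * g1 k = g1 k by case: (g1P k) => [[]].
have pf k : pi k * f1 k = f1 k by case: (g1P k) => [[]].
have gp k : g1 k * pi k = g1 k by case: (g1P k) => [_ []].
have fg k : f1 k * g1 k = pi k by case: (g1P k) => [_ []].
have gf k : g1 k * f1 k = QE k j2 by case: (g1P k) => [_ []].
have fX k t : f1 k * (QE k j2 * Phi (j2 + j1)%N t * QE k j2) = pi k * X t * pi k * f1 k by case: (g1P k) => [[]].
have pW k : pi k * W = f1 k.
  rewrite /W mulr_sumr (bigD1 k) //= pf big1 ?addr0 // => l lk.
  by rewrite -pf mulrA piM eq_sym (negbTE lk) mul0r.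
have Wp k : W' * pi k = g1 k.
  rewrite /W' mulr_suml (bigD1 k) //= gp big1 ?addr0 // => l lk.
  by rewrite -gp -mulrA piM (negbTE lk) mulr0.
have WW' : W * W' = 1.
  rewrite -pi_sum /W' mulr_sumr; apply: eq_bigr => l _.
  rewrite /W mulr_suml (bigD1 l) //= fg big1 ?addr0 // => k kl.
  by rewrite -fQ -Qg mulrA -[f1 k * _ * _]mulrA QQ0 // mulr0 mul0r.
have W'W : W' * W = 1.
  rewrite -(QEsum j2) /W mulr_sumr; apply: eq_bigr => l _.
  rewrite /W' mulr_suml (bigD1 l) //= gf big1 ?addr0 // => k kl.
  by rewrite -gp -pf mulrA -[g1 k * _ * _]mulrA piM (negbTE kl) mulr0 mul0r.
(* [Ga i] is the composite of the first [i] intertwiners. Being invertible, it carries back to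
   [phi 0] what has been shown at the index [i0]. *)
pose Ga := fix Ga i : A := if i is i'.+1 then F i' * Ga i' else 1.
have Gau i : Ga i \in unitmx.
  elim: i => [|i IH] /=; first exact: unitmx1.
  by rewrite -[F i * Ga i]/(F i *m Ga i) unitmx_mul Fu.
have GaPhi i t : Ga i * Phi 0 t = Phi i t * Ga i.
  elim: i => [|i IH] /=; first by rewrite mul1r mulr1.
  by rewrite -mulrA IH !mulrA FPhi.
pose i0 := (j2 + j1)%N; pose Gi : A := invmx (Ga i0).
have GG : Ga i0 * Gi = 1 by exact: mulmxV.
have GG' : Gi * Ga i0 = 1 by exact: mulVmx.
exists (W * Ga i0), (Gi * W'); split.
- by rewrite mulrA -[W * _ * _]mulrA GG mulr1.
- by rewrite mulrA -[Gi * _ * _]mulrA W'W mulr1.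
- move=> s; have GE := GaPhi i0 (inr (inl s)); rewrite /= in GE.
  rewrite -mulrA GE !mulrA; congr (_ * _); rewrite /W mulr_suml mulr_sumr; apply: eq_bigr => k _.
  have h1 := fX k (inr (inl s)); rewrite /= in h1.
  have QEE : QE k j2 * E s = E s * QE k j2 by rewrite /QE mulrBl mulrBr !(Qcomm _ _ (inl s)).
  move: h1; rewrite QEE -[E s * _ * _]mulrA QQ -QEE mulrA fQ => ->.
  by rewrite pi_E -[E s * _ * _]mulrA piM eqxx -mulrA pf.
move=> a k l lk.
have G0 := GaPhi i0 (inl a); rewrite /= mul0r oppr0 in G0.
have -> : pi k * (W * Ga i0 * phi 0 a * (Gi * W')) * pi l = f1 k * Phi i0 (inl a) * g1 l.
  apply: (@nc_lincomb _ _ _ (pi k * W * (Ga i0 * phi 0 a - Phi i0 (inl a) * Ga i0) * Gi * W' * pi l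
    + pi k * W * Phi i0 (inl a) * (Ga i0 * Gi - 1) * W' * pi l
    + (pi k * W - f1 k) * Phi i0 (inl a) * (W' * pi l) + f1 k * Phi i0 (inl a) * (W' * pi l - g1 l))).
    by rewrite G0 GG pW Wp !subrr; ncring.
  by ncring.
have -> : f1 k * Phi i0 (inl a) * g1 l = f1 k * (QE k j2 * Phi i0 (inl a) * QE l j2) * g1 l.
  by rewrite !mulrA fQ -!mulrA Qg.
case: eqP => [<-|/eqP kl].
  by rewrite fX -mulrA fg -!mulrA piM eqxx !mulrA pi_x -mulrA piM eqxx.
have {lk kl} lk : (l < k)%N by rewrite ltn_neqAle lk andbT eq_sym.
suff -> : QE k j2 * Phi i0 (inl a) * QE l j2 = 0 by rewrite mulr0 mul0r.
have h1 := q5 j2 l.+1 (inl a).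
have a1 : Q j2 l.+1 * QE l j2 = QE l j2 by rewrite /QE mulrBr (Qd j2 l.+1 l.+1) // (Qd j2 l l.+1).
have a2 : QE k j2 * Q j2 l.+1 = 0.
  by rewrite /QE mulrBl (Qd j2 l.+1 k.+1) ?leqW // (Qd j2 l.+1 k) // subrr.
apply: (@nc_lincomb _ _ _ (QE k j2 * ((1 - Q j2 l.+1) * Phi (j2 + j1)%N (inl a) * Q j2 l.+1) * QE l j2
   - QE k j2 * Phi (j2 + j1)%N (inl a) * (Q j2 l.+1 * QE l j2 - QE l j2) * 1
   + (QE k j2 * Q j2 l.+1 - 0) * Phi (j2 + j1)%N (inl a) * Q j2 l.+1 * QE l j2)).
  by rewrite h1 a1 a2 !subrr; ncring.
by rewrite /i0; ncring.
Qed.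

End Forward.

(** * The linearized gauge equation *)

Section GaugeEquation.
Variables (R : realType) (d : nat) (T I : finType).
Notation A := 'M[R[i]]_d.
Variables (al : A) (x : T -> A) (e : I -> A) (hdT tlT : T -> I).
Hypothesis al_adj : adj al = al.
Hypothesis e_adj : forall i, adj (e i) = e i.
Hypothesis ex : forall i a, e i * x a = if hdT a == i then x a else 0.
Hypothesis xe : forall i a, x a * e i = if tlT a == i then x a else 0.

(** In the application, [graded] matrices are those that preserve every [V_i], the Lie algebra of
    the gauge group, and [homog a] ones are the maps from the tail space to the head space of [a],
    extended by 0. *)
Definition graded (m : A) := forall i, e i * m = m * e i.
Definition homog (a : T) (m : A) := forall i,
  (e i * m = if hdT a == i then m else 0) /\ (m * e i = if tlT a == i then m else 0).

Hypothesis al_comm : forall m, graded m -> al * m = m * al.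
Let H := moment al x.
Hypothesis al_gr : graded al.

Lemma gradedD m m' : graded m -> graded m' -> graded (m + m').
Proof. by move=> h h' i; rewrite mulrDr mulrDl h h'. Qed.
Lemma gradedN m : graded m -> graded (- m).
Proof. by move=> h i; rewrite mulrN mulNr h. Qed.
Lemma gradedB m m' : graded m -> graded m' -> graded (m - m').
Proof. by move=> h h'; apply: gradedD => //; exact: gradedN. Qed.
Lemma gradedM m m' : graded m -> graded m' -> graded (m * m').
Proof. by move=> h h' i; rewrite mulrA h -mulrA h' mulrA. Qed.
Lemma graded0 : graded 0. Proof. by move=> i; rewrite mulr0 mul0r. Qed.
Lemma graded1 : graded 1. Proof. by move=> i; rewrite mulr1 mul1r. Qed.
Lemma graded_rscale r m : graded m -> graded (rscale r m).
Proof. by move=> h i; rewrite rscaleE mulrA -rscale_comm -!mulrA h. Qed.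
Lemma graded_adj m : graded m -> graded (adj m).
Proof. by move=> h i; rewrite -[LHS]adjK adjM adjK e_adj -h adjM e_adj. Qed.
Lemma graded_sum (J : Type) (s : seq J) (P : pred J) (F : J -> A) :
  (forall j, P j -> graded (F j)) -> graded (\sum_(j <- s | P j) F j).
Proof. by move=> h; elim/big_ind: _ => //; [exact: graded0 | exact: gradedD]. Qed.

Lemma homogD a m m' : homog a m -> homog a m' -> homog a (m + m').
Proof.
move=> h h' i; have [h1 h2] := h i; have [h1' h2'] := h' i.
by rewrite mulrDr mulrDl h1 h2 h1' h2'; do 2!case: ifP => _; rewrite ?addr0.
Qed.
Lemma homogN a m : homog a m -> homog a (- m).
Proof.
move=> h i; have [h1 h2] := h i; rewrite mulrN mulNr h1 h2.
by do 2!case: ifP => _; rewrite ?oppr0.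
Qed.
Lemma homogB a m m' : homog a m -> homog a m' -> homog a (m - m').
Proof. by move=> h h'; apply: homogD => //; exact: homogN. Qed.
Lemma homog0 a : homog a 0.
Proof. by move=> i; rewrite mulr0 mul0r; do 2!case: ifP. Qed.
Lemma homogMl a g m : graded g -> homog a m -> homog a (g * m).
Proof.
move=> hg h i; have [h1 h2] := h i; rewrite mulrA hg -!mulrA h1 h2.
by do 2!case: ifP => _; rewrite ?mulr0.
Qed.
Lemma homogMr a g m : graded g -> homog a m -> homog a (m * g).
Proof.
move=> hg h i; have [h1 h2] := h i; rewrite -[m * g * _]mulrA -hg !mulrA h1 h2.
by do 2!case: ifP => _; rewrite ?mul0r.
Qed.
Lemma homog_sum a (J : Type) (s : seq J) (P : pred J) (F : J -> A) :
  (forall j, P j -> homog a (F j)) -> homog a (\sum_(j <- s | P j) F j).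
Proof. by move=> h; elim/big_ind: _ => //; [exact: homog0 | exact: homogD]. Qed.
Lemma homog_x a : homog a (x a).
Proof. by move=> i; rewrite ex xe. Qed.
Lemma homog_adjr a m m' : homog a m -> homog a m' -> graded (m * adj m').
Proof.
move=> h h' i; have [h1 _] := h i; have [h1' _] := h' i.
rewrite mulrA h1 -[RHS]mulrA -{1}(e_adj i) -adjM h1'.
by case: ifP => _; rewrite ?mul0r ?adj0 ?mulr0.
Qed.
Lemma homog_adjl a m m' : homog a m -> homog a m' -> graded (adj m * m').
Proof.
move=> h h' i; have [_ h1] := h i; have [_ h1'] := h' i.
rewrite -mulrA h1' mulrA -{1}(e_adj i) -adjM h1.
by case: ifP => _; rewrite ?mul0r ?adj0 ?mulr0 ?mul0r.
Qed.

Lemma graded_H : graded H.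
Proof.
apply: gradedD => //; rewrite -rscaleE; apply: graded_rscale; apply: graded_sum => a _.
by apply: gradedB; [apply: homog_adjr | apply: homog_adjl]; exact: homog_x.
Qed.

Lemma H_adj : adj H = H.
Proof.
rewrite /H /moment adjD al_adj -rscaleE adj_rscale adj_sum; congr (_ + rscale _ _).
by apply: eq_bigr => a _; rewrite adjB !adjM adjK.
Qed.

Definition brak (m m' : A) := m * m' - m' * m.
(** Agrees with [gaugeB] on hermitian matrices, but is complex linear on all of them, so that linear
    algebra over the complex numbers applies. *)
Definition lap (m : A) : A :=
  rscale (1 / 2) 1 * \sum_a (brak (adj (x a)) (brak (x a) m) + brak (x a) (brak (adj (x a)) m)).
(** The derivative at [x] of [moment] in the direction [brak m (x a)] of the infinitesimal action;
    the adjoint makes it only real linear. *)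
Definition gaugeB (m : A) : A :=
  rscale (1 / 2) 1 * \sum_a (brak (brak m (x a)) (adj (x a)) + brak (x a) (adj (brak m (x a)))).

Lemma rtr_brak m w z : rtr (adj m * brak (adj z) w) = rtr (adj (brak z m) * w).
Proof.
rewrite /brak adjB !adjM mulrBr mulrBl !rtrB !mulrA; congr (_ - _).
by rewrite rtrC mulrA.
Qed.

(** By [rtr_brak] this trace is half the sum of the squared Hilbert-Schmidt norms of the brackets of
    [m] with the [x a] and the [adj (x a)]. *)
Lemma lap_ge0 m : 0 <= rtr (adj m * lap m).
Proof.
rewrite /lap mulrA -rscale_comm -mulrA -rscaleE rtr_rscale mulr_ge0 ?divr_ge0 //.
rewrite mulr_sumr rtr_sum; apply: sumr_ge0 => a _.
rewrite mulrDr rtrD rtr_brak -[x a in X in _ + rtr X](adjK (x a)) rtr_brak.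
by rewrite adjK addr_ge0 ?sqn_ge0.
Qed.

Lemma lap_linear : linear lap.
Proof.
have main k u v : lap (k%:M * u + v) = k%:M * lap u + lap v.
  have cen w : k%:M * w = w * k%:M by have := scalar_mxC k w.
  have brL y w z : brak y (k%:M * w + z) = k%:M * brak y w + brak y z.
    apply: (@nc_lincomb _ _ _ (- (k%:M * y - y * k%:M) * w)); first by rewrite cen subrr; ncring.
    by rewrite /brak; ncring.
  pose X m := \sum_a (brak (adj (x a)) (brak (x a) m) + brak (x a) (brak (adj (x a)) m)).
  have XL : X (k%:M * u + v) = k%:M * X u + X v.
    rewrite /X mulr_sumr -big_split /=; apply: eq_bigr => a _.
    by rewrite !brL; ncring.
  have lapE m : lap m = rscale (1 / 2) 1 * X m by [].
  rewrite !lapE XL; clearbody X.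
  apply: (@nc_lincomb _ _ _ ((rscale (1 / 2) 1 * k%:M - k%:M * rscale (1 / 2) 1) * X u)).
    by rewrite rscale_comm subrr mul0r.
  by ncring.
by move=> k u v; have := main k u v; rewrite -[k%:M * u]/(k%:M *m u) -[k%:M * lap u]/(k%:M *m lap u) !mul_scalar_mx.
Qed.

Lemma lapB u v : lap (u - v) = lap u - lap v.
Proof.
rewrite /lap -mulrBr -sumrB; apply: (congr1 (GRing.mul _)); apply: eq_bigr => a _.
by rewrite /brak; ncring.
Qed.

Lemma shifted_inj (c : R) m : 0 < c -> rscale c 1 * m + lap m = 0 -> m = 0.
Proof.
move=> c0 m0; apply: sqn_eq0; apply/le_anti; rewrite sqn_ge0 andbT.
have : rtr (adj m * (rscale c 1 * m + lap m)) = 0 by rewrite m0 mulr0 rtr0.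
rewrite mulrDr rtrD mulrA -rscale_comm -mulrA -rscaleE rtr_rscale -/(sqn m) => h.
by rewrite -(pmulr_rle0 _ c0) -(addrK (rtr (adj m * lap m)) (c * _)) h sub0r oppr_le0 lap_ge0.
Qed.

Lemma shifted_surj (c : R) r : 0 < c -> exists m, rscale c 1 * m + lap m = r.
Proof.
move=> c0; pose f (m : A) : A := (c%:C)%C *: m + lap m.
have f_lin : linear f.
  by move=> k u v; rewrite /f lap_linear !scalerDr addrACA !scalerA [(c%:C)%C * k]mulrC.
pose fL := GRing.isLinear.Build _ _ _ _ f f_lin.
pose F : {linear A -> A} := HB.pack f fL.
have kerF : lker (linfun F) == 0%VS.
  apply/lker0P => u v; rewrite !lfunE /= => uv; apply: subr0_eq.
  apply: (shifted_inj c0); rewrite -rscaleE -/(f (u - v)).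
  by rewrite /f lapB scalerBr addrACA -opprD -/(f u) -/(f v) uv subrr.
exists ((linfun F)^-1%VF r); rewrite -rscaleE -/(f _).
have := congr1 (fun g : 'End(A) => g r) (lker0_compfV kerF).
by rewrite comp_lfunE id_lfunE lfunE.
Qed.

Lemma lap_adj m : adj (lap m) = lap (adj m).
Proof.
have half_adj S : adj (rscale (1 / 2) 1 * S) = rscale (1 / 2) 1 * adj S.
  by rewrite -rscaleE adj_rscale rscaleE.
rewrite /lap half_adj adj_sum; apply: (congr1 (GRing.mul _)); apply: eq_bigr => a _.
by rewrite /brak !(adjD, adjN, adjM, adjK); ncring.
Qed.

(** What is left of [lap] in commutators with [e i]: the terms [adj (x a) * m * x a] and
    [x a * m * adj (x a)] commute with [e i] for every [m] and drop out, and the one-sided products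
    that survive form a positive operator. *)
Definition anticomm (k : A) : A :=
  \sum_a ((adj (x a) * x a * k + k * x a * adj (x a)) + (x a * adj (x a) * k + k * adj (x a) * x a)).

Lemma anticomm_inj (c : R) k : 0 < c -> rscale c 1 * k + rscale (1 / 2) 1 * anticomm k = 0 -> k = 0.
Proof.
move=> c0 kX; apply: sqn_eq0; apply/le_anti; rewrite sqn_ge0 andbT.
have X0 : 0 <= rtr (adj k * anticomm k).
  rewrite /anticomm mulr_sumr rtr_sum; apply: sumr_ge0 => a _.
  have e1 : adj k * (adj (x a) * x a * k) = adj (x a * k) * (x a * k) by rewrite adjM !mulrA.
  have e2 : rtr (adj k * (k * x a * adj (x a))) = rtr (adj (k * x a) * (k * x a)).
    by rewrite adjM mulrA rtrC !mulrA.
  have e3 : adj k * (x a * adj (x a) * k) = adj (adj (x a) * k) * (adj (x a) * k) by rewrite adjM adjK !mulrA.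
  have e4 : rtr (adj k * (k * adj (x a) * x a)) = rtr (adj (k * adj (x a)) * (k * adj (x a))).
    by rewrite adjM adjK mulrA rtrC !mulrA.
  rewrite !mulrDr !rtrD e1 e2 e3 e4.
  by apply: addr_ge0; apply: addr_ge0; exact: sqn_ge0.
have : rtr (adj k * (rscale c 1 * k + rscale (1 / 2) 1 * anticomm k)) = 0 by rewrite kX mulr0 rtr0.
rewrite mulrDr rtrD ![adj k * (rscale _ _ * _)]mulrA -!rscale_comm -!mulrA -!rscaleE !rtr_rscale -/(sqn k) => h.
rewrite -(pmulr_rle0 _ c0); move: h X0; move: (rtr _) (c * _) => u w; lra.
Qed.

Lemma lap_comm i m : e i * lap m - lap m * e i = rscale (1 / 2) 1 * anticomm (e i * m - m * e i).
Proof.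
have e1 : e i * lap m = rscale (1 / 2) 1 * (e i * \sum_a (brak (adj (x a)) (brak (x a) m) + brak (x a) (brak (adj (x a)) m))).
  by rewrite /lap mulrA -rscale_comm -mulrA.
rewrite e1 /lap -mulrA -mulrBr; apply: (congr1 (GRing.mul _)).
rewrite mulr_sumr mulr_suml -sumrB; apply: eq_bigr => a _.
have g1 := homog_adjl (homog_x a) (homog_x a) i; have g2 := homog_adjr (homog_x a) (homog_x a) i.
have [h1 h2] := homog_x a i.
have h3 : adj (x a) * e i = if hdT a == i then adj (x a) else 0.
  by rewrite -{1}(e_adj i) -adjM h1; case: ifP; rewrite ?adj0.
have h4 : e i * adj (x a) = if tlT a == i then adj (x a) else 0.
  by rewrite -{1}(e_adj i) -adjM h2; case: ifP; rewrite ?adj0.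
have g3 w : e i * (adj (x a) * w * x a) - adj (x a) * w * x a * e i = 0.
  by rewrite -[_ * x a * e i]mulrA h2 !mulrA h4; case: ifP => _; rewrite ?mul0r ?mulr0 subrr.
have g4 w : e i * (x a * w * adj (x a)) - x a * w * adj (x a) * e i = 0.
  by rewrite -[_ * adj (x a) * e i]mulrA h3 !mulrA h1; case: ifP => _; rewrite ?mul0r ?mulr0 subrr.
apply: (@nc_lincomb _ _ _ (
     (e i * (adj (x a) * x a) - adj (x a) * x a * e i) * m
     + m * (e i * (x a * adj (x a)) - x a * adj (x a) * e i)
     + (e i * (x a * adj (x a)) - x a * adj (x a) * e i) * m
     + m * (e i * (adj (x a) * x a) - adj (x a) * x a * e i)
     - (e i * (adj (x a) * m * x a) - adj (x a) * m * x a * e i) - (e i * (adj (x a) * m * x a) - adj (x a) * m * x a * e i)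
     - (e i * (x a * m * adj (x a)) - x a * m * adj (x a) * e i) - (e i * (x a * m * adj (x a)) - x a * m * adj (x a) * e i))).
  by rewrite g1 g2 g3 g4 !subrr; ncring.
by rewrite /brak; ncring.
Qed.

(** The commutators of [m] with the [e i] solve the homogeneous equation of [anticomm_inj], since
    those of the right-hand side vanish. *)
Lemma shifted_graded (c : R) m : 0 < c -> graded (rscale c 1 * m + lap m) -> graded m.
Proof.
move=> c0 gm i; apply: subr0_eq; apply: (anticomm_inj c0); rewrite -lap_comm.
apply: (@nc_lincomb _ _ _ ((e i * (rscale c 1 * m + lap m) - (rscale c 1 * m + lap m) * e i)
   + (rscale c 1 * e i - e i * rscale c 1) * m)).
  by rewrite gm [rscale c 1 * e i]rscale_comm !subrr; ncring.
by ncring.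
Qed.

(** Positivity of [lap] gives [c * sqn m <= nrm m * nrm r], and [nrm m ^+ 2] is at most
    [2 * (d * d)^2 * sqn m]. The bound decreases in [c], hence is uniform over the orders of the
    power series. *)
Lemma shifted_bound (c : R) m r : 0 < c -> rscale c 1 * m + lap m = r ->
  nrm m <= (2 * (d * d)%:R ^+ 2) / c * nrm r.
Proof.
move=> c0 mr; set N : R := (d * d)%:R; have N0 : 0 <= N by [].
have h1 : c * sqn m <= nrm m * nrm r.
  have : rtr (adj m * r) = c * sqn m + rtr (adj m * lap m).
    by rewrite -mr mulrDr rtrD mulrA -rscale_comm -mulrA -rscaleE rtr_rscale.
  have := lap_ge0 m; have := le_trans (ler_norm _) (le_trans (rtr_le_nrm (adj m * r)) (nrmM _ _)).
  by rewrite nrm_adj; move: (rtr (adj m * lap m)) (rtr (adj m * r)) (nrm m * nrm r) (c * sqn m) => a1 a2 a3 a4; lra.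
have h2 : nrm m ^+ 2 <= N ^+ 2 * (2 * sqn m).
  have s0 : 0 <= 2 * sqn m by rewrite mulr_ge0 ?sqn_ge0.
  rewrite -[X in _ <= _ * X]sqr_sqrtr // -exprMn; apply: lerXn2r; rewrite ?nnegrE ?nrm_ge0 ?mulr_ge0 ?sqrtr_ge0 //.
  exact: nrm_le_sqn.
have [m0|m0] := eqVneq (nrm m) 0.
  by rewrite m0 !mulr_ge0 ?invr_ge0 ?nrm_ge0 ?exprn_ge0 // ltW.
have mp : 0 < nrm m by rewrite lt_neqAle eq_sym m0 nrm_ge0.
rewrite mulrAC ler_pdivlMr // -(ler_pM2r mp).
have := ler_wpM2l (ltW c0) h2; have := ler_wpM2l (mulr_ge0 (ler0n R 2) (exprn_ge0 2 N0)) h1.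
move: (sqn m) (nrm m) (nrm r) (N ^+ 2) => s1 m1 r1 n1 a1 a2.
by move: a2 a1; rewrite expr2; lra.
Qed.

Lemma gaugeB_adj m : adj m = m -> gaugeB m = lap m.
Proof.
move=> mm; rewrite /gaugeB /lap; apply: (congr1 (GRing.mul _)); apply: eq_bigr => a _.
by rewrite /brak !(adjD, adjN, adjM, mm); ncring.
Qed.

Lemma rscale_half (m : A) : rscale (1 / 2) 1 * (m + m) = m.
Proof.
rewrite mulrDr -mulrDl -rscaleD (_ : 1 / 2 + 1 / 2 = 1 :> R) ?rscale1 ?mul1r //.
by field.
Qed.

(** A skew graded [m] is an infinitesimal unitary change of basis, under which [moment] is
    equivariant; the part [al] commutes with such [m]. *)
Lemma gaugeB_skew m : adj m = - m -> graded m -> gaugeB m = - brak H m.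
Proof.
move=> mm gm; rewrite /gaugeB /H /moment /brak mulrDl mulrDr al_comm //.
rewrite [X in _ = - X](_ : _ = rscale (1 / 2) 1 * ((\sum_a (x a * adj (x a) - adj (x a) * x a)) * m - m * \sum_a (x a * adj (x a) - adj (x a) * x a))).
  rewrite -mulrN; congr (_ * _); rewrite mulr_suml mulr_sumr -sumrB -sumrN; apply: eq_bigr => a _.
  by rewrite !(adjD, adjN, adjM, mm); ncring.
apply: (@nc_lincomb _ _ _ ((rscale (1 / 2) 1 * m - m * rscale (1 / 2) 1) * \sum_a (x a * adj (x a) - adj (x a) * x a))).
  by rewrite rscale_comm subrr mul0r.
by ncring.
Qed.

(* Both parts of r are treated separately: on hermitian m the equation involves the
   positive operator [lap], and on skew m the term [gaugeB m] cancels [brak H m]. *)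
Lemma gauge_solve (c0 : R) : 0 < c0 -> exists2 K : R, 0 <= K & forall (c : R) r, c0 <= c -> graded r ->
  exists m, [/\ graded m, rscale c 1 * m + brak H m + gaugeB m = r & nrm m <= K * nrm r].
Proof.
move=> c00; pose K1 : R := (2 * (d * d)%:R ^+ 2) / c0.
have K10 : 0 <= K1 by apply: divr_ge0; [rewrite mulr_ge0 ?exprn_ge0 | exact: ltW].
exists (K1 + (1 + 2 * (nrm H * K1)) / c0).
  apply: addr_ge0 => //; apply: divr_ge0; last exact: ltW.
  by apply: addr_ge0 => //; do 2!apply: mulr_ge0 => //; exact: nrm_ge0.
move=> c r cc gr; have cp : 0 < c by exact: lt_le_trans cc.
have half0 : (0 : R) <= 1 / 2 by rewrite divr_ge0.
pose rs := rscale (1 / 2) 1 * (r + adj r); pose rk := rscale (1 / 2) 1 * (r - adj r).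
have hn w : nrm w <= 2 * nrm r -> nrm (rscale (1 / 2) 1 * w : A) <= nrm r.
  by move=> h; rewrite -rscaleE nrm_rscale ger0_norm //; lra.
have rs_le : nrm rs <= nrm r by apply: hn; apply: le_trans (nrmD _ _) _; rewrite nrm_adj; lra.
have rk_le : nrm rk <= nrm r by apply: hn; apply: le_trans (nrmB _ _) _; rewrite nrm_adj; lra.
have rsk : rs + rk = r.
  rewrite /rs /rk -mulrDr addrACA subrr addr0; exact: rscale_half.
have grs : graded rs.
  by rewrite /rs -rscaleE; apply: graded_rscale; apply: gradedD => //; exact: graded_adj.
have grk : graded rk.
  by rewrite /rk -rscaleE; apply: graded_rscale; apply: gradedB => //; exact: graded_adj.
have rs_adj : adj rs = rs by rewrite /rs -!rscaleE adj_rscale adjD adjK addrC.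
have rk_adj : adj rk = - rk by rewrite /rk -!rscaleE adj_rscale adjB adjK -rscaleE -[RHS]mulrN opprB -rscaleE || rewrite /rk -!rscaleE adj_rscale adjB adjK /rscale -scalerN opprB.
have [a aE] := shifted_surj rs cp.
have ga : graded a by apply: (shifted_graded cp); rewrite aE.
have a_adj : adj a = a.
  apply: subr0_eq; apply: (shifted_inj cp).
  rewrite mulrBr lapB.
  rewrite addrACA -opprD aE -lap_adj.
  by rewrite -[rscale c 1 * adj a]rscaleE -adj_rscale -adjD rscaleE aE rs_adj subrr.
have a_le : nrm a <= K1 * nrm r.
  apply: le_trans (shifted_bound cp aE) _; apply: ler_pM; rewrite ?nrm_ge0 //.
    by rewrite divr_ge0 ?mulr_ge0 ?exprn_ge0 // ltW.
  by rewrite /K1 ler_wpM2l ?mulr_ge0 ?exprn_ge0 // lef_pV2 ?posrE.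
(* The bracket of [H] with the hermitian part [a] is skew and moves to the right-hand side; for the
   skew part the operator reduces to multiplication by [c]. *)
pose b := rscale c^-1 1 * (rk - brak H a).
have cb : rscale c 1 * b = rk - brak H a.
  by rewrite /b mulrA -rscaleM mulfV ?gt_eqF // rscale1 mul1r.
have gHa : graded (brak H a) by apply: gradedB; apply: gradedM => //; exact: graded_H.
have gb : graded b by rewrite /b -rscaleE; apply: graded_rscale; exact: gradedB.
have b_adj : adj b = - b.
  rewrite /b -rscaleE adj_rscale adjB rk_adj /brak adjB !adjM H_adj a_adj.
  have -> : - rk - (a * H - H * a) = - (rk - (H * a - a * H)) by ncring.
  by rewrite /rscale scalerN.
exists (a + b); split; first exact: gradedD.
- have gBD : gaugeB (a + b) = gaugeB a + gaugeB b.
    rewrite /gaugeB -mulrDr -big_split /=; congr (_ * _); apply: eq_bigr => t _.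
    by rewrite /brak !(adjD, adjN, adjM); ncring.
  rewrite gBD gaugeB_adj // gaugeB_skew // -[RHS]rsk -aE -[rk](subrK (brak H a)) -cb.
  by rewrite /brak; ncring.
apply: le_trans (nrmD _ _) _; rewrite mulrDl lerD //.
rewrite /b -rscaleE nrm_rscale ger0_norm ?invr_ge0 ?(ltW cp) // [leRHS]mulrAC [leRHS]mulrC.
apply: ler_pM; rewrite ?invr_ge0 ?(ltW cp) ?nrm_ge0 //; first by rewrite lef_pV2 ?posrE.
apply: le_trans (nrmB _ _) _; rewrite mulrDl mul1r lerD //.
apply: le_trans (nrmB _ _) _.
have h1 : nrm H * nrm a <= nrm H * (K1 * nrm r) by rewrite ler_wpM2l ?nrm_ge0.
have := nrmM H a; have := nrmM a H; rewrite [nrm a * _]mulrC; move: h1.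
move: (nrm (H * a)) (nrm (a * H)) (nrm H * nrm a) => u1 u2 u3.
rewrite (_ : 2 * (nrm H * K1) * nrm r = 2 * (nrm H * (K1 * nrm r))); last by ring.
by move: (nrm H * (K1 * nrm r)) => u4; lra.
Qed.

End GaugeEquation.

(** * A formal flow line *)

(** [t m] tabulates the values below [m], with [b0] as default elsewhere; by [loc] a step reads only
    this part of the table. *)
Lemma strong_rec (B : Type) (b0 : B) (step : nat -> (nat -> B) -> B) :
  (forall m u w, (forall i, (i < m)%N -> u i = w i) -> step m u = step m w) ->
  exists u, forall m, u m = step m u.
Proof.
move=> loc; pose t := fix t m : nat -> B :=
  if m is m'.+1 then fun i => if i == m' then step m' (t m') else t m' i else fun=> b0.
have tS m i : (i < m)%N -> t m i = t i.+1 i.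
  elim: m => // m IH; rewrite ltnS leq_eqVlt => /orP[/eqP -> //|im].
  by rewrite [t m.+1 i]/= (ltn_eqF im) IH.
exists (fun i => t i.+1 i) => m; rewrite [LHS]/= eqxx; apply: loc => i im.
exact: tS.
Qed.

(** * Majorants for Cauchy products *)

Section PartialConvolution.
Variable R : realFieldType.
Implicit Types a b : nat -> R.

(** Both [i] and [m - i] lie strictly between 0 and [N], so that the right-hand side stops one index
    earlier than the left. This gain lets the majorant induction on [N] close. *)
Lemma mid_conv_le a b N : (forall i, 0 <= a i) -> (forall i, 0 <= b i) ->
  \sum_(1 <= m < N.+1) \sum_(1 <= i < m) a i * b (m - i)%N <=
  (\sum_(1 <= i < N) a i) * (\sum_(1 <= i < N) b i).
Proof.
move=> a0 b0.
have -> : \sum_(1 <= m < N.+1) \sum_(1 <= i < m) a i * b (m - i)%N =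
          \sum_(1 <= m < N.+1) \sum_(1 <= i < N | (i < m)%N) a i * b (m - i)%N.
  rewrite [LHS]big_nat_cond [RHS]big_nat_cond; apply: eq_bigr => m; rewrite andbT ltnS => /andP[_ mN].
  by rewrite (big_nat_widen _ _ N) //.
rewrite (exchange_big_dep_nat xpredT) //= mulr_suml; apply: ler_sum_nat => i /andP[i1 _].
rewrite -mulr_sumr; apply: ler_wpM2l => //.
have -> : \sum_(1 <= m < N.+1 | (i < m)%N) b (m - i)%N = \sum_(0 <= m < N - i) b m.+1.
  rewrite (_ : \sum_(1 <= m < N.+1 | (i < m)%N) b (m - i)%N = \sum_(i.+1 <= m < N.+1) b (m - i)%N).
    rewrite -{1}[i.+1]add0n big_addn subSS; apply: eq_bigr => m _.
    by rewrite addnS -addSn addnK.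
  rewrite [RHS](big_nat_widenl _ 1) //.
rewrite [leRHS]big_add1.
have Ni : (N - i <= N.-1)%N by rewrite -subn1 leq_sub2l.
by rewrite [leRHS](big_cat_nat (n := (N - i)%N)) //= lerDl sumr_ge0.
Qed.

End PartialConvolution.

Section WeightedSums.
Variables (R : realFieldType) (rho : R).
Hypothesis rho_gt0 : 0 < rho.
Implicit Types a b : nat -> R.

Definition wsum a N : R := \sum_(1 <= m < N) rho ^+ m * a m.

Lemma wsum_le a b N : (forall m, a m.+1 <= b m.+1) -> wsum a N <= wsum b N.
Proof.
move=> ab; apply: ler_sum_nat => -[//|m] _; apply: ler_wpM2l => //.
by rewrite exprn_ge0 // ltW.
Qed.

Lemma wsumD a b N : wsum (fun m => a m + b m) N = wsum a N + wsum b N.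
Proof. by rewrite /wsum -big_split; apply: eq_bigr => m _; rewrite mulrDr. Qed.

Lemma wsumZ c a N : wsum (fun m => c * a m) N = c * wsum a N.
Proof. by rewrite /wsum mulr_sumr; apply: eq_bigr => m _; rewrite mulrCA. Qed.

Lemma wsum_ge0 a N : (forall m, 0 <= a m) -> 0 <= wsum a N.
Proof. by move=> a0; apply: sumr_ge0 => m _; rewrite mulr_ge0 ?exprn_ge0 // ltW. Qed.

Lemma wsum_mid a b N : (forall i, 0 <= a i) -> (forall i, 0 <= b i) ->
  wsum (fun m => \sum_(1 <= i < m) a i * b (m - i)%N) N.+1 <= wsum a N * wsum b N.
Proof.
move=> a0 b0; have w0 (z : nat -> R) i : (forall i, 0 <= z i) -> 0 <= rho ^+ i * z i.
  by move=> z0; rewrite mulr_ge0 ?exprn_ge0 // ltW.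
apply: le_trans (mid_conv_le (a := fun i => rho ^+ i * a i) (b := fun i => rho ^+ i * b i) N _ _);
  [|by move=> i; exact: w0..].
rewrite le_eqVlt; apply/orP; left; apply/eqP; apply: eq_bigr => m _.
rewrite mulr_sumr [LHS]big_nat_cond [RHS]big_nat_cond; apply: eq_bigr => i.
rewrite andbT => /andP[_ im]; rewrite -{1}(subnKC (ltnW im)) exprD; ring.
Qed.

End WeightedSums.

(** In [formal_flow] the letters [S], [Rr], [V], [Z], [W] are the weighted sums of the norms of the
    coefficients of [s], [r], [g], [phi], [h], and [eps * eps] bounds the convolution terms. The
    constants [c1], [c2], [c3] bound [V], [Z], [W] in multiples of [2 * d0 + eps * eps]. *)
Lemma majorant_step (R : realFieldType) (X Ks S Rr V Z W eps d0 : R) :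
  let c1 := Ks * (2 * X + 2) in let c2 := 2 * X * c1 + 1 in let c3 := 2 * X * c2 + 1 in
  let kk := c1 + c2 + c3 in
  0 <= X -> 0 <= Ks -> 0 <= d0 -> 0 <= eps <= 1 -> kk * (2 * d0 + eps * eps) <= eps ->
  S <= d0 + eps * d0 + eps * eps -> Rr <= 2 * X * S + eps * eps + eps * eps -> V <= Ks * Rr ->
  Z <= 2 * X * V + S -> W <= 2 * X * Z + eps * eps -> [/\ V <= eps, Z <= eps & W <= eps].
Proof.
move=> c1 c2 c3 kk X0 Ks0 d00 /andP[e0 e1] kG SS RR VV ZZ WW.
pose G := 2 * d0 + eps * eps; have ee : 0 <= eps * eps by rewrite mulr_ge0.
have G0 : 0 <= G by rewrite /G addr_ge0 // mulr_ge0.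
have SG : S <= G by have := ler_wpM2r d00 e1; rewrite /G; lra.
have eG : eps * eps <= G by rewrite /G lerDr mulr_ge0.
have X20 : 0 <= 2 * X by rewrite mulr_ge0.
have c10 : 0 <= c1 by rewrite /c1 mulr_ge0 // addr_ge0.
have c20 : 0 <= c2 by rewrite /c2 addr_ge0 // mulr_ge0.
have c30 : 0 <= c3 by rewrite /c3 addr_ge0 // mulr_ge0.
have RG : Rr <= (2 * X + 2) * G by have := ler_wpM2l X20 SG; lra.
have VG : V <= c1 * G by have := ler_wpM2l Ks0 RG; rewrite /c1; lra.
have ZG : Z <= c2 * G by have := ler_wpM2l X20 VG; rewrite /c2; lra.
have WG : W <= c3 * G by have := ler_wpM2l X20 ZG; rewrite /c3; lra.
have g1 : 0 <= c1 * G by rewrite mulr_ge0.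
have g2 : 0 <= c2 * G by rewrite mulr_ge0.
have g3 : 0 <= c3 * G by rewrite mulr_ge0.
have kE : kk * G = c1 * G + c2 * G + c3 * G by rewrite /kk; ring.
by rewrite -/G kE in kG; split; [apply: le_trans VG _ | apply: le_trans ZG _ | apply: le_trans WG _];
  move: (c1 * G) (c2 * G) (c3 * G) g1 g2 g3 kG => a1 a2 a3; lra.
Qed.

Section FormalSeries.
Variables (R : realType) (d : nat).
Notation A := 'M[R[i]]_d.
Implicit Types u w : nat -> A.

Definition conv u w m : A := \sum_(i < m.+1) u i * w (m - i)%N.
(** For [m > 0], the Cauchy product without its two extreme terms, the only ones that involve a
    coefficient of order [m]. *)
Definition midconv u w m : A := \sum_(1 <= i < m) u i * w (m - i)%N.

Lemma conv0 u w : conv u w 0 = u 0 * w 0.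
Proof. by rewrite /conv big_ord_recl big_ord0 addr0. Qed.

Lemma convS u w m : conv u w m.+1 = u 0 * w m.+1 + u m.+1 * w 0 + midconv u w m.+1.
Proof.
rewrite /conv /midconv big_ord_recl big_ord_recr /= subn0 subnn -addrA; congr (_ + _).
rewrite addrC; congr (_ + _); rewrite big_add1 big_mkord.
by apply: eq_bigr.
Qed.

Lemma midconv_ext u u' w w' m : (forall i, (i < m)%N -> u i = u' i) -> (forall i, (i < m)%N -> w i = w' i) ->
  midconv u w m = midconv u' w' m.
Proof.
move=> uu ww; rewrite /midconv big_nat_cond [RHS]big_nat_cond; apply: eq_bigr => i.
rewrite andbT => /andP[i1 im]; rewrite uu // ww //.
by rewrite ltn_subrL i1 (leq_ltn_trans _ im).
Qed.

Lemma nrm_midconv u w m : nrm (midconv u w m) <= \sum_(1 <= i < m) nrm (u i) * nrm (w (m - i)%N).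
Proof. by apply: le_trans (nrm_sum _ _ _) _; apply: ler_sum => i _; exact: nrmM. Qed.

End FormalSeries.

Section FormalFlow.
Variables (R : realType) (d : nat) (T I : finType).
Notation A := 'M[R[i]]_d.
Variables (al : A) (x : T -> A) (e : I -> A) (hdT tlT : T -> I) (y : nat -> T -> A) (M m0 : nat).
Hypothesis al_adj : adj al = al.
Hypothesis e_adj : forall i, adj (e i) = e i.
Hypothesis ex : forall i a, e i * x a = if hdT a == i then x a else 0.
Hypothesis xe : forall i a, x a * e i = if tlT a == i then x a else 0.
Hypothesis al_comm : forall m, graded e m -> al * m = m * al.
Hypothesis al_gr : graded e al.
Hypothesis y0 : forall a, y 0 a = x a.
Hypothesis y_fin : forall m a, (m0 <= m)%N -> y m a = 0.
Hypothesis y_hom : forall m a, homog e hdT tlT a (y m a).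
Hypothesis M_gt0 : (0 < M)%N.
Let H := moment al x.

Definition half (m : A) : A := rscale (1 / 2) 1 * m.

Record state := State { st_g : A; st_phi : T -> A; st_h : A }.

Section Step.
Variable sol : nat -> A -> A.
Variables (m : nat) (u : nat -> state).
Let g i := st_g (u i).
Let phi a i := st_phi (u i) a.
Let h i := st_h (u i).

(** As [g 0 = 1] and [phi 0 = y 0 = x], the order [m] of [phi g = g y] reads
    [phi m = brak (g m) x + s m], where [s m] involves only earlier coefficients besides the given
    [y m]. *)
Definition step_s a : A := y m a + (midconv g (fun i => y i a) m - midconv (phi a) g m).
Definition step_q : A :=
  half (\sum_a (midconv (phi a) (fun i => adj (phi a i)) m - midconv (fun i => adj (phi a i)) (phi a) m)).
Definition lin_h (z : T -> A) : A := half (\sum_a (brak (z a) (adj (x a)) + brak (x a) (adj (z a)))).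
Definition step_t : A := lin_h step_s + step_q.
(** The right-hand side of the order [m] of the equation for [g], once the part of [h m] linear in
    [g m] has moved to the left as [gaugeB]. *)
Definition step_r : A := - (step_t + midconv h g m).
Definition step_eta : A := sol m step_r.
Definition step_phi a : A := brak step_eta (x a) + step_s a.
Definition step : state :=
  if m == 0 then State 1 x H else State step_eta step_phi (lin_h step_phi + step_q).
End Step.

Lemma step_local sol m u w : (forall i, (i < m)%N -> u i = w i) -> step sol m u = step sol m w.
Proof.
move=> uw.
have g_eq i : (i < m)%N -> st_g (u i) = st_g (w i) by move=> /uw ->.
have p_eq a i : (i < m)%N -> st_phi (u i) a = st_phi (w i) a by move=> /uw ->.
have pa_eq a i : (i < m)%N -> adj (st_phi (u i) a) = adj (st_phi (w i) a) by move=> /uw ->.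
have h_eq i : (i < m)%N -> st_h (u i) = st_h (w i) by move=> /uw ->.
have sE : step_s m u = step_s m w.
  apply/funext => a; rewrite /step_s; congr (_ + (_ - _)).
    by apply: midconv_ext => // i im; exact: g_eq.
  by apply: midconv_ext => i im; [exact: p_eq | exact: g_eq].
have qE : step_q m u = step_q m w.
  rewrite /step_q; congr half; apply: eq_bigr => a _.
  by congr (_ - _); apply: midconv_ext => // i; [exact: p_eq|exact: pa_eq|exact: pa_eq|exact: p_eq].
have rE : step_r m u = step_r m w.
  by rewrite /step_r /step_t sE qE; congr (- (_ + _)); apply: midconv_ext => i im; [exact: h_eq | exact: g_eq].
by rewrite /step /step_phi /step_eta rE sE qE.
Qed.

(** Let a prime denote multiplication of the coefficient of order [m] by [m / M], which is d/dt for
    [s = e^(t/M)]. The equations are [phi g = g y], [g' = g H - h g] and [h = moment al phi];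
    together with [y' = y H - H y] they yield the flow equation [phi' = phi h - h phi]. *)
Theorem formal_flow : exists (g : nat -> A) (phi : nat -> T -> A) (h : nat -> A) (rho : R),
  [/\ 0 < rho, g 0 = 1, forall a, phi 0 a = x a,
     forall m, graded e (g m) /\ forall a, homog e hdT tlT a (phi m a) &
     forall N, \sum_(1 <= m < N) rho ^+ m * nrm (g m) <= 1 / 2] /\
  [/\ forall a N, \sum_(1 <= m < N) rho ^+ m * nrm (phi m a) <= 1,
     forall N, \sum_(1 <= m < N) rho ^+ m * nrm (h m) <= 1,
     forall a m, conv (phi ^~ a) g m = conv g (y ^~ a) m,
     forall m, rscale (m%:R / M%:R) 1 * g m = g m * H - conv h g m &
     forall m, h m = (if m == 0 then al else 0) +
       half (\sum_a (conv (phi ^~ a) (fun i => adj (phi i a)) m - conv (fun i => adj (phi i a)) (phi ^~ a) m))].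
Proof.
have Mp : (0 : R) < M%:R by rewrite ltr0n.
have c00 : (0 : R) < M%:R^-1 by rewrite invr_gt0.
have [Ks Ks0 KsP] := gauge_solve al_adj e_adj ex xe al_comm al_gr c00.
have solP m r : exists w : A, (0 < m)%N -> graded e r ->
  [/\ graded e w, rscale (m%:R / M%:R) 1 * w + brak H w + gaugeB x w = r & nrm w <= Ks * nrm r].
  (* The value 0 is a default at order 0 and for right-hand sides that are not graded. *)
  have [hm|hm] := pselect ((0 < m)%N /\ graded e r); last by exists 0 => h1 h2; case: hm.
  have [|w wP] := KsP (m%:R / M%:R) r _ hm.2; last by exists w.
  by rewrite -[leLHS]mul1r ler_wpM2r ?invr_ge0 ?ler0n // ler1n; case: hm.
have [sol {}solP] : exists sol : nat -> A -> A, forall m r, (0 < m)%N -> graded e r ->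
  [/\ graded e (sol m r), rscale (m%:R / M%:R) 1 * sol m r + brak H (sol m r) + gaugeB x (sol m r) = r &
     nrm (sol m r) <= Ks * nrm r].
  have [s sP] := choice (fun p : nat * A => solP p.1 p.2).
  by exists (fun m r => s (m, r)) => m r; exact: (sP (m, r)).
have [u uP] := strong_rec (State 0 (fun=> 0) 0) (@step_local sol).
pose g m := st_g (u m); pose phi m a := st_phi (u m) a; pose h m := st_h (u m).
have u0 : u 0 = State 1 x H by rewrite uP.
have g0 : g 0 = 1 by rewrite /g u0.
have phi0 a : phi 0 a = x a by rewrite /phi u0.
have h0 : h 0 = H by rewrite /h u0.
pose s m a := step_s m u a; pose q m := step_q m u; pose r m := step_r m u.
have gS m : g m.+1 = sol m.+1 (r m.+1) by rewrite /g uP /step /=.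
have phiS m a : phi m.+1 a = brak (g m.+1) (x a) + s m.+1 a by rewrite gS /phi uP /step /=.
have hS m : h m.+1 = lin_h (phi m.+1) + q m.+1.
  have pE : phi m.+1 = step_phi sol m.+1 u by rewrite /phi uP.
  by rewrite pE /h uP.
have sE m a : s m a = y m a + (midconv g (y ^~ a) m - midconv (phi ^~ a) g m) by [].
have qE m : q m = half (\sum_a (midconv (phi ^~ a) (fun i => adj (phi i a)) m - midconv (fun i => adj (phi i a)) (phi ^~ a) m)) by [].
have rE m : r m = - (lin_h (s m) + q m + midconv h g m) by [].
have halfgr z : graded e z -> graded e (half z).
  by move=> hz; rewrite /half -rscaleE; exact: graded_rscale.
have lin_gr z : (forall a, homog e hdT tlT a (z a)) -> graded e (lin_h z).
  move=> hz; apply: halfgr; apply: graded_sum => a _; have hx := homog_x ex xe a.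
  apply: gradedD; apply: gradedB.
  - exact: (homog_adjr e_adj (hz a) hx).
  - exact: (homog_adjl e_adj hx (hz a)).
  - exact: (homog_adjr e_adj hx (hz a)).
  - exact: (homog_adjl e_adj (hz a) hx).
(* Gradedness of all coefficients is proved in one induction, as [sol] solves the equation of order
   [m] only for a graded right-hand side. *)
have gr m : [/\ graded e (g m), forall a, homog e hdT tlT a (phi m a) & graded e (h m)] /\
   ((0 < m)%N -> graded e (r m)).
  elim/ltn_ind: m => [[|m]] IH.
    split => //; split; [rewrite g0; exact: graded1 | move=> a; rewrite phi0; exact: homog_x |].
    rewrite h0; exact: (graded_H e_adj ex xe al_gr).
  have grs a : homog e hdT tlT a (s m.+1 a).
    apply: homogD => //; rewrite /midconv; apply: homogB; rewrite big_nat_cond; apply: homog_sum => i;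
      rewrite andbT => /andP[i1 im].
      by apply: homogMl => //; have [[]] := IH i im.
    have im' : (m.+1 - i < m.+1)%N by rewrite ltn_subrL i1.
    by apply: homogMr; [have [[]] := IH _ im' | have [[_ hh _] _] := IH i im; exact: hh].
  have grq : graded e (q m.+1).
    apply: halfgr; apply: graded_sum => a _; rewrite /midconv; apply: gradedB; rewrite big_nat_cond; apply: graded_sum => i;
      rewrite andbT => /andP[i1 im]; have im' : (m.+1 - i < m.+1)%N by rewrite ltn_subrL i1.
      have [[_ h1 _] _] := IH i im; have [[_ h2 _] _] := IH _ im'.
      exact: (homog_adjr e_adj (h1 a) (h2 a)).
    have [[_ h1 _] _] := IH i im; have [[_ h2 _] _] := IH _ im'.
    exact: (homog_adjl e_adj (h1 a) (h2 a)).
  have grr : graded e (r m.+1).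
    apply: gradedN; apply: gradedD; first by apply: gradedD => //; exact: lin_gr.
    rewrite /midconv big_nat_cond; apply: graded_sum => i; rewrite andbT => /andP[i1 im].
    have im' : (m.+1 - i < m.+1)%N by rewrite ltn_subrL i1.
    by apply: gradedM; [have [[]] := IH i im | have [[]] := IH _ im'].
  have [gg _ _] := solP m.+1 _ isT grr; rewrite -gS in gg.
  have hphi a : homog e hdT tlT a (phi m.+1 a).
    rewrite phiS; apply: homogD => //; apply: homogB.
      by apply: homogMl => //; exact: homog_x.
    by apply: homogMr => //; exact: homog_x.
  split=> //; split => //; rewrite hS; apply: gradedD => //; exact: lin_gr.
have gE m : rscale (m.+1%:R / M%:R) 1 * g m.+1 + brak H (g m.+1) + gaugeB x (g m.+1) = r m.+1.
  by have [_ grr] := gr m.+1; have [_] := solP m.+1 _ isT (grr isT); rewrite -gS.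
have g_le m : nrm (g m.+1) <= Ks * nrm (r m.+1).
  by have [_ grr] := gr m.+1; have [_ _] := solP m.+1 _ isT (grr isT); rewrite -gS.
have gr_g m : graded e (g m) by have [[]] := gr m.
have lin_hD z w : lin_h (fun a => z a + w a) = lin_h z + lin_h w.
  rewrite /lin_h /half -mulrDr -big_split /=; congr (_ * _); apply: eq_bigr => a _.
  by rewrite /brak !adjD; ncring.
have eq1 a m : conv (phi ^~ a) g m = conv g (y ^~ a) m.
  case: m => [|m]; first by rewrite !conv0 g0 phi0 y0 mul1r mulr1.
  rewrite !convS g0 phi0 y0 mulr1 mul1r phiS sE /brak; ncring.
have eq2 m : rscale (m%:R / M%:R) 1 * g m = g m * H - conv h g m.
  case: m => [|m]; first by rewrite conv0 g0 h0 mul0r rscale0 mul0r mul1r mulr1 subrr.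
  rewrite convS g0 h0 mulr1.
  have lin_phi : lin_h (phi m.+1) = gaugeB x (g m.+1) + lin_h (s m.+1).
    rewrite -[gaugeB x _]/(lin_h (fun a => brak (g m.+1) (x a))) -lin_hD; congr lin_h.
    by apply/funext => a; exact: phiS.
  rewrite hS lin_phi.
  apply: (@nc_lincomb _ _ _ (rscale (m.+1%:R / M%:R) 1 * g m.+1 + brak H (g m.+1) + gaugeB x (g m.+1) - r m.+1)).
    by rewrite gE subrr.
  by rewrite rE /brak; ncring.
have eq3 m : h m = (if m == 0 then al else 0) +
    half (\sum_a (conv (phi ^~ a) (fun i => adj (phi i a)) m - conv (fun i => adj (phi i a)) (phi ^~ a) m)).
  case: m => [|m].
    rewrite h0 /H /moment /half; congr (_ + _ * _); apply: eq_bigr => a _.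
    by rewrite !conv0 phi0.
  rewrite hS /= add0r /lin_h qE /half -mulrDr -big_split /=; congr (_ * _); apply: eq_bigr => a _.
  by rewrite !convS !phi0 /brak; ncring.
pose X : R := \sum_a nrm (x a); have X0 : 0 <= X by apply: sumr_ge0 => a _; exact: nrm_ge0.
have xX a : nrm (x a) <= X by rewrite /X (bigD1 a) //= lerDl sumr_ge0 // => b _; exact: nrm_ge0.
pose nY m := \sum_a nrm (y m a); pose nS m := \sum_a nrm (s m a); pose nZ m := \sum_a nrm (phi m a).
have nY0 m : 0 <= nY m by apply: sumr_ge0 => a _; exact: nrm_ge0.
have nS0 m : 0 <= nS m by apply: sumr_ge0 => a _; exact: nrm_ge0.
have nZ0 m : 0 <= nZ m by apply: sumr_ge0 => a _; exact: nrm_ge0.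
have ng0 m : 0 <= nrm (g m) by exact: nrm_ge0.
have nh0 m : 0 <= nrm (h m) by exact: nrm_ge0.
have phi_nZ m a : nrm (phi m a) <= nZ m.
  by rewrite /nZ (bigD1 a) //= lerDl sumr_ge0 // => b _; exact: nrm_ge0.
have half_nrm z : nrm (half z) = 1 / 2 * nrm z by rewrite /half -rscaleE nrm_rscale ger0_norm // divr_ge0.
have brak_nrm z w : nrm (brak z w : A) <= 2 * (nrm z * nrm w).
  by apply: le_trans (nrmB _ _) _; have := nrmM z w; have := nrmM w z; rewrite [nrm w * _]mulrC; move: (nrm z * nrm w) => t; lra.
have linh_le z : nrm (lin_h z) <= 2 * X * \sum_a nrm (z a).
  rewrite half_nrm; have : nrm (\sum_a (brak (z a) (adj (x a)) + brak (x a) (adj (z a)))) <= \sum_a 4 * X * nrm (z a).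
    apply: le_trans (nrm_sum _ _ _) _; apply: ler_sum => a _; apply: le_trans (nrmD _ _) _.
    have h1 := brak_nrm (z a) (adj (x a)); have h2 := brak_nrm (x a) (adj (z a)).
    rewrite !nrm_adj in h1 h2; have h3 := ler_wpM2l (nrm_ge0 (z a)) (xX a).
    rewrite [nrm (x a) * _]mulrC in h2; move: h1 h2 h3; move: (nrm (z a) * nrm (x a)) (nrm (brak _ _)) (nrm (brak _ _)) => t1 t2 t3; lra.
  by rewrite -mulr_sumr; move: (\sum_a nrm (z a)) (nrm _) => t1 t2; lra.
have q_le m : nrm (q m) <= \sum_(1 <= i < m) nZ i * nZ (m - i)%N.
  rewrite qE half_nrm.
  have : nrm (\sum_a (midconv (phi ^~ a) (fun i => adj (phi i a)) m - midconv (fun i => adj (phi i a)) (phi ^~ a) m))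
     <= \sum_a 2 * \sum_(1 <= i < m) nrm (phi i a) * nrm (phi (m - i)%N a).
    apply: le_trans (nrm_sum _ _ _) _; apply: ler_sum => a _; apply: le_trans (nrmB _ _) _.
    have := nrm_midconv (phi ^~ a) (fun i => adj (phi i a)) m.
    have := nrm_midconv (fun i => adj (phi i a)) (phi ^~ a) m.
    under eq_bigr do rewrite nrm_adj; under [in X in _ -> X -> _]eq_bigr do rewrite nrm_adj.
    by move: (nrm _) (nrm _) (\sum_(1 <= i < m) _) => t1 t2 t3; lra.
  have : \sum_a \sum_(1 <= i < m) nrm (phi i a) * nrm (phi (m - i)%N a) <= \sum_(1 <= i < m) nZ i * nZ (m - i)%N.
    rewrite exchange_big /=; apply: ler_sum => i _; rewrite /nZ mulr_suml; apply: ler_sum => a _.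
    by rewrite ler_wpM2l ?nrm_ge0.
  by rewrite -mulr_sumr; move: (nrm _) (\sum_a _) (\sum_(1 <= i < m) _) => t1 t2 t3; lra.
have s_le m : nS m <= nY m + (\sum_(1 <= i < m) nrm (g i) * nY (m - i)%N + \sum_(1 <= i < m) nZ i * nrm (g (m - i)%N)).
  have e1 : \sum_(1 <= i < m) nrm (g i) * nY (m - i)%N = \sum_a \sum_(1 <= i < m) nrm (g i) * nrm (y (m - i)%N a).
    by rewrite exchange_big /=; apply: eq_bigr => i _; rewrite mulr_sumr.
  have e2 : \sum_(1 <= i < m) nZ i * nrm (g (m - i)%N) = \sum_a \sum_(1 <= i < m) nrm (phi i a) * nrm (g (m - i)%N).
    by rewrite exchange_big /=; apply: eq_bigr => i _; rewrite mulr_suml.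
  rewrite e1 e2 -!big_split /=; apply: ler_sum => a _; rewrite sE.
  apply: le_trans (nrmD _ _) _; rewrite lerD2l; apply: le_trans (nrmB _ _) _.
  by apply: lerD; exact: nrm_midconv.
have r_le m : nrm (r m) <= 2 * X * nS m + \sum_(1 <= i < m) nZ i * nZ (m - i)%N + \sum_(1 <= i < m) nrm (h i) * nrm (g (m - i)%N).
  rewrite rE nrmN; apply: le_trans (nrmD _ _) _; apply: lerD; last exact: nrm_midconv.
  by apply: le_trans (nrmD _ _) _; apply: lerD.
have Z_le m : nZ m.+1 <= 2 * X * nrm (g m.+1) + nS m.+1.
  rewrite /nZ /nS mulrAC -mulrA mulr_sumr mulr_sumr -big_split /=; apply: ler_sum => a _.
  rewrite phiS; apply: le_trans (nrmD _ _) _; rewrite lerD2r.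
  by apply: le_trans (brak_nrm _ _) _.
have h_le m : nrm (h m.+1) <= 2 * X * nZ m.+1 + \sum_(1 <= i < m.+1) nZ i * nZ (m.+1 - i)%N.
  by rewrite hS; apply: le_trans (nrmD _ _) _; apply: lerD.
pose c1 := Ks * (2 * X + 2); pose c2 := 2 * X * c1 + 1; pose c3 := 2 * X * c2 + 1.
pose kk := c1 + c2 + c3.
have c10 : 0 <= c1 by rewrite /c1 mulr_ge0 // addr_ge0 // mulr_ge0.
have c20 : 0 <= 2 * X * c1 by apply: mulr_ge0 c10; exact: mulr_ge0.
have c30 : 0 <= 2 * X * c2 by apply: mulr_ge0; [exact: mulr_ge0 | exact: addr_ge0].
have kk1 : 1 <= kk by rewrite /kk /c3 {1}/c2; lra.
have kp : 0 < kk by exact: lt_le_trans ltr01 kk1.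
(* With this [eps] and the [d0] below, both terms of [kk * (2 * d0 + eps * eps)] are [eps / 4], so
   that [majorant_step] applies. *)
pose eps := (4 * kk)^-1; have ke : 4 * kk * eps = 1 by rewrite /eps mulfV // gt_eqF // mulr_gt0.
have eps0 : 0 < eps by rewrite /eps invr_gt0 mulr_gt0.
have eps1 : eps <= 1 / 4 by have := ler_wpM2r (ltW eps0) kk1; lra.
pose d0 := eps / (8 * kk); have d00 : 0 < d0 by rewrite divr_gt0 // mulr_gt0.
have kd : 8 * kk * d0 = eps by rewrite /d0 mulrC divfK // gt_eqF // mulr_gt0.
have kG : kk * (2 * d0 + eps * eps) <= eps.
  have -> : kk * (2 * d0 + eps * eps) = (8 * kk * d0) / 4 + (4 * kk * eps) * eps / 4 by field.
  by rewrite kd ke; lra.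
clearbody eps d0.
pose C := \sum_(0 <= m < m0) nY m.
have C0 : 0 <= C by apply: sumr_ge0.
(* As [rho ^+ m <= rho] for [m > 0], this makes the weighted sum of the finitely many nonzero [y m]
   of positive order at most [d0]. *)
pose rho := Num.min 1 (d0 / (C + 1)).
have C1 : 0 < C + 1 by rewrite ltr_wpDl.
have rho0 : 0 < rho by rewrite lt_min ltr01 divr_gt0.
have rho1 : rho <= 1 by rewrite ge_min lexx.
have rhoC : rho * C <= d0.
  apply: (@le_trans _ _ (d0 / (C + 1) * C)); first by apply: ler_wpM2r => //; rewrite /rho ge_min lexx orbT.
  by rewrite mulrAC ler_pdivrMr // ler_wpM2l ?(ltW d00) // lerDl.
clearbody rho.
have Y_le N : wsum rho nY N <= d0.
  apply: le_trans rhoC; apply: (@le_trans _ _ (\sum_(1 <= m < N) rho * nY m)).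
    apply: ler_sum_nat => -[//|m] _; apply: ler_wpM2r => //.
    by rewrite exprS -[leRHS]mulr1 ler_wpM2l ?(ltW rho0) // exprn_ile1 // ltW.
  rewrite -mulr_sumr; apply: ler_wpM2l; first exact: ltW.
  apply: (@le_trans _ _ (\sum_(0 <= m < m0 + N) nY m)).
    case: N => [|N]; first by rewrite big_geq // sumr_ge0.
    rewrite [leRHS](big_cat_nat (n := 1)) //= ?addnS // [X in _ <= _ + X](big_cat_nat (n := N.+1)) //= ?ltnS ?leq_addl //.
    by rewrite addrCA lerDl addr_ge0 // sumr_ge0.
  rewrite (big_cat_nat (n := m0)) //= ?leq_addr // -/C gerDl.
  rewrite big_nat_cond big1 // => m; rewrite andbT => /andP[mm _].
  by rewrite /nY big1 // => a _; rewrite y_fin // nrm0.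
have ind N : [/\ wsum rho (fun m => nrm (g m)) N <= eps, wsum rho nZ N <= eps & wsum rho (fun m => nrm (h m)) N <= eps].
  elim: N => [|N [V Z W]]; first by rewrite /wsum !big_geq // ltW.
  have V0 : 0 <= wsum rho (fun m => nrm (g m)) N by exact: wsum_ge0.
  have Z0 : 0 <= wsum rho nZ N by exact: wsum_ge0.
  have W0 : 0 <= wsum rho (fun m => nrm (h m)) N by exact: wsum_ge0.
  have Y0 : 0 <= wsum rho nY N by exact: wsum_ge0.
  have ZZ : wsum rho (fun m => \sum_(1 <= i < m) nZ i * nZ (m - i)%N) N.+1 <= eps * eps.
    by apply: le_trans (wsum_mid rho0 N nZ0 nZ0) _; exact: ler_pM.
  have HG : wsum rho (fun m => \sum_(1 <= i < m) nrm (h i) * nrm (g (m - i)%N)) N.+1 <= eps * eps.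
    by apply: le_trans (wsum_mid rho0 N nh0 ng0) _; exact: ler_pM.
  have ZG : wsum rho (fun m => \sum_(1 <= i < m) nZ i * nrm (g (m - i)%N)) N.+1 <= eps * eps.
    by apply: le_trans (wsum_mid rho0 N nZ0 ng0) _; exact: ler_pM.
  have GY : wsum rho (fun m => \sum_(1 <= i < m) nrm (g i) * nY (m - i)%N) N.+1 <= eps * d0.
    by apply: le_trans (wsum_mid rho0 N ng0 nY0) _; exact: ler_pM.
  apply: (@majorant_step _ X Ks (wsum rho nS N.+1) (wsum rho (fun m => nrm (r m)) N.+1) _ _ _ eps d0) => //.
  - exact: ltW.
  - by apply/andP; split; [exact: ltW | move: eps1; lra].
  - apply: le_trans (wsum_le rho0 N.+1 (b := fun m => nY m + (\sum_(1 <= i < m) nrm (g i) * nY (m - i)%N + \sum_(1 <= i < m) nZ i * nrm (g (m - i)%N))) (fun m => s_le m.+1)) _; rewrite !wsumD -addrA.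
    by apply: lerD => //; apply: lerD.
  - apply: le_trans (wsum_le rho0 N.+1 (b := fun m => 2 * X * nS m + \sum_(1 <= i < m) nZ i * nZ (m - i)%N + \sum_(1 <= i < m) nrm (h i) * nrm (g (m - i)%N)) (fun m => r_le m.+1)) _; rewrite !wsumD wsumZ.
    by apply: lerD => //; apply: lerD.
  - by rewrite -wsumZ; apply: wsum_le.
  - by rewrite -wsumZ -wsumD; apply: wsum_le.
  apply: le_trans (wsum_le rho0 N.+1 (b := fun m => 2 * X * nZ m + \sum_(1 <= i < m) nZ i * nZ (m - i)%N) h_le) _.
  by rewrite wsumD wsumZ; apply: lerD.
exists g, phi, h, rho; split; split => //.
- by move=> m; have [[gg ff _] _] := gr m.
- move=> N; have [V _ _] := ind N; apply: le_trans V _; move: eps1; lra.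
- move=> a N; have [_ Z _] := ind N; apply: (@le_trans _ _ eps); last by move: eps1; lra.
  by apply: le_trans Z; apply: (@wsum_le _ rho rho0 (fun m => nrm (phi m a))) => m.
- move=> N; have [_ _ W] := ind N; apply: le_trans W _; move: eps1; lra.
Qed.
End FormalFlow.

(** * Convergence of the formal flow *)

Section ScalarSeries.
Variable R : realType.
Implicit Types (c : nat -> R) (r z : R).

Definition wbounded r c := exists B, forall N, \sum_(0 <= m < N) r ^+ m * `|c m| <= B.

Lemma wbounded_cvg r c z : 0 <= z <= r -> wbounded r c -> cvgn (pseries c z).
Proof.
move=> /andP[z0 zr] [B cB]; apply: normed_cvg; apply: nondecreasing_is_cvgn.
  apply/nondecreasing_seqP => n; rewrite [leRHS]big_nat_recr //= lerDl; exact: normr_ge0.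
exists B => _ [N _ <-]; apply: le_trans (cB N); rewrite /series /=.
apply: ler_sum => m _; rewrite normrM normrX (ger0_norm z0) mulrC.
by apply: ler_wpM2r => //; apply: lerXn2r => //; rewrite nnegrE (le_trans z0).
Qed.

(** The factor [m.+1] from differentiation is absorbed by [2 ^ m], at the price of half the
    radius. *)
Lemma wbounded_diffs r c : 0 < r -> wbounded r c -> wbounded (r / 2) (pseries_diffs c).
Proof.
move=> r0 [B cB]; exists (r^-1 * B) => N; rewrite ler_pdivlMl //; apply: le_trans (cB N.+1).
rewrite big_nat_recl //= [leRHS]addrC; apply: ler_wpDr; first by rewrite mulr_ge0 ?exprn_ge0 // ltW.
rewrite mulr_sumr; apply: ler_sum => m _; rewrite /pseries_diffs normrM (ger0_norm (ler0n _ _)).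
rewrite exprS exprMn [leLHS]mulrA [leRHS]mulrC -mulrA mulrA; move: (`|c m.+1|) (normr_ge0 (c m.+1)) => a a0.
have m2 : (2 : R)^-1 ^+ m * m.+1%:R <= 1.
  rewrite exprVn ler_pdivrMl ?exprn_gt0 // mulr1 -natrX ler_nat; exact: ltn_expl.
have rm : 0 <= r * r ^+ m by rewrite mulr_ge0 ?exprn_ge0 // ltW.
have := ler_wpM2l (mulr_ge0 rm a0) m2; rewrite mulr1.
by rewrite [leLHS]mulrACA [X in _ <= X -> _]mulrC; congr (_ <= _); ring.
Qed.

(** Termwise differentiation by [pseries_snd_diffs] asks for convergence of the first two derived
    series, and each of them halves the radius; hence [r / 4]. *)
Lemma pseries_exp_derive r c (z0 t k : R) : 0 < r -> wbounded r c -> 0 < z0 ->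
  z0 * expR (k * t) < r / 4 ->
  is_derive t 1 (fun s : R => limn (pseries c (z0 * expR (k * s))))
    (limn (pseries (fun m => k * m%:R * c m) (z0 * expR (k * t)))).
Proof.
move=> r0 cB z00 zr; set z := z0 * expR (k * t).
have zp : 0 < z by rewrite mulr_gt0 ?expR_gt0.
have b1 := wbounded_diffs r0 cB; have r2 : 0 < r / 2 by rewrite divr_gt0.
have b2 := wbounded_diffs r2 b1; have r4 : 0 < r / 2 / 2 by rewrite divr_gt0.
have e4 : r / 4 = r / 2 / 2 by field.
have zr4 : z < r / 2 / 2 by rewrite -e4.
have zK : `|z| < `|r / 2 / 2| by rewrite !gtr0_norm.
have Kin (q : R) : r / 2 / 2 <= q -> 0 <= r / 2 / 2 <= q by move=> ->; rewrite ltW.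
have D := pseries_snd_diffs (wbounded_cvg (Kin _ _) cB) (wbounded_cvg (Kin _ _) b1) (wbounded_cvg (Kin _ _) b2) zK.
have {}D : is_derive z 1 (fun x => limn (pseries c x)) (limn (pseries (pseries_diffs c) z)).
  by apply: D; lra.
have Dz : is_derive t 1 (fun s : R => z0 * expR (k * s)) (k * z).
  have Dk : is_derive t 1 (fun s : R => k * s) k.
    by have := is_deriveZ k (is_derive_id t (1 : R)); rewrite /GRing.scale /= mulr1.
  have De := is_derive1_comp (is_derive_expR (k * t)) Dk.
  have := is_deriveZ z0 De; rewrite /GRing.scale /=; congr (is_derive _ _ _ _).
  by rewrite /z; ring.
have := @is_derive1_comp _ _ (fun s : R => z0 * expR (k * s)) _ _ _ D Dz; congr (is_derive _ _ _ _).
apply/esym/cvg_lim => //.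
have cd : cvgn (pseries (pseries_diffs c) z).
  by apply: wbounded_cvg b1; rewrite ltW //=; lra.
have L := pseries_diffs_equiv cd.
have -> : pseries (fun m => k * m%:R * c m) z = (fun N => series (fun i => i%:R * c i * z ^+ i.-1) N * (k * z)).
  apply/funext => N; rewrite /pseries /series /= mulr_suml; apply: eq_bigr => m _.
  by case: m => [|m]; rewrite ?mul0r ?mulr0 ?mul0r //= exprS; ring.
exact: cvgMl.
Qed.

Lemma expR_cvgNy (k e : R) : 0 < k -> 0 < e -> (\forall t \near -oo, expR (k * t) < e)%classic.
Proof.
move=> k0 e0; exists (ln e / k); split; first exact: num_real.
by move=> t; rewrite ltr_pdivlMr // mulrC => kt; rewrite -[X in _ < X](lnK e0) ltr_expR.
Qed.
End ScalarSeries.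

(** * Power series with matrix coefficients *)

Section MatrixSeries.
Variables (R : realType) (d : nat).
Notation A := 'M[R[i]]_d.
Implicit Types (u w : nat -> A) (r z : R) (a b : A).

Definition nbounded r u := exists B, forall N, \sum_(0 <= m < N) r ^+ m * nrm (u m) <= B.

Definition psum u z N : A := \sum_(0 <= m < N) rscale (z ^+ m) (u m).

(** Built from real series, since the flow equation has to be verified on the real and imaginary
    parts of the entries. *)
Definition mxseries u z : A :=
  \matrix_(p, q) (limn (pseries (fun m => complex.Re (u m p q)) z)
                  +i* limn (pseries (fun m => complex.Im (u m p q)) z))%C.

Lemma rscale_mull r a b : rscale r a * b = rscale r (a * b).
Proof. by rewrite rscaleE -mulrA -rscaleE. Qed.

Lemma rscale_mulr r a b : a * rscale r b = rscale r (a * b).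
Proof. by rewrite [rscale r b]rscaleE mulrA -rscale_comm -mulrA -rscaleE. Qed.

Lemma nbounded_entries r u p q : 0 < r -> nbounded r u ->
  wbounded r (fun m => complex.Re (u m p q)) /\ wbounded r (fun m => complex.Im (u m p q)).
Proof.
move=> r0 [B uB]; split; exists B => N; apply: le_trans (uB N); apply: ler_sum => m _;
  by (apply: ler_wpM2l; [rewrite exprn_ge0 // ltW | rewrite ?abs1_Re ?abs1_Im]).
Qed.

Lemma nbounded_ext r u w : (forall m, nrm (u m) <= nrm (w m)) -> 0 <= r -> nbounded r w -> nbounded r u.
Proof.
move=> uw r0 [B wB]; exists B => N; apply: le_trans (wB N).
by apply: ler_sum => m _; rewrite ler_wpM2l ?exprn_ge0.
Qed.

Lemma nbounded_le r s u : 0 <= r <= s -> nbounded s u -> nbounded r u.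
Proof.
move=> /andP[r0 rs] [B uB]; exists B => N; apply: le_trans (uB N); apply: ler_sum => m _.
by apply: ler_wpM2r; [exact: nrm_ge0 | apply: lerXn2r => //; exact: le_trans rs].
Qed.

Lemma nbounded_shift r u B : (forall N, \sum_(1 <= m < N) r ^+ m * nrm (u m) <= B) -> nbounded r u.
Proof.
move=> uB; exists (nrm (u 0) + B) => -[|N].
  rewrite big_geq //; apply: addr_ge0; first exact: nrm_ge0.
  by have := uB 0; rewrite big_geq.
by rewrite big_nat_recl //= expr0 mul1r lerD2l -[leRHS]/B; have := uB N.+1; rewrite big_add1.
Qed.

Lemma nbounded_finite r u m0 : 0 <= r -> (forall m, (m0 <= m)%N -> u m = 0) -> nbounded r u.
Proof.
move=> r0 u0; exists (\sum_(0 <= m < m0) r ^+ m * nrm (u m)) => N.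
apply: (@le_trans _ _ (\sum_(0 <= m < m0 + N) r ^+ m * nrm (u m))).
  rewrite [leRHS](big_cat_nat (n := N)) //= ?leq_addl // lerDl; apply: sumr_ge0 => m _.
  by rewrite mulr_ge0 ?exprn_ge0 ?nrm_ge0.
rewrite (big_cat_nat (n := m0)) //= ?leq_addr // gerDl.
by rewrite big_nat_cond big1 // => m; rewrite andbT => /andP[mm _]; rewrite u0 // nrm0 mulr0.
Qed.

Lemma nbounded_weight r (k : R) u : 0 <= r -> 0 <= k <= 1 -> nbounded r u ->
  nbounded (r / 2) (fun m => rscale (k * m%:R) (u m)).
Proof.
move=> r0 /andP[k0 k1] [B uB]; exists B => N; apply: le_trans (uB N); apply: ler_sum => m _.
rewrite nrm_rscale exprMn mulrA; apply: ler_wpM2r; first exact: nrm_ge0.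
rewrite -mulrA -[leRHS]mulr1; apply: ler_wpM2l; first exact: exprn_ge0.
rewrite ger0_norm ?mulr_ge0 // exprVn ler_pdivrMl ?exprn_gt0 // mulr1.
apply: le_trans (_ : m%:R <= _); last by rewrite -natrX ler_nat ltnW // ltn_expl.
by rewrite -[leRHS]mul1r ler_wpM2r.
Qed.

Lemma psum_cvg r u z : 0 < r -> 0 <= z <= r -> nbounded r u -> cvA (\oo%classic) (psum u z) (mxseries u z).
Proof.
move=> r0 zr uB; apply: cvA_entries => p q.
have [bR bI] := nbounded_entries p q r0 uB.
have E N : psum u z N p q = (pseries (fun m => complex.Re (u m p q)) z N +i*
    pseries (fun m => complex.Im (u m p q)) z N)%C.
  rewrite /psum /pseries /series /=; elim: N => [|N IH]; first by rewrite !big_geq // mxE.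
  by rewrite !big_nat_recr //= !mxE IH; case: (u N p q) => a b /=; congr (_ +i* _)%C; ring.
rewrite mxE /=; split.
  by under eq_fun do rewrite E /=; exact: (wbounded_cvg zr bR).
by under eq_fun do rewrite E /=; exact: (wbounded_cvg zr bI).
Qed.

Lemma triangle_sum (V : zmodType) (f : nat -> nat -> V) N :
  \sum_(0 <= m < N) \sum_(i < m.+1) f i (m - i)%N = \sum_(0 <= i < N) \sum_(0 <= j < N - i) f i j.
Proof.
elim: N => [|N IH]; first by rewrite !big_geq.
rewrite big_nat_recr //= IH [RHS]big_nat_recr //= subSnn big_nat1.
rewrite big_ord_recr /= subnn addrA; congr (_ + _).
rewrite -(big_mkord xpredT (fun i => f i (N - i)%N)) -big_split /=.
rewrite [LHS]big_nat_cond [RHS]big_nat_cond; apply: eq_bigr => i; rewrite andbT => /andP[_ iN].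
by rewrite subSn ?(ltnW iN) // big_nat_recr.
Qed.

Lemma cvA_oo_near (u v : nat -> A) (a : A) (m0 : nat) : (forall N, (m0 <= N)%N -> u N = v N) ->
  cvA (\oo%classic) u a -> cvA (\oo%classic) v a.
Proof. by move=> uv; apply: cvA_near; exists m0. Qed.

(** The product of the partial sums exceeds the partial sum of the Cauchy product by the terms with
    [i, j < N <= i + j]; there [z <= r / 2] gives [z ^+ (i + j) <= 2^(-N) r ^+ (i + j)], so that the
    excess tends to 0. *)
Lemma psum_conv_cvg r u w z : 0 < r -> 0 <= z <= r / 2 -> nbounded r u -> nbounded r w ->
  cvA (\oo%classic) (psum (conv u w) z) (mxseries u z * mxseries w z).
Proof.
move=> r0 /andP[z0 zr] uB wB.
have zr' : 0 <= z <= r by rewrite z0 /=; apply: (le_trans zr); lra.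
have L : cvA (\oo%classic) (fun N => psum u z N * psum w z N) (mxseries u z * mxseries w z).
  by apply: cvAM; exact: (psum_cvg r0 zr').
have [[Bu uBu] [Bw wBw]] := (uB, wB).
have Bu0 : 0 <= Bu by have := uBu 0; rewrite big_geq.
have Bw0 : 0 <= Bw by have := wBw 0; rewrite big_geq.
have dist N : nrm (psum u z N * psum w z N - psum (conv u w) z N) <= (1 / 2) ^+ N * (Bu * Bw).
  have h0 : 0 <= (1 / 2 : R) ^+ N by rewrite exprn_ge0 // divr_ge0.
  have rn m (b : A) : 0 <= r ^+ m * nrm b by apply: mulr_ge0; [rewrite exprn_ge0 // ltW | exact: nrm_ge0].
  pose f i j := rscale (z ^+ i) (u i) * rscale (z ^+ j) (w j).
  have -> : psum u z N * psum w z N - psum (conv u w) z N =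
      \sum_(0 <= i < N) \sum_(N - i <= j < N) f i j.
    have -> : psum (conv u w) z N = \sum_(0 <= i < N) \sum_(0 <= j < N - i) f i j.
      rewrite -triangle_sum; apply: eq_bigr => m _; rewrite /conv /rscale scaler_sumr.
      apply: eq_bigr => i _; rewrite /f rscale_mull rscale_mulr /rscale scalerA.
      by rewrite -rmorphM -exprD subnKC // -ltnS.
    rewrite /psum mulr_suml -sumrB; apply: eq_bigr => i _; rewrite mulr_sumr.
    by rewrite (big_cat_nat (n := (N - i)%N)) //= ?leq_subr // addrC addrK.
  apply: le_trans (nrm_sum _ _ _) _.
  apply: (@le_trans _ _ (\sum_(0 <= i < N) \sum_(0 <= j < N) (1 / 2) ^+ N * ((r ^+ i * nrm (u i)) * (r ^+ j * nrm (w j))))).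
    rewrite !big_mkord; apply: ler_sum => i _; apply: le_trans (nrm_sum _ _ _) _.
    rewrite [leRHS](big_cat_nat (n := (N - i)%N)) //= ?leq_subr //.
    apply: ler_wpDl.
      by apply: sumr_ge0 => j _; apply: mulr_ge0 => //; apply: mulr_ge0; exact: rn.
    rewrite [leLHS]big_nat_cond [leRHS]big_nat_cond; apply: ler_sum => j; rewrite andbT => /andP[Nj _].
    rewrite /f; apply: le_trans (nrmM _ _) _; rewrite !nrm_rscale !ger0_norm ?exprn_ge0 //.
    have zE : z ^+ i * z ^+ j <= (1 / 2) ^+ N * (r ^+ i * r ^+ j).
      rewrite -!exprD; apply: (@le_trans _ _ ((r / 2) ^+ (i + j))).
        by apply: lerXn2r => //; rewrite nnegrE // divr_ge0 // ltW.
      rewrite mulrC exprMn; apply: ler_wpM2r; first by rewrite exprn_ge0 // ltW.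
      rewrite mul1r; apply: ler_wiXn2l; rewrite ?invr_ge0 // ?invf_le1 ?ler1n //.
      by rewrite -leq_subLR.
    have := ler_wpM2l (mulr_ge0 (nrm_ge0 (u i)) (nrm_ge0 (w j))) zE.
    by congr (_ <= _); ring.
  under eq_bigr do rewrite -mulr_sumr; rewrite -mulr_sumr; apply: ler_wpM2l => //.
  under eq_bigr do rewrite -mulr_sumr; rewrite -mulr_suml; apply: ler_pM => //.
    exact: sumr_ge0.
  exact: sumr_ge0.
have D : cvA (\oo%classic) (fun N => psum u z N * psum w z N - psum (conv u w) z N) 0.
  apply: (@cvA_le_near _ _ _ _ _ _ _ (fun N => (1 / 2) ^+ N * (Bu * Bw))).
    by apply: nearW => N; rewrite subr0.
  apply: cvg_toE (mul0r (Bu * Bw)); apply: cvgMl; apply: cvg_expr.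
  by rewrite ger0_norm ?divr_ge0 // mul1r invf_lt1 // ltr1n.
have LD : cvA (\oo%classic) (fun N => psum u z N * psum w z N - (psum u z N * psum w z N - psum (conv u w) z N))
    (mxseries u z * mxseries w z - 0) by exact: cvAB L D.
by rewrite subr0 in LD; refine (cvA_oo_near (m0 := 0) _ LD) => N _; exact: subKr.
Qed.

Lemma psumD u w z N : psum (fun m => u m + w m) z N = psum u z N + psum w z N.
Proof. by rewrite /psum -big_split; apply: eq_bigr => m _; rewrite /rscale scalerDr. Qed.

Lemma psumB u w z N : psum (fun m => u m - w m) z N = psum u z N - psum w z N.
Proof. by rewrite /psum -sumrB; apply: eq_bigr => m _; rewrite /rscale scalerBr. Qed.

Lemma psumMl b u z N : psum (fun m => b * u m) z N = b * psum u z N.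
Proof. by rewrite /psum mulr_sumr; apply: eq_bigr => m _; rewrite rscale_mulr. Qed.

Lemma psumMr b u z N : psum (fun m => u m * b) z N = psum u z N * b.
Proof. by rewrite /psum mulr_suml; apply: eq_bigr => m _; rewrite rscale_mull. Qed.

Lemma psum_sum (J : finType) (u : J -> nat -> A) z N :
  psum (fun m => \sum_j u j m) z N = \sum_j psum (u j) z N.
Proof. by rewrite /psum exchange_big /=; apply: eq_bigr => m _; rewrite /rscale scaler_sumr. Qed.

Lemma psum_adj u z N : psum (fun m => adj (u m)) z N = adj (psum u z N).
Proof. by rewrite /psum adj_sum; apply: eq_bigr => m _; rewrite adj_rscale. Qed.

Lemma eq_psum u w z N : u =1 w -> psum u z N = psum w z N.
Proof. by move=> uw; apply: eq_bigr => m _; rewrite uw. Qed.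

End MatrixSeries.

(** * The flow line defined by the formal solution *)

Section FlowLine.
Variables (R : realType) (d : nat) (T I : finType).
Notation A := 'M[R[i]]_d.
Variables (al : A) (x : T -> A) (e : I -> A) (hdT tlT : T -> I) (y : nat -> T -> A) (M m0 : nat).
Hypothesis al_adj : adj al = al.
Hypothesis e_adj : forall i, adj (e i) = e i.
Hypothesis ex : forall i a, e i * x a = if hdT a == i then x a else 0.
Hypothesis xe : forall i a, x a * e i = if tlT a == i then x a else 0.
Hypothesis al_comm : forall m, graded e m -> al * m = m * al.
Hypothesis al_gr : graded e al.
Hypothesis y0 : forall a, y 0 a = x a.
Hypothesis y_fin : forall m a, (m0 <= m)%N -> y m a = 0.
Hypothesis y_hom : forall m a, homog e hdT tlT a (y m a).
Hypothesis M_gt0 : (0 < M)%N.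
Let H := moment al x.
Hypothesis y_H : forall m a, rscale (m%:R / M%:R) 1 * y m a = y m a * H - H * y m a.

Theorem flow_series : exists (z0 : R) (G : A) (phi : R -> T -> A),
  [/\ 0 < z0, G \in unitmx, graded e G &
      forall a, phi 0 a * G = G * \sum_(0 <= m < m0) rscale (z0 ^+ m) (y m a)] /\
  (forall (t : R) a, t <= 0 -> homog e hdT tlT a (phi t a)) /\
  (forall (t : R) a p q, t <= 0 ->
     is_derive t 1 (fun s : R => complex.Re (phi s a p q))
       (complex.Re ((phi t a * moment al (phi t) - moment al (phi t) * phi t a) p q)) /\
     is_derive t 1 (fun s : R => complex.Im (phi s a p q))
       (complex.Im ((phi t a * moment al (phi t) - moment al (phi t) * phi t a) p q))) /\
  (forall a p q, (complex.Re (phi t a p q) @[t --> -oo] --> complex.Re (x a p q))%classic /\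
                 (complex.Im (phi t a p q) @[t --> -oo] --> complex.Im (x a p q))%classic).
Proof.
have [g [f [h [rho [[rho0 g0 f0 gr gB] [fB hB fg gH hE]]]]]] :=
  formal_flow al_adj e_adj ex xe al_comm al_gr y0 y_fin y_hom M_gt0.
(* Half of [rho] pays for the weights [m / M] of the derived series; a second halving, to [r / 2],
   is the range in which Cauchy products are evaluated. *)
pose r := rho / 2; have r0 : 0 < r by rewrite divr_gt0.
have rrho : 0 <= r <= rho by rewrite ltW //= /r; lra.
pose k : R := M%:R^-1; have k0 : 0 < k by rewrite invr_gt0 ltr0n.
have k1 : 0 <= k <= 1 by rewrite ltW //= invf_le1 ?ltr0n // ler1n.
(* The derivation d/dt on coefficients; [th_conv] is its Leibniz rule. *)
pose th (u : nat -> A) m := rscale (k * m%:R) (u m).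
have bg : nbounded rho g by exact: nbounded_shift gB.
have bf a : nbounded rho (f ^~ a) by exact: nbounded_shift (fB a).
have bh : nbounded rho h by exact: nbounded_shift hB.
have by_ a : nbounded rho (y ^~ a) by apply: nbounded_finite; [exact: ltW | move=> m; exact: y_fin].
have brw (u : nat -> A) : nbounded rho u -> nbounded r u by exact: nbounded_le.
have bth (u : nat -> A) : nbounded rho u -> nbounded r (th u) by apply: nbounded_weight => //; exact: ltW.
have th_conv u w m : th (conv u w) m = conv (th u) w m + conv u (th w) m.
  rewrite /th /conv /rscale scaler_sumr -big_split /=; apply: eq_bigr => i _.
  rewrite -/(rscale _ _) -/(rscale _ (u i)) -/(rscale _ (w _)) rscale_mull rscale_mulr /rscale -scalerDl -rmorphD.
  by rewrite -mulrDr -natrD subnKC // -ltnS.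
pose F z a := mxseries (f ^~ a) z; pose F' z a := mxseries (th (f ^~ a)) z.
pose Gz z := mxseries g z; pose hz z := mxseries h z.
have cv (u : nat -> A) z : 0 <= z <= r / 2 -> nbounded r u -> cvA (\oo%classic) (psum u z) (mxseries u z).
  move=> /andP[z1 z2]; apply: psum_cvg => //; rewrite z1 /=; apply: le_trans z2 _; lra.
have cvc (u w : nat -> A) z : 0 <= z <= r / 2 -> nbounded r u -> nbounded r w ->
    cvA (\oo%classic) (psum (conv u w) z) (mxseries u z * mxseries w z).
  by move=> *; apply: (psum_conv_cvg r0).
(* The coefficients of [g] of positive order have weighted sum at most 1/2, which makes the gauge
   series invertible. *)
have near1 (z : R) : 0 <= z <= r / 2 -> nrm (Gz z - 1) <= 1 / 2.
  move=> zr; have zrho : 0 <= z <= rho by case/andP: zr => -> /=; move: rrho; rewrite /r; lra.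
  apply: (@cvA_nrm_le _ _ _ (\oo%classic) _ (fun N => psum g z N - 1)); last first.
    by apply: cvAB; [apply: cv => //; exact: brw | exact: cvA_cst].
  exists 1 => // -[//|N] _ /=; apply: le_trans (gB N.+1).
  rewrite /psum big_nat_recl //= g0 expr0 rscale1 addrC addKr.
  apply: le_trans (nrm_sum _ _ _) _; rewrite big_add1 /=; apply: ler_sum => m _.
  rewrite nrm_rscale; apply: ler_wpM2r; first exact: nrm_ge0.
  by case/andP: zrho => zz zzr; rewrite ger0_norm ?exprn_ge0 // lerXn2r // nnegrE ltW.
have Gunit z : 0 <= z <= r / 2 -> Gz z \in unitmx.
  by move=> zr; rewrite -[Gz z](subrK 1) addrC; apply: unit_near1; exact: near1.
have FG z a : 0 <= z <= r / 2 -> F z a * Gz z = Gz z * mxseries (y ^~ a) z.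
  move=> zr; apply: (cvA_eq (F := \oo%classic) (cvc _ _ z zr (brw _ (bf a)) (brw _ bg)) (cvc _ _ z zr (brw _ bg) (brw _ (by_ a)))).
  by apply: nearW => N; apply: eq_psum => m; exact: fg.
have G'E z : 0 <= z <= r / 2 -> mxseries (th g) z = Gz z * H - hz z * Gz z.
  move=> zr; apply: (cvA_eq (F := \oo%classic) (cv _ z zr (bth _ bg))
    (cvAB (cvAMr H (cv _ z zr (brw _ bg))) (cvc _ _ z zr (brw _ bh) (brw _ bg)))).
  apply: nearW => N; rewrite -psumMr -psumB; apply: eq_psum => m.
  by rewrite /th rscaleE mulrC gH.
have Y'E z a : 0 <= z <= r / 2 ->
    mxseries (th (y ^~ a)) z = mxseries (y ^~ a) z * H - H * mxseries (y ^~ a) z.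
  move=> zr; apply: (cvA_eq (F := \oo%classic) (cv _ z zr (bth _ (by_ a)))
    (cvAB (cvAMr H (cv _ z zr (brw _ (by_ a)))) (cvAMl H (cv _ z zr (brw _ (by_ a)))))).
  apply: nearW => N; rewrite -psumMr -psumMl -psumB; apply: eq_psum => m.
  by rewrite /th rscaleE mulrC y_H.
have leib z a : 0 <= z <= r / 2 -> F' z a * Gz z + F z a * mxseries (th g) z =
    mxseries (th g) z * mxseries (y ^~ a) z + Gz z * mxseries (th (y ^~ a)) z.
  move=> zr; apply: (cvA_eq (F := \oo%classic)
    (cvAD (cvc _ _ z zr (bth _ (bf a)) (brw _ bg)) (cvc _ _ z zr (brw _ (bf a)) (bth _ bg)))
    (cvAD (cvc _ _ z zr (bth _ bg) (brw _ (by_ a))) (cvc _ _ z zr (brw _ bg) (bth _ (by_ a))))).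
  apply: nearW => N; rewrite -!psumD; apply: eq_psum => m; rewrite -!th_conv /th.
  by congr rscale; exact: fg.
have homF z a : 0 <= z <= r / 2 -> homog e hdT tlT a (F z a).
  move=> zr i; have L := cv _ z zr (brw _ (bf a)); have fh m := (gr m).2 a i.
  have psum0 (u : nat -> A) N : (forall m, u m = 0) -> psum u z N = 0.
    by move=> u0; rewrite /psum big1 // => m _; rewrite u0 /rscale scaler0.
  split.
    apply: (cvA_eq (F := \oo%classic) (v := fun N => if hdT a == i then psum (f ^~ a) z N else 0) (cvAMl (e i) L)).
      by case: ifP => _ //; exact: cvA_cst.
    apply: nearW => N; rewrite -psumMl; case: ifP => hi; [apply: eq_psum | apply: psum0] => m;
      by have [-> _] := fh m; rewrite hi.
  apply: (cvA_eq (F := \oo%classic) (v := fun N => if tlT a == i then psum (f ^~ a) z N else 0) (cvAMr (e i) L)).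
    by case: ifP => _ //; exact: cvA_cst.
  apply: nearW => N; rewrite -psumMr; case: ifP => hi; [apply: eq_psum | apply: psum0] => m;
    by have [_ ->] := fh m; rewrite hi.
have badj (u : nat -> A) : nbounded rho u -> nbounded rho (fun m => adj (u m)).
  by apply: nbounded_ext; [move=> m; rewrite nrm_adj | exact: ltW].
have hzE z : 0 <= z <= r / 2 -> hz z = moment al (F z).
  move=> zr; have ca a : cvA (\oo%classic) (psum (fun m => adj (f m a)) z) (adj (F z a)).
    have L : cvA (\oo%classic) (fun N => adj (psum (f ^~ a) z N)) (adj (F z a)) by exact: cvA_adj (cv _ z zr (brw _ (bf a))).
    by refine (cvA_oo_near (m0 := 0) _ L) => N _; rewrite psum_adj.
  have sa a : mxseries (fun m => adj (f m a)) z = adj (F z a).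
    by apply: cvA_unique (ca a); apply: cv => //; apply: brw; exact: badj.
  apply: (cvA_eq (F := \oo%classic) (v := fun N => psum (fun m => if m == 0 then al else 0) z N +
     rscale (1 / 2) 1 * \sum_a (psum (conv (f ^~ a) (fun i => adj (f i a))) z N
        - psum (conv (fun i => adj (f i a)) (f ^~ a)) z N)) (cv _ z zr (brw _ bh))).
    apply: cvAD; last apply: cvAMl.
      refine (cvA_oo_near (u := fun=> al) (m0 := 1) _ _); last exact: cvA_cst.
      move=> [//|N] _.
      by rewrite /psum big_nat_recl //= expr0 big1 ?addr0 ?rscale1 // => [|m _]; rewrite /rscale ?scale1r ?scaler0.
    apply: cvA_sum => a _; rewrite -sa; apply: cvAB; apply: cvc => //; apply: brw => //; exact: badj.
  apply: nearW => N; under [in RHS]eq_bigr do rewrite -psumB.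
  rewrite -psum_sum -psumMl -psumD; apply: eq_psum => m; rewrite hE /half.
  by congr (_ + _).
have ode z a : 0 <= z <= r / 2 -> F' z a = F z a * moment al (F z) - moment al (F z) * F z a.
  move=> zr; rewrite -hzE //.
  (* The Leibniz rule for [F G = G Y] gives the flow equation multiplied on the right by [Gz z],
     which is invertible. *)
  suff E0 : F' z a * Gz z = (F z a * hz z - hz z * F z a) * Gz z.
    by have := congr1 (fun b => b *m invmx (Gz z)) E0; rewrite /= !mulmxK ?Gunit.
  have L := leib z a zr; rewrite (G'E z zr) (Y'E z a zr) in L; have FGz := FG z a zr.
  apply: (@nc_lincomb _ _ _ ((F' z a * Gz z + F z a * (Gz z * H - hz z * Gz z)
    - ((Gz z * H - hz z * Gz z) * mxseries (y ^~ a) z + Gz z * (mxseries (y ^~ a) z * H - H * mxseries (y ^~ a) z)))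
    - (F z a * Gz z - Gz z * mxseries (y ^~ a) z) * H + hz z * (F z a * Gz z - Gz z * mxseries (y ^~ a) z))).
    by rewrite L FGz !subrr mul0r mulr0 subrr addr0.
  by ncring.
(* Inside the range [r / 2] of the Cauchy products, and strictly below [rho / 4], as
   [pseries_exp_derive] requires. *)
pose z0 := r / 4; have z00 : 0 < z0 by rewrite divr_gt0.
pose zt t := z0 * expR (k * t).
have zt_le1 t : t <= 0 -> z0 * expR (k * t) <= z0.
  move=> t0; rewrite -[leRHS]mulr1; apply: ler_wpM2l; first exact: ltW.
  by rewrite -[leRHS]expR0 ler_expR pmulr_rle0.
have zt_le t : t <= 0 -> 0 <= zt t <= r / 2.
  move=> /zt_le1 t0; apply/andP; split; first by rewrite mulr_ge0 ?expR_ge0 // ltW.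
  by apply: le_trans t0 _; rewrite /z0; lra.
have zt_lt t : t <= 0 -> z0 * expR (k * t) < rho / 4.
  by move=> /zt_le1 t0; apply: le_lt_trans t0 _; rewrite /z0 /r; lra.
have zt0 : zt 0 = z0 by rewrite /zt mulr0 expR0 mulr1.
exists z0, (Gz z0), (fun t => F (zt t)); split; [split => // | split; [|split]].
- by rewrite -zt0; apply: Gunit; exact: zt_le.
- move=> i; have z0r : 0 <= z0 <= r / 2 by rewrite -zt0 zt_le.
  apply: (cvA_eq (F := \oo%classic) (cvAMl (e i) (cv g z0 z0r (brw _ bg))) (cvAMr (e i) (cv g z0 z0r (brw _ bg)))).
  by apply: nearW => N; rewrite -psumMl -psumMr; apply: eq_psum => m; exact: (gr m).1.
- move=> a; have z0r : 0 <= z0 <= r / 2 by rewrite -zt0 zt_le.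
  rewrite zt0 FG //; congr (_ * _); apply: cvA_unique (cv _ z0 z0r (brw _ (by_ a))) _.
  refine (cvA_oo_near (u := fun=> _) (m0 := m0) _ _); last exact: cvA_cst.
  move=> N /= mN.
  rewrite /psum [RHS](big_cat_nat (n := m0)) //= [X in _ = _ + X]big_nat_cond [X in _ = _ + X]big1 ?addr0 // => m.
  by rewrite andbT => /andP[mm _]; rewrite y_fin // /rscale scaler0.
- by move=> t a t0; apply: homF; exact: zt_le.
- move=> t a p q t0; rewrite -ode; last exact: zt_le.
  have [bR bI] := nbounded_entries p q rho0 (bf a).
  have ReE (c : R) (b : A) : complex.Re (rscale c b p q) = c * complex.Re (b p q).
    by rewrite mxE; case: (b p q) => u w /=; ring.
  have ImE (c : R) (b : A) : complex.Im (rscale c b p q) = c * complex.Im (b p q).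
    by rewrite mxE; case: (b p q) => u w /=; ring.
  split.
    have := pseries_exp_derive rho0 bR z00 (zt_lt t t0); rewrite /F /F' !mxE /= /th.
    by congr (is_derive _ _ _ _); [apply/funext => s; rewrite mxE | congr (limn (pseries _ _)); apply/funext => m; rewrite ReE].
  have := pseries_exp_derive rho0 bI z00 (zt_lt t t0); rewrite /F /F' !mxE /= /th.
  by congr (is_derive _ _ _ _); [apply/funext => s; rewrite mxE | congr (limn (pseries _ _)); apply/funext => m; rewrite ImE].
have Fx z a : 0 <= z <= r / 2 -> nrm (F z a - x a) <= z / rho.
  move=> zr; have zrho : 0 <= z <= rho by case/andP: zr => -> /=; move: rrho; rewrite /r; lra.
  have zz := andP zrho; apply: (@cvA_nrm_le _ _ _ (\oo%classic) _ (fun N => psum (f ^~ a) z N - x a)); last first.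
    by apply: cvAB; [apply: cv => //; exact: brw | exact: cvA_cst].
  exists 1 => // -[//|N] _ /=; have zp : 0 <= z / rho by rewrite divr_ge0 ?zz.1 // ltW.
  apply: le_trans (ler_piMr zp (fB a N.+1)).
  rewrite /psum big_nat_recl //= f0 expr0 {1}/rscale scale1r addrC addKr.
  apply: le_trans (nrm_sum _ _ _) _; rewrite big_add1 /= mulr_sumr; apply: ler_sum => m _.
  rewrite nrm_rscale mulrA; apply: ler_wpM2r; first exact: nrm_ge0.
  rewrite ger0_norm ?exprn_ge0 ?zz.1 // !exprS mulrA divfK ?gt_eqF //.
  by rewrite ler_wpM2l ?zz.1 // lerXn2r ?zz.2 ?nnegrE ?zz.1 // ltW.
have lim a (eps : R) : 0 < eps -> (\forall t \near -oo, nrm (F (zt t) a - x a) < eps)%classic.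
  move=> ep; have ep' : 0 < eps * rho / z0 by rewrite divr_gt0 // mulr_gt0.
  have := expR_cvgNy k0 ep'; apply: filterS2 (nbhs_ninfty_le (num_real 0)) => t t0 h1.
  apply: le_lt_trans (Fx _ a (zt_le t t0)) _; rewrite ltr_pdivrMr // /zt mulrC -ltr_pdivlMr //.
move=> a p q; split; apply/cvgrPdist_lt => eps ep; have := lim a eps ep; apply: filterS => t; apply: le_lt_trans.
  apply: le_trans (abs1_Re _ p q); rewrite distrC !mxE le_eqVlt; apply/orP; left; apply/eqP; congr `|_|.
  by case: (x a p q) => ? ? /=.
apply: le_trans (abs1_Im _ p q); rewrite distrC !mxE le_eqVlt; apply/orP; left; apply/eqP; congr `|_|.
by case: (x a p q) => ? ? /=.
Qed.
End FlowLine.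

(** * Representations as graded endomorphisms *)

Lemma adj_mulmx (R : realType) m1 m2 m3 (a : 'M[R[i]]_(m1, m2)) (b : 'M[R[i]]_(m2, m3)) :
  (a *m b)^t* = b^t* *m a^t*.
Proof. by rewrite trmx_mul map_mxM. Qed.

Section Embedding.
Variables (R : realType) (I : finType) (v : I -> nat).
Notation C := R[i].

Definition total_dim := #|{: {i : I & 'I_(v i)}}|.
Notation A := 'M[C]_total_dim.

Definition inj_mx i : 'M[C]_(total_dim, v i) :=
  \matrix_(p, q) (enum_val p == Tagged (fun i => 'I_(v i)) q)%:R.
Definition prj_mx i : 'M[C]_(v i, total_dim) := (inj_mx i)^T.

Lemma prj_mul_entry i w (B : 'M[C]_(total_dim, w)) p q :
  (prj_mx i *m B) p q = B (enum_rank (Tagged (fun i => 'I_(v i)) p)) q.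
Proof.
rewrite mxE (bigD1 (enum_rank (Tagged (fun i => 'I_(v i)) p))) //= !mxE enum_rankK eqxx mul1r.
by rewrite big1 ?addr0 // => r rp; rewrite !mxE -(inj_eq enum_rank_inj) enum_valK (negPf rp) mul0r.
Qed.

Lemma mul_inj_entry i w (B : 'M[C]_(w, total_dim)) p q :
  (B *m inj_mx i) p q = B p (enum_rank (Tagged (fun i => 'I_(v i)) q)).
Proof.
by have := prj_mul_entry (B^T) q p; rewrite -(trmxK (prj_mx i)) -trmx_mul mxE [X in _ = X]mxE trmxK.
Qed.

Lemma inj_mul_entry i p :
  (forall w (m : 'M[C]_(v i, w)) q, (inj_mx i *m m) p q = 0) \/
  (exists p', forall w (m : 'M[C]_(v i, w)) q, (inj_mx i *m m) p q = m p' q).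
Proof.
case E : (enum_val p) => [j p']; have [ji|ji] := eqVneq j i.
  subst j; right; exists p' => w m q; rewrite mxE (bigD1 p') //= mxE E eqxx mul1r.
  rewrite big1 ?addr0 // => r rp; rewrite mxE E; case: eqP => [|_]; last by rewrite mul0r.
  by move/eqP; rewrite -[X in X == _]/(Tagged (fun i => 'I_(v i)) p') eq_Tagged /= eq_sym (negPf rp).
left=> w m q; rewrite mxE big1 // => r _; rewrite mxE E; case: eqP => [h|_]; last by rewrite mul0r.
by move/eqP: ji; case; have := congr1 tag h.
Qed.

Lemma mul_prj_entry i q :
  (forall w (m : 'M[C]_(w, v i)) p, (m *m prj_mx i) p q = 0) \/
  (exists q', forall w (m : 'M[C]_(w, v i)) p, (m *m prj_mx i) p q = m p q').
Proof.
have tr w (m : 'M[C]_(w, v i)) p : (m *m prj_mx i) p q = (inj_mx i *m m^T) q p.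
  by rewrite -[inj_mx i]trmxK -trmx_mul [RHS]mxE.
have [h|[q' h]] := inj_mul_entry i q; [left | right; exists q'] => w m p; rewrite tr h //.
by rewrite mxE.
Qed.

Lemma prj_inj i : prj_mx i *m inj_mx i = 1%:M.
Proof.
apply/matrixP => p q; rewrite prj_mul_entry !mxE enum_rankK eq_Tagged /=.
by [].
Qed.

Lemma prj_inj0 i k : i != k -> prj_mx i *m inj_mx k = 0.
Proof.
move=> ik; apply/matrixP => p q; rewrite prj_mul_entry !mxE enum_rankK.
case: eqP => // h; have := congr1 tag h => /= e; by rewrite e eqxx in ik.
Qed.

Lemma inj_prj_sum : \sum_i inj_mx i *m prj_mx i = 1%:M :> A.
Proof.
apply/matrixP => p q; rewrite summxE.
pose F (t : {i : I & 'I_(v i)}) : C := (enum_val p == t)%:R * (enum_val q == t)%:R.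
have -> : \sum_i (inj_mx i *m prj_mx i) p q = \sum_t F t.
  rewrite (eq_bigr (fun i => \sum_(r : 'I_(v i)) F (Tagged (fun i => 'I_(v i)) r))); last first.
    by move=> i _; rewrite mxE; apply: eq_bigr => r _; rewrite !mxE.
  rewrite (sig_big_dep xpredT (fun _ _ => true) (fun i (r : 'I_(v i)) => F (Tagged (fun i => 'I_(v i)) r))) /=.
  by apply: eq_bigr => -[].
rewrite (bigD1 (enum_val p)) //= big1 ?addr0; last first.
  by move=> t tp; rewrite /F eq_sym (negPf tp) mul0r.
by rewrite /F eqxx mul1r mxE (inj_eq enum_val_inj) eq_sym.
Qed.

Lemma inj_adj i : (inj_mx i)^t* = prj_mx i.
Proof. by apply/matrixP => p q; rewrite !mxE; case: eqP => _; rewrite ?rmorph0 ?rmorph1. Qed.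

Lemma prj_adj i : (prj_mx i)^t* = inj_mx i.
Proof. by rewrite -inj_adj trmxCK. Qed.

Definition vproj i : A := inj_mx i *m prj_mx i.

Definition gmx (g : forall i, 'M[C]_(v i)) : A := \sum_i inj_mx i *m g i *m prj_mx i.

Definition block (b : A) i : 'M[C]_(v i) := prj_mx i *m b *m inj_mx i.

Lemma vproj_adj i : adj (vproj i) = vproj i.
Proof. by rewrite /adj /vproj adj_mulmx inj_adj prj_adj. Qed.

Lemma vproj_sum : \sum_i vproj i = 1.
Proof. exact: inj_prj_sum. Qed.

Lemma vproj_inj i k : vproj i *m inj_mx k = if i == k then inj_mx k else 0.
Proof.
rewrite /vproj -mulmxA; case: eqVneq => [->|ik]; first by rewrite prj_inj mulmx1.
by rewrite prj_inj0 ?mulmx0.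
Qed.

Lemma prj_vproj i k : prj_mx k *m vproj i = if i == k then prj_mx k else 0.
Proof.
rewrite /vproj mulmxA; case: eqVneq => [->|ik]; first by rewrite prj_inj mul1mx.
by rewrite prj_inj0 ?mul0mx // eq_sym.
Qed.

Lemma gmx_inj g i : gmx g *m inj_mx i = inj_mx i *m g i.
Proof.
rewrite /gmx mulmx_suml (bigD1 i) //= -mulmxA prj_inj mulmx1 big1 ?addr0 // => k ki.
by rewrite -mulmxA prj_inj0 // mulmx0.
Qed.

Lemma prj_gmx g i : prj_mx i *m gmx g = g i *m prj_mx i.
Proof.
rewrite /gmx mulmx_sumr (bigD1 i) //= !mulmxA prj_inj mul1mx big1 ?addr0 // => k ki.
by rewrite !mulmxA prj_inj0 ?mul0mx // eq_sym.
Qed.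

Lemma blockK g i : block (gmx g) i = g i.
Proof. by rewrite /block -mulmxA gmx_inj mulmxA prj_inj mul1mx. Qed.

Lemma gmxM g h : gmx g * gmx h = gmx (fun i => g i *m h i).
Proof.
rewrite {2}/gmx mulr_sumr; apply: eq_bigr => i _.
by rewrite -[LHS]/(gmx g *m _) !mulmxA gmx_inj.
Qed.

Lemma gmx1 : gmx (fun=> 1%:M) = 1.
Proof. by rewrite -vproj_sum; apply: eq_bigr => i _; rewrite mulmx1. Qed.

Lemma gmx_graded g : graded vproj (gmx g).
Proof.
move=> i; change (vproj i *m gmx g = gmx g *m vproj i).
by rewrite /vproj -mulmxA prj_gmx [in RHS]mulmxA gmx_inj !mulmxA.
Qed.

Lemma graded_gmx b : graded vproj b -> gmx (block b) = b.
Proof.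
move=> gb; rewrite -[RHS]mul1r -vproj_sum mulr_suml; apply: eq_bigr => i _.
have vv : vproj i * vproj i = vproj i by change (vproj i *m (inj_mx i *m prj_mx i) = vproj i); rewrite mulmxA vproj_inj eqxx.
rewrite -[X in _ = X * _]vv -mulrA gb.
change (inj_mx i *m block b i *m prj_mx i = vproj i *m (b *m vproj i)).
by rewrite /block /vproj !mulmxA.
Qed.

Lemma block_mulmx a b i : graded vproj a -> block (a * b) i = block a i *m block b i.
Proof.
move=> ga; have E : block a i *m prj_mx i = prj_mx i *m a.
  by rewrite -[in RHS](graded_gmx ga) prj_gmx.
by rewrite [in RHS]/block !mulmxA -/(block a i) E /block -[a * b]/(a *m b) !mulmxA.
Qed.

Lemma rtr_vproj b i : rtr (vproj i * b) = complex.Re (\tr (block b i)).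
Proof. by rewrite /rtr; congr complex.Re; rewrite -[vproj i * b]/(inj_mx i *m prj_mx i *m b) -mulmxA mxtrace_mulC. Qed.

End Embedding.

(** * Representations as families of homogeneous matrices *)

Section RepEmbedding.
Variables (R : realType) (Q : quiver) (v : vert Q -> nat).
Notation C := R[i].
Notation A := 'M[C]_(total_dim v).
Notation e := (vproj R v).

Definition rmx (a : edge Q) (m : 'M[C]_(v (hd a), v (tl a))) : A :=
  inj_mx R v (hd a) *m m *m prj_mx R v (tl a).

Definition unrmx (a : edge Q) (b : A) : 'M[C]_(v (hd a), v (tl a)) :=
  prj_mx R v (hd a) *m b *m inj_mx R v (tl a).

Lemma rmxK a m : unrmx a (rmx m) = m.
Proof. by rewrite /unrmx /rmx !mulmxA prj_inj mul1mx -mulmxA prj_inj mulmx1. Qed.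

Lemma rmx_homog a (m : 'M[C]_(v (hd a), v (tl a))) : homog e (@hd Q) (@tl Q) a (rmx m).
Proof.
move=> i; split; [change (e i *m rmx m = if hd a == i then rmx m else 0) | change (rmx m *m e i = if tl a == i then rmx m else 0)].
  by rewrite /rmx !mulmxA vproj_inj eq_sym; case: eqP => // _; rewrite !mul0mx.
by rewrite /rmx -mulmxA prj_vproj eq_sym; case: eqP => // _; rewrite mulmx0.
Qed.

Lemma homog_rmx a b : homog e (@hd Q) (@tl Q) a b -> rmx (unrmx a b) = b.
Proof.
move=> hb; rewrite /rmx /unrmx !mulmxA -/(vproj R v _) -mulmxA -/(vproj R v _).
have [h1 _] := hb (hd a); have [_ h2] := hb (tl a).
by rewrite eqxx in h1; rewrite eqxx in h2; rewrite -[e _ *m b]/(e _ * b) h1 -[RHS]h2.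
Qed.

(** The position [p'], [q'] does not depend on [m], so that derivatives and limits of the entries of
    a curve [m] carry over to [rmx m]. *)
Lemma rmx_entry a p q : (forall m, @rmx a m p q = 0) \/ (exists p' q', forall m, @rmx a m p q = m p' q').
Proof.
rewrite /rmx; have [h|[p' h]] := inj_mul_entry R (v := v) (hd a) p.
  by left=> m; rewrite -mulmxA h.
have [h'|[q' h']] := mul_prj_entry R (v := v) (tl a) q.
  by left=> m; rewrite -mulmxA h h'.
by right; exists p', q' => m; rewrite -mulmxA h h'.
Qed.

Lemma unrmx_entry a p q : exists p' q', forall b, unrmx a b p q = b p' q'.
Proof.
exists (enum_rank (Tagged (fun i => 'I_(v i)) p)), (enum_rank (Tagged (fun i => 'I_(v i)) q)) => b.
by rewrite /unrmx mul_inj_entry prj_mul_entry.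
Qed.

Lemma gmx_rmx g a m : gmx g * rmx m = @rmx a (g (hd a) *m m).
Proof. by change (gmx g *m rmx m = @rmx a (g (hd a) *m m)); rewrite /rmx !mulmxA gmx_inj. Qed.

Lemma rmx_gmx g a m : rmx m * gmx g = @rmx a (m *m g (tl a)).
Proof.
change (rmx m *m gmx g = @rmx a (m *m g (tl a))).
by rewrite /rmx -mulmxA prj_gmx !mulmxA.
Qed.

Lemma adj_rmx a (m : 'M[C]_(v (hd a), v (tl a))) :
  adj (rmx m) = inj_mx R v (tl a) *m m^t* *m prj_mx R v (hd a).
Proof. by rewrite /adj /rmx !adj_mulmx prj_adj inj_adj mulmxA. Qed.

Variable alpha : vert Q -> int.

Definition stab_mx : A := \sum_i rscale (alpha i)%:~R (e i).

Lemma stab_mx_gmx : stab_mx = gmx (fun i => ((alpha i)%:~R : C)%:M).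
Proof.
apply: eq_bigr => i _; rewrite mul_mx_scalar -scalemxAl /rscale; congr (_ *: _).
by rewrite rmorph_int.
Qed.

Lemma stab_mx_adj : adj stab_mx = stab_mx.
Proof. by rewrite /stab_mx adj_sum; apply: eq_bigr => i _; rewrite adj_rscale vproj_adj. Qed.

Lemma stab_mx_graded : graded e stab_mx.
Proof. by rewrite stab_mx_gmx; exact: gmx_graded. Qed.

Lemma stab_mx_comm b : graded e b -> stab_mx * b = b * stab_mx.
Proof.
move=> gb; rewrite /stab_mx mulr_suml mulr_sumr; apply: eq_bigr => i _.
by rewrite rscale_mull rscale_mulr gb.
Qed.

Lemma conform_inj i k (B : 'M[C]_(v k)) : k = i ->
  inj_mx R v i *m conform_mx 0 B *m prj_mx R v i = inj_mx R v k *m B *m prj_mx R v k.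
Proof. by move=> ki; subst k; rewrite conform_mx_id. Qed.

(** Grouping the edges by heads and by tails gives the two sums in [mu]. The factor [i] turns the
    coefficient [1 / (2 i)] into [1 / 2], and the central part [- i alpha] into [alpha]. *)
Lemma moment_rmx (z : Rep R v) :
  moment stab_mx (fun a => rmx (z a)) = gmx (fun i => 'i%C *: mu_sub alpha z i).
Proof.
rewrite /moment stab_mx_gmx /mu_sub /central.
pose B1 i := \sum_(a | hd a == i) conform_mx (0 : 'M[C]_(v i)) (z a *m (z a)^t*).
pose B2 i := \sum_(a | tl a == i) conform_mx (0 : 'M[C]_(v i)) ((z a)^t* *m z a).
have E1 : \sum_a rmx (z a) * adj (rmx (z a)) = gmx B1.
  rewrite (partition_big (@hd Q) xpredT) //=; apply: eq_bigr => i _.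
  rewrite /B1 mulmx_sumr mulmx_suml; apply: eq_bigr => a /eqP ai; rewrite conform_inj //.
  rewrite adj_rmx; change (rmx (z a) *m (inj_mx R v (tl a) *m (z a)^t* *m prj_mx R v (hd a)) =
    inj_mx R v (hd a) *m (z a *m (z a)^t*) *m prj_mx R v (hd a)).
  by rewrite /rmx !mulmxA -[_ *m prj_mx R v (tl a) *m _]mulmxA prj_inj mulmx1.
have E2 : \sum_a adj (rmx (z a)) * rmx (z a) = gmx B2.
  rewrite (partition_big (@tl Q) xpredT) //=; apply: eq_bigr => i _.
  rewrite /B2 mulmx_sumr mulmx_suml; apply: eq_bigr => a /eqP ai; rewrite conform_inj //.
  rewrite adj_rmx; change (inj_mx R v (tl a) *m (z a)^t* *m prj_mx R v (hd a) *m rmx (z a) =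
    inj_mx R v (tl a) *m ((z a)^t* *m z a) *m prj_mx R v (tl a)).
  by rewrite /rmx !mulmxA -[_ *m prj_mx R v (hd a) *m _]mulmxA prj_inj mulmx1.
rewrite sumrB E1 E2 -rscaleE /gmx -sumrB /rscale scaler_sumr -big_split /=; apply: eq_bigr => i _.
rewrite /mu -/(B1 i) -/(B2 i) -mulmxBl -mulmxBr scalemxAl scalemxAr -mulmxDl -mulmxDr.
have i2 : 'i%C * 'i%C = -1 :> C by apply/eqP; rewrite eq_complex /= !mul0r !mulr1 !mul1r sub0r addr0 oppr0 !eqxx.
have i0 : 'i%C != 0 :> C by rewrite eq_complex /= oner_eq0 andbF.
have iE : 'i%C *: ('i%C * (alpha i)%:~R)%:M = - ((alpha i)%:~R : C)%:M :> 'M_(v i).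
  by apply/matrixP => p q; rewrite !mxE -mulrnAr mulrA i2 mulN1r.
congr (_ *m _ *m _); rewrite [RHS]scalerBr iE opprK [RHS]addrC [in RHS]scalerA; congr (_ + _ *: _).
by rewrite invfM mulrCA mulfV // mulr1 rmorphM rmorph1 mul1r fmorphV rmorph_nat.
Qed.

End RepEmbedding.

(** * Spectral projections of a critical point *)

Section SpectralProjections.
Variables (R : realType) (d n : nat).
Notation C := R[i].
Notation A := 'M[C]_d.
Implicit Types (a b H W : A) (c : C).

Lemma scale_mull c a b : (c *: a) * b = c *: (a * b).
Proof. by rewrite -[LHS]/(_ *m _) -scalemxAl. Qed.

Lemma scale_mulr c a b : a * (c *: b) = c *: (a * b).
Proof. by rewrite -[LHS]/(_ *m _) -scalemxAr. Qed.

Lemma adj_scale c a : adj (c *: a) = c^* *: adj a.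
Proof. by apply/matrixP => p q; rewrite !mxE rmorphM. Qed.

Lemma hermitian_eigen_real H W c : adj H = H -> W != 0 -> H * W = c *: W -> c = (complex.Re c)%:C%C.
Proof.
move=> Ha W0 HW; have E : (c - c^*) *: (adj W * W) = 0.
  rewrite scalerBl; apply/eqP; rewrite subr_eq0 -scale_mulr -HW -scale_mull -adj_scale -HW adjM Ha.
  by rewrite mulrA.
have WW : adj W * W != 0.
  by apply: contra W0 => /eqP h; apply/eqP; apply: sqn_eq0; rewrite /sqn h rtr0.
move/eqP: E; rewrite scaler_eq0 (negPf WW) orbF subr_eq0 => /eqP.
case: c {HW} => u w /= [h]; congr (_ +i* _)%C; lra.
Qed.

Variables (H : A) (pi : 'I_n -> A) (lam : 'I_n -> R).
Hypothesis H_adj : adj H = H.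
Hypothesis H_pi : forall k, H * pi k = rscale (lam k) (pi k).
Hypothesis pi_sum : \sum_k pi k = 1.
Hypothesis lam_inj : injective lam.

Lemma eigen_orth k (W : A) l : H * W = rscale (lam l) W -> k != l -> adj (pi k) * W = 0.
Proof.
move=> HW kl; have h : adj (pi k) * H = rscale (lam k) (adj (pi k)).
  by rewrite -adj_rscale -H_pi adjM H_adj.
have E : rscale (lam k - lam l) (adj (pi k) * W) = 0.
  rewrite rscaleE rscaleD rscaleN mulrDl mulNr -!rscaleE -rscale_mull -h -mulrA HW.
  by rewrite rscale_mulr subrr.
move/eqP: E; rewrite /rscale scaler_eq0 => /orP[/eqP[] /eqP|/eqP//].
by rewrite subr_eq0 => /eqP /lam_inj h'; rewrite h' eqxx in kl.
Qed.

(** Of [1 = \sum_l adj (pi l)] only the term [l = k] survives on [W], as eigenvectors for different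
    eigenvalues are orthogonal. *)
Lemma spectral_fix k (W : A) : H * W = rscale (lam k) W -> adj (pi k) * W = W.
Proof.
move=> HW; rewrite -[RHS]mul1r -[in RHS]adj1 -pi_sum adj_sum mulr_suml (bigD1 k) //= big1 ?addr0 // => l lk.
exact: eigen_orth HW lk.
Qed.

(** By [spectral_fix], [pi k] equals [adj (pi k) * pi k]. *)
Lemma spectral_adj k : adj (pi k) = pi k.
Proof.
have f := spectral_fix (H_pi k).
by rewrite -[X in adj X = _]f adjM adjK f.
Qed.

Lemma spectral_mul k l : pi k * pi l = if k == l then pi k else 0.
Proof.
case: eqVneq => [<-|kl]; first by rewrite -{1}spectral_adj spectral_fix.
by rewrite -{1}spectral_adj (eigen_orth (H_pi l)).
Qed.

Lemma spectral_sum : H = \sum_k rscale (lam k) (pi k).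
Proof. by rewrite -[LHS]mulr1 -pi_sum mulr_sumr; apply: eq_bigr. Qed.

Lemma spectral_comm m k : H * m = m * H -> pi k * m = m * pi k.
Proof.
move=> Hm; have off (i j : 'I_n) : i != j -> pi i * m * pi j = 0.
  move=> ij; rewrite -[X in X * _ * _]spectral_adj -mulrA; apply: eigen_orth ij.
  by rewrite mulrA Hm -mulrA H_pi rscale_mulr.
rewrite -[LHS]mulr1 -[RHS]mul1r -pi_sum mulr_sumr mulr_suml.
rewrite (bigD1 k) //= big1 ?addr0 => [|l lk]; last by apply: off; rewrite eq_sym.
by rewrite (bigD1 k) //= big1 ?addr0 ?mulrA // => l lk; rewrite mulrA; exact: off.
Qed.
End SpectralProjections.

(** With [B] the matrix of a basis of [U] and [D] that of the coordinates of the values of [p], one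
    has [p = B *m D] and [D *m B = 1]; the trace is cyclic. *)
Lemma mxtrace_idem_dim (F : fieldType) m (U : {vspace 'cV[F]_m}) (p : 'M[F]_m) :
  (forall w : 'cV_m, p *m w \in U) -> (forall w, w \in U -> p *m w = w) -> \tr p = (\dim U)%:R.
Proof.
move=> pU Up; pose b := vbasis U.
pose B : 'M[F]_(m, \dim U) := \matrix_(i, j) (b`_j) i 0.
pose D : 'M[F]_(\dim U, m) := \matrix_(j, i) coord b j (p *m delta_mx i 0).
have colB j : col j B = b`_j by apply/matrixP => i k; rewrite !mxE ord1.
have BD : p = B *m D.
  apply/matrixP => i q; have := coord_vbasis (pU (delta_mx q 0)).
  move/(congr1 (fun w : 'cV_m => w i 0)); rewrite summxE -colE [X in X = _ -> _]mxE => ->.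
  by rewrite mxE; apply: eq_bigr => j _; rewrite !mxE mulrC -colE.
have DB : D *m B = 1%:M.
  apply/matrixP => i j; rewrite mxE.
  transitivity (coord b i (p *m b`_j)).
    rewrite [in RHS](_ : b`_j = \sum_q b`_j q 0 *: delta_mx q 0); last first.
      apply/matrixP => r s; rewrite ord1 summxE (bigD1 r) //= !mxE !eqxx mulr1 big1 ?addr0 // => t tr.
      by rewrite !mxE eq_sym (negPf tr) mulr0.
    rewrite mulmx_sumr linear_sum; apply: eq_bigr => q _; rewrite !mxE -scalemxAr linearZ /= mulrC.
    by [].
  have bj : b`_j \in U by apply: vbasis_mem; rewrite mem_nth // size_tuple.
  have fb : free b := basis_free (vbasisP U).
  by rewrite Up // mxE coord_free // eq_sym.
by rewrite BD mxtrace_mulC DB mxtrace1.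
Qed.

Lemma dimvec_sub_qrep (Q : quiver) (F : fieldType) (M : qrep Q F) (N : subrep M) i :
  dimvec (sub_qrep N) i = \dim (N i).
Proof. by rewrite /dimvec dimvf. Qed.

Lemma dim_subrep_in (Q : quiver) (F : fieldType) (M : qrep Q F) (N N' : subrep M) i :
  (N' i <= N i)%VS -> \dim (subrep_in N N' i) = \dim (N' i).
Proof.
move=> NN; rewrite /= ; set f := linfun _.
have fE u : f u = vsval u by rewrite lfunE.
have inj_f : lker f == 0%VS.
  by apply/lker0P => u w; rewrite !fE; exact: subvs_inj.
rewrite -(limg_dim_eq (f := f)); last by rewrite (eqP inj_f) capv0.
congr (\dim _); apply/vspaceP => w; apply/idP/idP.
  by case/memv_imgP => u; rewrite -memv_preim => uN ->.
move=> wN; apply/memv_imgP; exists (vsproj (N i) w).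
  by rewrite -memv_preim fE vsprojK // (subvP NN).
by rewrite fE vsprojK // (subvP NN).
Qed.

Section CriticalProjections.
Variables (R : realType) (Q : quiver) (v : vert Q -> nat) (alpha : vert Q -> int).
Notation C := R[i].
Variables (x : Rep R v) (n : nat) (X : 'I_n -> subrep (qrep_of x)).
Let h i : 'M[C]_(v i) := 'i%C *: mu_sub alpha x i.
Let H := gmx h.

Lemma critical_comm : critical alpha x -> forall a, H * rmx (x a) = rmx (x a) * H.
Proof.
move=> crit a; rewrite /H gmx_rmx rmx_gmx; congr rmx; rewrite /h -scalemxAl -scalemxAr.
by congr (_ *: _); apply/eqP; rewrite -subr_eq0; apply/eqP; exact: crit.
Qed.

Lemma hermitian_gmx : adj H = H.
Proof.
rewrite /H -moment_rmx; apply: H_adj; exact: stab_mx_adj.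
Qed.

Lemma critical_projections : critical alpha x -> critical_decomposition alpha X ->
  exists (p : 'I_n -> forall i, 'M[C]_(v i)) (lam : 'I_n -> R),
    [/\ forall k l, gmx (p k) * gmx (p l) = if k == l then gmx (p k) else 0,
        \sum_k gmx (p k) = 1, forall k, gmx (p k) != 0 &
        H = \sum_k rscale (lam k) (gmx (p k))] /\
    (forall k a, gmx (p k) * rmx (x a) = rmx (x a) * gmx (p k)) /\
    (forall k i w, (w \in X k i) = (p k i *m w == w)).
Proof.
move=> crit [lam [lam_inj XE X0 Xsum]].
have memX k i (w : 'cV_(v i)) : (w \in X k i) = (h i *m w == lam k *: w).
  rewrite XE /passmx.leigenspace memv_ker add_lfunE opp_lfunE scale_lfunE id_lfunE lfunE /=.
  by rewrite subr_eq0.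
have ex_w i (q : 'I_(v i)) : exists w : 'I_n -> 'cV[C]_(v i),
    (forall k, w k \in X k i) /\ delta_mx q 0 = \sum_k w k.
  have := memvf (delta_mx q 0 : 'cV[C]_(v i)); rewrite -(Xsum i) => /memv_sumP[w wX wE].
  by exists w; split=> // k; exact: wX.
have [w wP] : exists w : forall i (q : 'I_(v i)), 'I_n -> 'cV[C]_(v i),
    forall i q, (forall k, w i q k \in X k i) /\ delta_mx q 0 = \sum_k w i q k.
  by exists (fun i q => sval (cid (ex_w i q))) => i q; exact: (svalP (cid (ex_w i q))).
(* The columns are components of the basis vectors, chosen without knowing uniqueness; that [p k] is
   the orthogonal projection onto [X k] follows afterwards from the spectral lemmas. *)
pose p k i : 'M[C]_(v i) := \matrix_(r, q) w i q k r 0.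
have p_sum i : \sum_k p k i = 1%:M.
  apply/matrixP => r q; rewrite summxE; have [_ /matrixP/(_ r 0)] := wP i q.
  by rewrite !mxE eqxx andbT summxE => ->; apply: eq_bigr => k _; rewrite mxE.
have hp k i : h i *m p k i = lam k *: p k i.
  apply/matrixP => r q; have [/(_ k) wX _] := wP i q; move: wX; rewrite memX => /eqP/matrixP/(_ r 0).
  by rewrite !mxE => <-; apply: eq_bigr => s _; rewrite !mxE.
have pi_sum : \sum_k gmx (p k) = 1.
  rewrite /gmx exchange_big /= -vproj_sum; apply: eq_bigr => i _.
  by rewrite -mulmx_suml -mulmx_sumr p_sum mulmx1.
(* Multiplication by a row of ones turns an eigenvector into a square matrix with the same entries
   in each column, to which the spectral lemmas apply. *)
pose ones : 'rV[C]_(total_dim v) := const_mx 1.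
have lift_col i (c : 'cV[C]_(v i)) (k : 'I_n) : c \in X k i ->
    H * (inj_mx R v i *m c *m ones) = lam k *: (inj_mx R v i *m c *m ones).
  rewrite memX => /eqP cE; change (H *m (inj_mx R v i *m c *m ones) = lam k *: (inj_mx R v i *m c *m ones)).
  by rewrite !mulmxA gmx_inj -[inj_mx R v i *m h i *m c]mulmxA cE -scalemxAr -scalemxAl.
have lift_neq0 i (c : 'cV[C]_(v i)) : c != 0 -> inj_mx R v i *m c *m ones != 0.
  apply: contra => /eqP E; apply/eqP/matrixP => r s; rewrite ord1 !mxE.
  have := congr1 (fun m => (prj_mx R v i *m m) r (enum_rank (Tagged (fun i => 'I_(v i)) r))) E.
  by rewrite !mulmxA prj_inj mul1mx mulmx0 !mxE big_ord1 mxE mulr1.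
have lam_real k : lam k = (complex.Re (lam k))%:C%C.
  have [i Xi] := X0 k; have Xp := memv_pick (X k i).
  have W0 : vpick (X k i) != 0 by rewrite vpick0.
  exact: (hermitian_eigen_real hermitian_gmx (lift_neq0 _ _ W0) (lift_col _ _ _ Xp)).
pose lamR k := complex.Re (lam k).
have lamR_inj : injective lamR.
  by move=> k l kl; apply: lam_inj; rewrite lam_real (lam_real l) -/(lamR k) kl.
have H_pi k : H * gmx (p k) = rscale (lamR k) (gmx (p k)).
  rewrite /H gmxM /rscale -lam_real /gmx scaler_sumr; apply: eq_bigr => i _.
  by rewrite hp -scalemxAr -scalemxAl.
have fixX k i (c : 'cV_(v i)) : c \in X k i -> p k i *m c = c.
  move=> cX; have := lift_col _ _ _ cX; rewrite lam_real => HW.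
  have := spectral_fix hermitian_gmx H_pi pi_sum lamR_inj HW.
  rewrite (spectral_adj hermitian_gmx H_pi pi_sum lamR_inj) => E.
  have {E} : gmx (p k) *m (inj_mx R v i *m c *m ones) = inj_mx R v i *m c *m ones by exact: E.
  rewrite !mulmxA gmx_inj => E; apply/matrixP => r s; rewrite ord1.
  have := congr1 (fun m => (prj_mx R v i *m m) r (enum_rank (Tagged (fun i => 'I_(v i)) r))) E.
  by rewrite /= !mulmxA prj_inj !mul1mx [LHS]mxE big_ord1 [ones _ _]mxE mulr1 => ->; rewrite mxE big_ord1 mxE mulr1.
exists p, lamR; split; first split => //.
- exact: (spectral_mul hermitian_gmx H_pi pi_sum lamR_inj).
- move=> k; have [i Xi] := X0 k; have Xp := memv_pick (X k i).
  apply: contra Xi => /eqP p0; rewrite -vpick0 -(fixX _ _ _ Xp) -(blockK (p k) i) p0.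
  by rewrite /block mulmx0 mul0mx mul0mx.
- exact: (spectral_sum H_pi pi_sum).
split=> [k a|k i c].
  exact: (spectral_comm hermitian_gmx H_pi pi_sum lamR_inj k (critical_comm crit a)).
apply/idP/eqP => [/fixX //|<-]; rewrite memX mulmxA hp -scalemxAl; exact: eqxx.
Qed.
End CriticalProjections.

(** * Slopes as traces *)

Section GradedTrace.
Variables (R : realType) (Q : quiver) (v : vert Q -> nat) (alpha : vert Q -> int).
Notation C := R[i].
Notation A := 'M[C]_(total_dim v).
Notation e := (vproj R v).
Variables (s : A) (U : forall i, {vspace 'cV[C]_(v i)}).
Hypothesis sU : forall i (w : 'cV_(v i)), block s i *m w \in U i.
Hypothesis Us : forall i (w : 'cV_(v i)), w \in U i -> block s i *m w = w.

Lemma rtr_vproj_dim i : rtr (e i * s) = (\dim (U i))%:R.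
Proof.
rewrite rtr_vproj (mxtrace_idem_dim (@sU i) (@Us i)); elim: (\dim _) => // m IH.
by rewrite -!natr1 -IH; case: (m%:R : C).
Qed.

Lemma rtr_dim : rtr s = (\sum_i \dim (U i))%:R.
Proof.
by rewrite -[s in LHS]mul1r -vproj_sum mulr_suml rtr_sum natr_sum; apply: eq_bigr => i _; exact: rtr_vproj_dim.
Qed.

Lemma rtr_stab_dim : rtr (stab_mx R v alpha * s) = (\sum_i alpha i * (\dim (U i))%:Z)%:~R.
Proof.
rewrite /stab_mx mulr_suml rtr_sum rmorph_sum; apply: eq_bigr => i _ /=.
by rewrite rscale_mull rtr_rscale rtr_vproj_dim intrM.
Qed.
End GradedTrace.

Lemma ratr_slope (R : realType) (Q : quiver) (alpha : vert Q -> int) (F : fieldType) (M : qrep Q F) :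
  ratr (slope alpha M) = (\sum_i alpha i * (dimvec M i)%:Z)%:~R / (\sum_i dimvec M i)%N%:R :> R.
Proof. by rewrite /slope fmorph_div rmorph_int rmorph_nat. Qed.

Section Stability.
Variables (R : realType) (Q : quiver) (v : vert Q -> nat) (alpha : vert Q -> int).
Notation C := R[i].
Notation A := 'M[C]_(total_dim v).
Notation e := (vproj R v).
Notation al := (stab_mx R v alpha).
Variables (x : Rep R v) (n : nat) (X : 'I_n -> subrep (qrep_of x)).
Variables (p : 'I_n -> forall i, 'M[C]_(v i)) (lam : 'I_n -> R).
Notation pi k := (gmx (p k)).
Hypothesis piM : forall k l, pi k * pi l = if k == l then pi k else 0.
Hypothesis pi_neq0 : forall k, pi k != 0.
Hypothesis momentE : moment al (fun a => rmx (x a)) = \sum_k rscale (lam k) (pi k).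
Hypothesis pi_x : forall k a, pi k * rmx (x a) = rmx (x a) * pi k.
Hypothesis memX : forall k i w, (w \in X k i) = (p k i *m w == w).

Lemma p_idem k i : p k i *m p k i = p k i.
Proof.
have := piM k k; rewrite eqxx gmxM => E.
by rewrite -[LHS](blockK (fun i => p k i *m p k i)) E blockK.
Qed.

Lemma p_mem k i (w : 'cV_(v i)) : p k i *m w \in X k i.
Proof. by rewrite memX mulmxA p_idem. Qed.

Lemma p_fix k i (w : 'cV_(v i)) : w \in X k i -> p k i *m w = w.
Proof. by rewrite memX => /eqP. Qed.

Lemma pi_block_mem k i (w : 'cV_(v i)) : block (pi k) i *m w \in X k i.
Proof. by rewrite blockK p_mem. Qed.

Lemma pi_block_fix k i (w : 'cV_(v i)) : w \in X k i -> block (pi k) i *m w = w.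
Proof. by rewrite blockK; exact: p_fix. Qed.

Lemma rtr_pi k : rtr (pi k) = (\sum_i \dim (X k i))%:R.
Proof. exact: rtr_dim (pi_block_mem k) (@pi_block_fix k). Qed.

Lemma dim_X_gt0 k : (0 < \sum_i \dim (X k i))%N.
Proof.
rewrite lt0n; apply: contra (pi_neq0 k) => /eqP d0; apply/eqP; apply: idem_rtr0; first by have := piM k k; rewrite eqxx.
by rewrite rtr_pi d0.
Qed.

(** The commutators in [moment] have trace 0 against [pi k], which commutes with [x]; so [al] and
    [moment] have the same trace there. *)
Lemma rtr_stab_pi k : rtr (al * pi k) = lam k * rtr (pi k).
Proof.
have E : rtr (moment al (fun a => rmx (x a)) * pi k) = lam k * rtr (pi k).
  rewrite momentE mulr_suml rtr_sum (bigD1 k) //= rscale_mull piM eqxx rtr_rscale.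
  by rewrite big1 ?addr0 // => l lk; rewrite rscale_mull piM (negPf lk) /rscale scaler0 rtr0.
rewrite -{}E /moment mulrDl rtrD -rscaleE rscale_mull rtr_rscale mulr_suml rtr_sum big1 ?mulr0 ?addr0 //.
move=> a _; rewrite mulrBl rtrB; apply/eqP; rewrite subr_eq0; apply/eqP.
by rewrite -mulrA rtrC -!mulrA pi_x.
Qed.

Lemma slope_lam k : ratr (slope alpha (sub_qrep (X k))) = lam k.
Proof.
have w0 : (\sum_i \dim (X k i))%:R != 0 :> R by rewrite pnatr_eq0 -lt0n dim_X_gt0.
have dE i : dimvec (sub_qrep (X k)) i = \dim (X k i) by exact: dimvec_sub_qrep.
rewrite ratr_slope (eq_bigr _ (fun i _ => dE i)) (eq_bigr (fun i => alpha i * (\dim (X k i))%:Z)); last by move=> i _; rewrite dE.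
rewrite -(rtr_stab_dim alpha (pi_block_mem k) (@pi_block_fix k)) rtr_stab_pi rtr_pi.
by rewrite mulfK.
Qed.

Lemma stable_trace k (s : A) : stable alpha (sub_qrep (X k)) -> s * s = s -> pi k * s = s ->
  (forall a, rmx (x a) * s = s * rmx (x a) * s) -> (forall i, e i * s = s * e i * s) ->
  s != 0 -> s * pi k != pi k -> rtr ((al - rscale (lam k) 1) * s) < 0.
Proof.
move=> [_ stab] ss ps xs es s0 sp.
have [t tE] : exists t : forall i, 'M[C]_(v i), forall i, t i = block s i by exists (block s).
have es' i : prj_mx R v i *m s = t i *m prj_mx R v i *m s.
  have h1 : prj_mx R v i *m (e i *m s) = prj_mx R v i *m s by rewrite mulmxA prj_vproj eqxx.
  have h2 : prj_mx R v i *m (s *m e i *m s) = t i *m prj_mx R v i *m s.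
    by rewrite tE /block /vproj !mulmxA.
  by rewrite -h1 -h2; exact: (congr1 (fun b : A => prj_mx R v i *m b) (es i)).
have ti i : t i *m t i = t i.
  by rewrite {2}tE /block !mulmxA -es' tE.
have tx a : x a *m t (tl a) = t (hd a) *m x a *m t (tl a).
  have := xs a; move/(congr1 (fun b : A => prj_mx R v (hd a) *m b *m inj_mx R v (tl a))).
  change (prj_mx R v (hd a) *m (rmx (x a) *m s) *m inj_mx R v (tl a) =
    prj_mx R v (hd a) *m (s *m rmx (x a) *m s) *m inj_mx R v (tl a) -> x a *m t (tl a) = t (hd a) *m x a *m t (tl a)).
  by rewrite /rmx !tE /block !mulmxA prj_inj mul1mx.
pose f i : 'End('cV[C]_(v i)) := linfun (mulmx (t i)).
have fE i w : f i w = t i *m w by rewrite lfunE.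
have U_sub a : (rmap (qrep_of x) a @: limg (f (tl a)) <= limg (f (hd a)))%VS.
  apply/subvP => _ /memv_imgP[_ /memv_imgP[w _ ->] ->]; 
  have -> : rmap (qrep_of x) a (f (tl a) w) = f (hd a) (x a *m (t (tl a) *m w)).
    rewrite [LHS]lfunE (fE (tl a)) (fE (hd a)).
    change (x a *m (t (tl a) *m w) = t (hd a) *m (x a *m (t (tl a) *m w))).
    by rewrite [LHS]mulmxA tx -!mulmxA.
  exact: memv_img (memvf _).
pose N : subrep (qrep_of x) := @SubRep Q C (qrep_of x) (fun i => limg (f i)) U_sub.
have tU i (w : 'cV_(v i)) : block s i *m w \in N i by rewrite -tE -fE memv_img ?memvf.
have Ut i (w : 'cV_(v i)) : w \in N i -> block s i *m w = w.
  by case/memv_imgP => u _ ->; rewrite -tE fE mulmxA ti.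
have NX i : (N i <= X k i)%VS.
  apply/subvP => _ /memv_imgP[u _ ->]; rewrite fE tE -ps block_mulmx ?blockK; last exact: gmx_graded.
  by rewrite -mulmxA p_mem.
have dN i : dimvec (sub_qrep (subrep_in (X k) N)) i = \dim (N i).
  by rewrite dimvec_sub_qrep dim_subrep_in.
have trs := rtr_dim tU Ut.
have dimN0 : (\sum_i \dim (N i) != 0)%N.
  by apply: contra s0 => /eqP d0; apply/eqP; apply: idem_rtr0 => //; rewrite trs d0.
have : slope alpha (sub_qrep (subrep_in (X k) N)) < slope alpha (sub_qrep (X k)).
  apply: stab.
  - have [i di] : exists i, \dim (N i) != 0%N.
      apply: contrapT => no; case/negP: dimN0; rewrite big1 // => i _; apply/eqP; apply: contrapT => /negP di.
      by apply: no; exists i.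
    by exists i; rewrite -dimv_eq0 dim_subrep_in.
  (* If [N] were all of [X k], then [s] and [pi k] would have the same trace, and the idempotent
     [pi k - s * pi k] would have trace 0. *)
  - have [full|] := boolP [forall i, subrep_in (X k) N i == fullv]; last first.
      by rewrite negb_forall => /fintype.existsP[i iN]; exists i.
    case/eqP: sp; apply: esym; apply/eqP; rewrite -subr_eq0; apply/eqP.
    have pp : pi k * pi k = pi k by rewrite piM eqxx.
    apply: idem_rtr0.
      apply: (@nc_lincomb _ _ _ ((pi k * pi k - pi k) - s * (pi k * pi k - pi k) - (pi k * s - s) * pi k
        + s * (pi k * s - s) * pi k + (s * s - s) * pi k)).
        by rewrite pp ps ss !subrr; ncring.
      by ncring.
    rewrite rtrB [X in _ - X]rtrC ps trs rtr_pi; apply/eqP; rewrite subr_eq0; apply/eqP; congr _%:R.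
    apply: eq_bigr => i _; have /eqP := fintype.forallP full i => /(congr1 (fun W => \dim W)).
    by rewrite dim_subrep_in // dimvf => ->.
rewrite -(ltr_rat R) slope_lam ratr_slope.
rewrite (eq_bigr _ (fun i _ => dN i)) (eq_bigr (fun i => alpha i * (\dim (N i))%:Z)); last by move=> i _; rewrite dN.
rewrite -(rtr_stab_dim alpha tU Ut) -trs ltr_pdivrMr; last by rewrite trs ltr0n lt0n.
by rewrite mulrBl rtrB rscale_mull mul1r rtr_rscale subr_lt0.
Qed.
End Stability.

(** * Filtrations and block-triangular representations *)

Lemma lfun_mx (F : fieldType) m1 m2 (f : 'Hom('cV[F]_m1, 'cV[F]_m2)) :
  exists M : 'M[F]_(m2, m1), forall w, f w = M *m w.
Proof.
exists (\matrix_(r, q) (f (delta_mx q 0)) r 0) => w.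
have wE : w = \sum_q w q 0 *: delta_mx q 0.
  apply/matrixP => r s; rewrite ord1 summxE (bigD1 r) //= !mxE !eqxx mulr1 big1 ?addr0 // => t tr.
  by rewrite !mxE eq_sym (negPf tr) mulr0.
rewrite {1}wE linear_sum; apply/matrixP => r s; rewrite ord1 summxE mxE; apply: eq_bigr => q _.
by rewrite linearZ !mxE mulrC.
Qed.

Lemma mulmx_ext (F : fieldType) m1 m2 (M N : 'M[F]_(m1, m2)) : (forall w : 'cV_m2, M *m w = N *m w) -> M = N.
Proof.
by move=> MN; apply/matrixP => r q; have /matrixP/(_ r 0) := MN (delta_mx q 0); rewrite -!colE !mxE.
Qed.

Lemma inj_surj_bijective (T U : Type) (f : T -> U) : injective f -> (forall u, exists t, f t = u) -> bijective f.
Proof.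
move=> inj_f sf; exists (fun u => sval (cid (sf u))) => [t|u]; last exact: (svalP (cid (sf u))).
by apply: inj_f; exact: (svalP (cid (sf (f t)))).
Qed.

Lemma injective_unitmx (F : fieldType) m (b : 'M[F]_m) : (forall z : 'cV_m, b *m z = 0 -> z = 0) -> b \in unitmx.
Proof.
move=> b0; rewrite -unitmx_tr -row_free_unit -kermx_eq0; apply/rowV0P => u /sub_kermxP ub.
by apply: trmx_inj; rewrite trmx0; apply: b0; rewrite -[b]trmxK -trmx_mul ub trmx0.
Qed.

(** * Isomorphisms from subquotients as matrices *)

Section QuotientMatrix.
Variables (R : realType) (Q : quiver) (v : vert Q -> nat).
Notation C := R[i].
Variables (y x : Rep R v) (N N' : subrep (qrep_of y)) (P : subrep (qrep_of x)).

(** A lift to matrices of an isomorphism from [N] modulo [N'] to [P], free of quotient and subspace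
    types; [Phi] is constrained on [N] only. *)
Definition quotient_mx (Phi : forall i, 'M[C]_(v i)) :=
  [/\ forall i (w : 'cV_(v i)), w \in N i -> Phi i *m w \in P i,
      forall i (w : 'cV_(v i)), w \in N i -> (Phi i *m w == 0) = (w \in N' i),
      forall i (u : 'cV_(v i)), u \in P i -> exists2 w : 'cV_(v i), w \in N i & Phi i *m w = u &
      forall a (w : 'cV_(v (tl a))), w \in N (tl a) ->
        Phi (hd a) *m (y a *m w) = x a *m (Phi (tl a) *m w)].

Lemma subrep_inE i (u : subvs_of (N i)) : (u \in subrep_in N N' i) = (vsval u \in N' i).
Proof. by rewrite -memv_preim lfunE. Qed.

Lemma rmap_qrep_of (z : Rep R v) a (w : 'cV_(v (tl a))) : rmap (qrep_of z) a w = z a *m w.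
Proof. by rewrite lfunE. Qed.

Lemma quotient_mx_qiso Phi : quotient_mx Phi -> qiso (quot_qrep (subrep_in N N')) (sub_qrep P).
Proof.
case=> P1 P2 P3 P4.
pose g i (q : quotvs (subrep_in N N' i)) : subvs_of (P i) := vsproj (P i) (Phi i *m vsval (qrepr q)).
have gE i u : vsval (g i (qproj (subrep_in N N' i) u)) = Phi i *m vsval u.
  rewrite vsprojK ?P1 ?subvsP //; apply/eqP; rewrite -subr_eq0 -mulmxBr.
  have := qreprP (subrep_in N N' i) u; set u' := qrepr _; rewrite subrep_inE linearB /= => h.
  by rewrite P2 // rpredB ?subvsP.
have gE' i q : vsval (g i q) = Phi i *m vsval (qrepr q) by rewrite -{1}[q]qreprK gE.
have g_lin i : linear (g i).
  move=> c q r; have E : c *: q + r = qproj (subrep_in N N' i) (c *: qrepr q + qrepr r).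
    by rewrite qproj_is_linear !qreprK.
  apply: subvs_inj; rewrite {}E gE.
  have -> : vsval (c *: qrepr q + qrepr r) = c *: vsval (qrepr q) + vsval (qrepr r) by rewrite linearP.
  have -> : vsval (c *: g i q + g i r) = c *: vsval (g i q) + vsval (g i r) by rewrite linearP.
  by rewrite !gE' mulmxDr -scalemxAr.
pose G i : {linear quotvs (subrep_in N N' i) -> subvs_of (P i)} :=
  HB.pack (g i) (GRing.isLinear.Build C _ _ _ (g i) (g_lin i)).
exists (fun i => linfun (G i)); have GE i q : linfun (G i) q = g i q by rewrite lfunE.
split=> [i|a].
  apply: inj_surj_bijective => [q r|u].
    have dN : vsval (qrepr q) - vsval (qrepr r) \in N i by rewrite rpredB ?subvsP.
    rewrite !GE => /(congr1 vsval); rewrite !gE' => /eqP; rewrite -subr_eq0 -mulmxBr P2 // => h.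
    by rewrite -[q]qreprK -[r]qreprK; apply/eqP; rewrite eq_qproj subrep_inE linearB.
  have [w wN wE] := P3 _ _ (subvsP u); exists (qproj (subrep_in N N' i) (vsproj (N i) w)).
  by apply: subvs_inj; rewrite GE gE vsprojK.
apply/lfunP => q; rewrite [LHS]comp_lfunE [RHS]comp_lfunE -[q]qreprK quot_qrepE !GE.
set u := qrepr q; apply: subvs_inj; rewrite gE sub_qrepE [RHS]sub_qrepE gE !rmap_qrep_of P4 ?subvsP //.
Qed.

Lemma qiso_quotient_mx : qiso (quot_qrep (subrep_in N N')) (sub_qrep P) -> exists Phi, quotient_mx Phi.
Proof.
case=> f [f_bij f_comm].
pose F i : 'Hom('cV[C]_(v i), 'cV[C]_(v i)) :=
  (linfun (@vsval _ _ (P i)) \o (f i : 'Hom(quotvs (subrep_in N N' i), subvs_of (P i)))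
    \o linfun (qproj (subrep_in N N' i)) \o linfun (vsproj (N i)))%VF.
pose Phi i := sval (cid (lfun_mx (F i))).
have PhiE i (w : 'cV_(v i)) : Phi i *m w = vsval (f i (qproj (subrep_in N N' i) (vsproj (N i) w))).
  by rewrite -(svalP (cid (lfun_mx (F i)))) /F !comp_lfunE !lfunE.
exists Phi; split=> [i w wN|i w wN|i u uP|a w wN].
- by rewrite PhiE subvsP.
- rewrite PhiE; set q := qproj _ _.
  have -> : (vsval (f i q) == 0) = (q == 0).
    rewrite -[0 in LHS](linear0 (@vsval _ _ (P i))) (inj_eq (@subvs_inj _ _ (P i))).
    by rewrite -[0 in LHS](linear0 (f i)) (inj_eq (bij_inj (f_bij i))).
  by rewrite /q qproj_eq0 subrep_inE vsprojK.
- have [f' _ fK] := f_bij i; pose q : quotvs (subrep_in N N' i) := f' (vsproj (P i) u).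
  exists (vsval (qrepr q)); first exact: subvsP.
  by rewrite PhiE vsvalK qreprK fK vsprojK.
rewrite !PhiE; set u := vsproj (N (tl a)) w.
have -> : vsproj (N (hd a)) (y a *m w) = rmap (sub_qrep N) a u.
  apply: val_inj; have -> : val (rmap (sub_qrep N) a u) = rmap (qrep_of y) a (vsval u) by exact: sub_qrepE.
  rewrite /u vsprojK // rmap_qrep_of /= vsprojK // -rmap_qrep_of.
  by apply: (subvP (subrepP N a)); exact: memv_img.
have /lfunP/(_ (qproj (subrep_in N N' (tl a)) u)) := f_comm a.
rewrite [X in X = _ -> _]comp_lfunE [X in _ = X -> _]comp_lfunE quot_qrepE => ->.
by rewrite sub_qrepE rmap_qrep_of.
Qed.
End QuotientMatrix.

Section Triangular.
Variables (R : realType) (Q : quiver) (v : vert Q -> nat).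
Notation C := R[i].
Variables (x : Rep R v) (n : nat) (X : 'I_n -> subrep (qrep_of x)) (p : 'I_n -> forall i, 'M[C]_(v i)).
Hypothesis p_mul : forall k l i, p k i *m p l i = if k == l then p k i else 0.
Hypothesis p_sum : forall i, \sum_k p k i = 1%:M.
Hypothesis memX : forall k i (w : 'cV_(v i)), (w \in X k i) = (p k i *m w == w).

Definition triangular_over_x (z : Rep R v) := forall a (k l : 'I_n), (l <= k)%N ->
  p k (hd a) *m z a *m p l (tl a) = if k == l then x a *m p k (tl a) else 0.

Lemma p_total i (z : 'cV[C]_(v i)) : z = \sum_k p k i *m z.
Proof. by rewrite -mulmx_suml p_sum mul1mx. Qed.

Section FromTriangular.
Variables (y : Rep R v) (g g' : forall i, 'M[C]_(v i)).
Hypothesis gK : forall i, g i *m g' i = 1%:M.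
Hypothesis g'K : forall i, g' i *m g i = 1%:M.
Variable z : Rep R v.
Hypothesis zE : forall a, g (hd a) *m y a = z a *m g (tl a).
Hypothesis z_tri : triangular_over_x z.

Definition upperp (j : nat) i : 'M[C]_(v i) := \sum_(l < n | (j <= l)%N) p l i.

Lemma upperp_split (k : 'I_n) i : upperp k i = p k i + upperp k.+1 i.
Proof.
rewrite /upperp (bigD1 k) //=; congr (_ + _); apply: eq_bigl => l.
by rewrite ltn_neqAle andbC eq_sym.
Qed.

Lemma upperp_p j (k : 'I_n) i : (k < j)%N -> upperp j i *m p k i = 0.
Proof.
move=> kj; rewrite mulmx_suml big1 // => l jl; rewrite p_mul; case: eqP => // lk.
by rewrite lk leqNgt kj in jl.
Qed.

Lemma p_upperp j (k : 'I_n) i : (j <= k)%N -> p k i *m upperp j i = p k i.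
Proof.
move=> jk; rewrite mulmx_sumr (bigD1 k) //= p_mul eqxx big1 ?addr0 // => l /andP[_ lk].
by rewrite p_mul eq_sym (negPf lk).
Qed.

Lemma upperp_total j i (w : 'cV[C]_(v i)) : upperp j i *m w = 0 -> w = \sum_(l < n | (l < j)%N) p l i *m w.
Proof.
move=> h; rewrite [LHS]p_total (bigID (fun l : 'I_n => (l < j)%N)) /=.
rewrite [X in _ + X]big1 ?addr0 // => l; rewrite -leqNgt => jl.
by rewrite -(p_upperp i jl) -mulmxA h mulmx0.
Qed.

Lemma g_y a (w : 'cV[C]_(v (tl a))) : g (hd a) *m (y a *m w) = z a *m (g (tl a) *m w).
Proof. by rewrite mulmxA zE mulmxA. Qed.

Lemma p_z a (k : 'I_n) j (w : 'cV[C]_(v (tl a))) : (j <= k)%N -> upperp j (tl a) *m w = 0 ->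
  p k (hd a) *m (z a *m w) = 0.
Proof.
move=> jk /upperp_total ->; rewrite !mulmx_sumr big1 // => l lj; rewrite !mulmxA z_tri; last exact: leq_trans (ltnW lj) jk.
by case: eqP => [kl|_]; [rewrite -kl ltnNge jk in lj | rewrite mul0mx].
Qed.

(** [Y j] is the preimage under [g] of the span of the first [j] summands, which is invariant
    because [z] is block triangular. *)
Lemma upperp_subrep : exists Y : nat -> subrep (qrep_of y),
  forall j i (w : 'cV[C]_(v i)), (w \in Y j i) = (upperp j i *m (g i *m w) == 0).
Proof.
pose Yv j i : {vspace 'cV[C]_(v i)} := lker (linfun (mulmx (upperp j i *m g i))).
have memYv j i (w : 'cV[C]_(v i)) : (w \in Yv j i) = (upperp j i *m (g i *m w) == 0).
  by rewrite memv_ker lfunE /= mulmxA.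
have Yv_sub j a : (rmap (qrep_of y) a @: Yv j (tl a) <= Yv j (hd a))%VS.
  apply/subvP => u /memv_imgP[w wY ->]; rewrite memYv in wY.
  rewrite rmap_qrep_of memYv g_y /upperp mulmx_suml big1 // => k jk.
  exact: p_z jk (eqP wY).
by exists (fun j => @SubRep Q C (qrep_of y) (Yv j) (Yv_sub j)).
Qed.

Lemma has_filtration_triangular : has_filtration (qrep_of y) (fun k => sub_qrep (X k)).
Proof.
have [Y memY] := upperp_subrep.
exists Y; split => [i|i|k i|k].
- apply/vspaceP => w; rewrite memY memv0 /upperp p_sum mul1mx.
  by apply/eqP/eqP => [h|->]; [rewrite -[w]mul1mx -g'K -mulmxA h mulmx0 | rewrite mulmx0].
- apply/vspaceP => w; rewrite memY memvf /upperp big_pred0 ?mul0mx ?eqxx // => l.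
  by rewrite leqNgt ltn_ord.
- apply/subvP => w; rewrite !memY => /eqP h.
  have -> : upperp k.+1 i *m (g i *m w) = \sum_(l < n | (k.+1 <= l)%N) p l i *m (g i *m w) by rewrite mulmx_suml.
  by apply/eqP; rewrite big1 // => l kl; rewrite -(p_upperp i (ltnW kl)) -mulmxA h mulmx0.
(* [p k i *m g i] maps the step [k.+1] onto the summand [X k], with the step [k] as kernel. *)
apply: (@quotient_mx_qiso _ _ _ _ _ _ _ _ (fun i => p k i *m g i)); split.
- by move=> i w _; rewrite memX !mulmxA p_mul eqxx.
- move=> i w; rewrite !memY => /eqP h.
  by rewrite -[p k i *m g i *m w]mulmxA upperp_split mulmxDl h addr0.
- move=> i u; rewrite memX => /eqP pu; exists (g' i *m u).
    by rewrite memY [g i *m _]mulmxA gK mul1mx -pu mulmxA upperp_p // mul0mx.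
  by rewrite -mulmxA [g i *m _]mulmxA gK mul1mx.
move=> a w; rewrite memY => /eqP h.
rewrite -[LHS]mulmxA g_y -[X in x a *m X]mulmxA; move: (g (tl a) *m w) h => u h.
rewrite {1}[u]p_total (bigD1 k) //= !mulmxDr !mulmxA z_tri // eqxx.
rewrite -[RHS]addr0; congr (_ + _).
rewrite !mulmx_sumr big1 // => l lk; rewrite !mulmxA.
have [lk'|kl] := leqP l k; first by rewrite z_tri // eq_sym (negPf lk) !mul0mx.
by rewrite -(p_upperp _ kl) -!mulmxA h !mulmx0.
Qed.
End FromTriangular.

Section ToTriangular.
Variable y : Rep R v.

(** [B k] lifts the elements of [X k] through the [k]-th quotient isomorphism to [Y k.+1]. The sum
    [b] of these lifts carries the flag of the summands of [x] to the filtration of [y]. *)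
Lemma triangular_has_filtration : has_filtration (qrep_of y) (fun k => sub_qrep (X k)) ->
  exists b b' : forall i, 'M[C]_(v i), [/\ forall i, b i *m b' i = 1%:M, forall i, b' i *m b i = 1%:M &
    triangular_over_x (fun a => b' (hd a) *m y a *m b (tl a))].
Proof.
case=> Y [Y0 Yn Ymono Yiso].
have Phi_ex k := qiso_quotient_mx (Yiso k).
pose Phi k := sval (cid (Phi_ex k)); have PhiP k := svalP (cid (Phi_ex k)); rewrite -/(Phi _) in PhiP.
have Yle i j k : (j <= k <= n)%N -> (Y j i <= Y k i)%VS.
  case/andP; elim: k => [|k IH]; first by rewrite leqn0 => /eqP ->.
  rewrite leq_eqVlt => /orP[/eqP -> //|jk] kn; apply: subv_trans (IH jk (ltnW kn)) _.
  exact: (Ymono (Ordinal kn)).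
have col_ex (k : 'I_n) i (q : 'I_(v i)) : exists w : 'cV[C]_(v i), w \in Y k.+1 i /\ Phi k i *m w = p k i *m delta_mx q 0.
  have [_ _ P3 _] := PhiP k; have [|w w1 w2] := P3 i (p k i *m delta_mx q 0); last by exists w.
  by rewrite memX mulmxA p_mul eqxx.
pose cl k i q := sval (cid (col_ex k i q)).
have clY k i q : cl k i q \in Y k.+1 i by have [] := svalP (cid (col_ex k i q)).
have clP k i q : Phi k i *m cl k i q = p k i *m delta_mx q 0 by have [] := svalP (cid (col_ex k i q)).
pose B k i : 'M[C]_(v i) := \matrix_(r, q) cl k i q r 0.
have BE k i (w : 'cV[C]_(v i)) : B k i *m w = \sum_q w q 0 *: cl k i q.
  apply/matrixP => r s; rewrite ord1 summxE mxE; apply: eq_bigr => q _.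
  by rewrite !mxE mulrC.
have BY k i (w : 'cV[C]_(v i)) : B k i *m w \in Y k.+1 i.
  by rewrite BE; apply: memv_suml => q _; apply: memvZ; exact: clY.
have PhiB k i (w : 'cV[C]_(v i)) : Phi k i *m (B k i *m w) = p k i *m w.
  rewrite BE mulmx_sumr; under eq_bigr do rewrite -scalemxAr clP scalemxAr.
  rewrite -mulmx_sumr; congr (_ *m _); apply/matrixP => r s; rewrite ord1 summxE (bigD1 r) //= !mxE !eqxx mulr1.
  by rewrite big1 ?addr0 // => t tr; rewrite !mxE eq_sym (negPf tr) mulr0.
pose b i : 'M[C]_(v i) := \sum_k B k i *m p k i.
have bE i (w : 'cV[C]_(v i)) : b i *m w = \sum_k B k i *m (p k i *m w).
  by rewrite mulmx_suml; apply: eq_bigr => k _; rewrite mulmxA.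
(* The terms of [b i *m w] of index below [k] lie in [Y k] and are killed by [Phi k]. *)
have key i (k : 'I_n) (w : 'cV[C]_(v i)) : (forall l : 'I_n, (k < l)%N -> p l i *m w = 0) ->
    b i *m w \in Y k.+1 i /\ Phi k i *m (b i *m w) = p k i *m w.
  move=> pw; have lowY : \sum_(l | l != k) B l i *m (p l i *m w) \in Y k i.
    apply: memv_suml => l lk; have [kl|lk'] := ltnP k l; first by rewrite pw // mulmx0 mem0v.
    by apply: (subvP (Yle i l.+1 k _)); rewrite ?BY // ltn_neqAle lk lk' ltnW.
  have kk : (Y k i <= Y k.+1 i)%VS by exact: Ymono.
  have [_ P2 _ _] := PhiP k; have lowP := P2 _ _ (subvP kk _ lowY); rewrite lowY in lowP.
  rewrite bE (bigD1 k) //=; split; first by rewrite rpredD ?BY // (subvP kk).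
  by rewrite mulmxDr (eqP lowP) addr0 PhiB mulmxA p_mul eqxx.
(* Descending induction on [l], encoded by a bound [m] on [n - l]: once the higher components
   vanish, [key] reads off the component of index [l]. *)
have desc i j (w : 'cV[C]_(v i)) : b i *m w \in Y j i -> forall l : 'I_n, (j <= l)%N -> p l i *m w = 0.
  move=> bw; suff H m : forall l : 'I_n, (n - l <= m)%N -> (j <= l)%N -> p l i *m w = 0 by move=> l; exact: (H n l (leq_subr _ _)).
  elim: m => [|m IH] l; first by rewrite leqn0 subn_eq0 leqNgt ltn_ord.
  move=> lm jl; have [|_ <-] := key i l w.
    move=> l' ll'; apply: IH; last exact: leq_trans jl (ltnW ll').
    by rewrite -ltnS; apply: leq_trans lm; rewrite ltn_sub2l.
  have bl : b i *m w \in Y l i by apply: (subvP (Yle i j l _)) => //; rewrite jl ltnW.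
  have [_ P2 _ _] := PhiP l; apply/eqP; rewrite P2 //.
  by apply: (subvP (Yle i l l.+1 _)) => //; rewrite leqnSn /=.
have b_unit i : b i \in unitmx.
  apply: injective_unitmx => w bw; rewrite [w]p_total big1 // => l _; apply: (desc i 0%N) => //.
  by rewrite bw mem0v.
exists b, (fun i => invmx (b i)); split => [i|i|a k l lk]; [exact: mulmxV | exact: mulVmx|].
pose q (w : 'cV[C]_(v (tl a))) := invmx (b (hd a)) *m y a *m b (tl a) *m p l (tl a) *m w.
have bp (w : 'cV[C]_(v (tl a))) : b (tl a) *m (p l (tl a) *m w) = B l (tl a) *m (p l (tl a) *m w).
  rewrite bE (bigD1 l) //= !mulmxA -[_ *m p l _ *m p l _]mulmxA p_mul eqxx big1 ?addr0 // => l' l'l.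
  by rewrite !mulmxA -[_ *m p l' _ *m p l _]mulmxA p_mul (negPf l'l) mulmx0 mul0mx.
have bq w : b (hd a) *m q w = y a *m (B l (tl a) *m (p l (tl a) *m w)).
  by rewrite /q -bp !mulmxA mulmxV // mul1mx.
have bqY w : b (hd a) *m q w \in Y l.+1 (hd a).
  rewrite bq -rmap_qrep_of; apply: (subvP (subrepP (Y l.+1) a)); exact: memv_img (BY _ _ _).
have ptq w : p k (hd a) *m q w = if k == l then x a *m (p k (tl a) *m w) else 0.
  case: eqVneq => [->|kl]; last by apply: (desc _ _ _ (bqY w)); rewrite ltn_neqAle eq_sym kl lk.
  have [|_ <-] := key (hd a) l (q w); first by move=> l'; exact: (desc _ _ _ (bqY w)).
  have [_ _ _ P4] := PhiP l; by rewrite bq P4 ?BY // PhiB [p l _ *m (p l _ *m w)]mulmxA p_mul eqxx.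
apply: mulmx_ext => w; have := ptq w; rewrite /q !mulmxA => ->.
by case: eqP => _; rewrite ?mul0mx.
Qed.
End ToTriangular.
End Triangular.

(** * Unstable sets and filtrations *)

(** [M] is the product of the denominators [w k]. The shift [- B / M], with [B] the sum of the
    absolute values of the numerators, makes the remaining numerators natural numbers, which serve
    as exponents. *)
Lemma common_denominator (R : realType) (n : nat) (lam : 'I_n -> R) (w : 'I_n -> nat) (N : 'I_n -> int) :
  (forall k, (0 < w k)%N) -> (forall k, lam k * (w k)%:R = (N k)%:~R) ->
  exists (M : nat) (c0 : R) (c : 'I_n -> nat), (0 < M)%N /\ forall k, lam k = c0 + (c k)%:R / M%:R.
Proof.
move=> w0 lamw; pose M := \prod_l w l; have M0 : (0 < M)%N by apply: prodn_gt0.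
pose K k : int := N k * (\prod_(l | l != k) w l)%:Z; pose B := (\sum_k `|K k|)%N.
have lamM k : lam k * M%:R = (K k)%:~R.
  by rewrite /M (bigD1 k) //= natrM mulrA lamw /K intrM.
have KB k : 0 <= K k + B%:Z.
  have : (`|K k| <= B)%N by rewrite /B (bigD1 k) //= leq_addr.
  rewrite -lez_nat abszE => h; have := ler_norm (- K k); rewrite normrN; lra.
exists M, (- B%:R / M%:R), (fun k => absz (K k + B%:Z)); split=> // k.
have MR : M%:R != 0 :> R by rewrite pnatr_eq0 -lt0n.
have E : (absz (K k + B%:Z))%:R = (K k)%:~R + B%:R :> R.
  by rewrite natr_absz ger0_norm // intrD.
by rewrite E mulrDl -lamM mulfK // mulNr addrCA addNr addr0.
Qed.

Section Block.
Variables (R : realType) (I : finType) (v : I -> nat).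
Notation A := 'M[R[i]]_(total_dim v).

Lemma block0 i : block (0 : A) i = 0.
Proof. by rewrite /block mulmx0 mul0mx. Qed.

Lemma block1 i : block (1 : A) i = 1%:M.
Proof. by rewrite -gmx1 blockK. Qed.

Lemma block_sum (J : finType) (F : J -> A) i : block (\sum_j F j) i = \sum_j block (F j) i.
Proof. by rewrite /block mulmx_sumr mulmx_suml. Qed.

Lemma unitmx_ring (b : A) : b \in unitmx -> b * invmx b = 1 /\ invmx b * b = 1.
Proof. by move=> ub; split; [exact: mulmxV | exact: mulVmx]. Qed.
End Block.

Section GaugeAction.
Variables (R : realType) (Q : quiver) (v : vert Q -> nat).
Variables (y : Rep R v) (g : forall i, 'M[R[i]]_(v i)).
Hypothesis gG : in_G g.

Lemma gactE a : gact g y a *m g (tl a) = g (hd a) *m y a.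
Proof. by rewrite /gact mulmxKV. Qed.

Lemma gact_path i j (p : qpath i j) : path_eval (gact g y) p *m g i = g j *m path_eval y p.
Proof.
elim: p => [k|a k p IH] /=; first by rewrite mul1mx mulmx1.
by rewrite -mulmxA gactE !mulmxA IH.
Qed.

Lemma gact_nu0 m (rels : 'I_m -> qrelation Q R[i]) : nu0 rels y -> nu0 rels (gact g y).
Proof.
move=> y0 r; rewrite -[LHS](mulmxK (gG (rel_tl (rels r)))).
have -> : relation_eval (gact g y) (rels r) *m g (rel_tl (rels r)) =
    g (rel_hd (rels r)) *m relation_eval y (rels r).
  rewrite /relation_eval mulmx_suml mulmx_sumr; apply: eq_bigr => c _.
  by rewrite -scalemxAl gact_path scalemxAr.
by rewrite y0 mulmx0 mul0mx.
Qed.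
End GaugeAction.

(** * Transfer of flow lines between the two models of representations *)

Section FlowTransfer.
Variables (R : realType) (Q : quiver) (v : vert Q -> nat) (alpha : vert Q -> int).
Notation C := R[i].
Notation al := (stab_mx R v alpha).

Lemma rmx0 (a : edge Q) : rmx (0 : 'M[C]_(v (hd a), v (tl a))) = 0.
Proof. by rewrite /rmx mulmx0 mul0mx. Qed.

Lemma flow_rmx (z : Rep R v) a :
  rmx (z a) * moment al (fun a => rmx (z a)) - moment al (fun a => rmx (z a)) * rmx (z a) =
  rmx (- ('i%C *: rho z (mu_sub alpha z) a)).
Proof.
rewrite moment_rmx gmx_rmx rmx_gmx /rmx -mulmxBl -mulmxBr; congr (_ *m _ *m _).
by rewrite -scalemxAr -scalemxAl -scalerBr -scalerN opprB.
Qed.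

Lemma flow_line_rmx (y : Rep R v) (phi : R -> Rep R v) : backward_flow_line alpha y phi ->
  let Phi t a := rmx (phi t a) in
  forall (t : R) a p q, t <= 0 ->
  is_derive t 1 (fun s : R => complex.Re (Phi s a p q))
    (complex.Re ((Phi t a * moment al (Phi t) - moment al (Phi t) * Phi t a) p q)) /\
  is_derive t 1 (fun s : R => complex.Im (Phi s a p q))
    (complex.Im ((Phi t a * moment al (Phi t) - moment al (Phi t) * Phi t a) p q)).
Proof.
move=> [_ phiD] Phi t a p q t0; rewrite flow_rmx.
have [E|[p' [q' E]]] := rmx_entry R a p q.
  have c0 : is_derive t 1 (fun=> 0 : R) (0 : R) by exact: is_derive_cst.
  by split; rewrite E; under eq_fun do rewrite /Phi E.
have [D1 D2] := phiD t t0 a p' q'.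
by split; rewrite E; under eq_fun do rewrite /Phi E.
Qed.

Lemma limit_rmx (x : Rep R v) (phi : R -> Rep R v) :
  (forall a p q,
      (complex.Re (phi t a p q) @[t --> -oo] --> complex.Re (x a p q))%classic /\
      (complex.Im (phi t a p q) @[t --> -oo] --> complex.Im (x a p q))%classic) ->
  forall a p q,
      (complex.Re (rmx (phi t a) p q) @[t --> -oo] --> complex.Re (rmx (x a) p q))%classic /\
      (complex.Im (rmx (phi t a) p q) @[t --> -oo] --> complex.Im (rmx (x a) p q))%classic.
Proof.
move=> lim a p q; have [E|[p' [q' E]]] := rmx_entry R a p q.
  by split; rewrite E; under eq_fun do rewrite E; exact: cvg_cst.
have [L1 L2] := lim a p' q'.
by split; rewrite E; under eq_fun do rewrite E.
Qed.
End FlowTransfer.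

Section Main.
Variables (R : realType) (Q : quiver) (v : vert Q -> nat).
Variables (m : nat) (rels : 'I_m -> qrelation Q R[i]) (alpha : vert Q -> int).
Variables (x : Rep R v) (n : nat) (X : 'I_n -> subrep (qrep_of x)).
Notation C := R[i].
Notation A := 'M[C]_(total_dim v).
Notation e := (vproj R v).
Notation al := (stab_mx R v alpha).
Variables (p : 'I_n -> forall i, 'M[C]_(v i)) (lam : 'I_n -> R).
Notation pi k := (gmx (p k)).
Hypothesis piM : forall k l, pi k * pi l = if k == l then pi k else 0.
Hypothesis pi_sum : \sum_k pi k = 1.
Hypothesis pi_neq0 : forall k, pi k != 0.
Hypothesis momentE : moment al (fun a => rmx (x a)) = \sum_k rscale (lam k) (pi k).
Hypothesis pi_x : forall k a, pi k * rmx (x a) = rmx (x a) * pi k.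
Hypothesis memX : forall k i w, (w \in X k i) = (p k i *m w == w).
Variables (M : nat) (c0 : R) (c : 'I_n -> nat).
Hypothesis M_gt0 : (0 < M)%N.
Hypothesis lamE : forall k, lam k = c0 + (c k)%:R / M%:R.
Hypothesis lam_lt : forall k l : 'I_n, (k < l)%N -> lam k < lam l.

Let X0 a := rmx (x a).

Lemma p_mul k l i : p k i *m p l i = if k == l then p k i else 0.
Proof.
have := piM k l; rewrite gmxM => E; rewrite -[LHS](blockK (fun i => p k i *m p l i)) E.
by case: ifP => _; rewrite ?blockK ?block0.
Qed.

Lemma p_sum i : \sum_k p k i = 1%:M.
Proof.
by rewrite -(block1 R v) -pi_sum block_sum; apply: eq_bigr => k _; rewrite blockK.
Qed.

Lemma c_lt (k l : 'I_n) : (k < l)%N -> (c k < c l)%N.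
Proof.
move/lam_lt; rewrite !lamE ltrD2l ltr_pM2r ?invr_gt0 ?ltr0n //.
by rewrite ltr_nat.
Qed.

Lemma lam_gap (k l : 'I_n) : (k < l)%N -> lam k + M%:R^-1 <= lam l.
Proof.
move/c_lt => kl; rewrite !lamE -addrA lerD2l -[X in _ + X]mul1r -mulrDl.
by rewrite ler_pM2r ?invr_gt0 ?ltr0n // natr1 ler_nat.
Qed.

Lemma pi_graded k : graded e (pi k). Proof. exact: gmx_graded. Qed.

Lemma xE i a : e i * X0 a = if hd a == i then X0 a else 0.
Proof. by have [] := rmx_homog (x a) i. Qed.

Lemma Xe i a : X0 a * e i = if tl a == i then X0 a else 0.
Proof. by have [] := rmx_homog (x a) i. Qed.

Lemma unstable_has_filtration y : (forall k, stable alpha (sub_qrep (X k))) ->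
  unstable_set rels alpha x y -> has_filtration (qrep_of y) (fun k => sub_qrep (X k)).
Proof.
move=> stab [_ [phi [line lim]]]; pose Phi t a := rmx (phi t a).
pose beta k := al - rscale (lam k) 1.
have M0 : (0 : R) < M%:R^-1 by rewrite invr_gt0 ltr0n.
have gr_moment t : graded e (moment al (Phi t)) by rewrite moment_rmx; exact: gmx_graded.
have beta_comm b l : graded e b -> b * beta l = beta l * b.
  by move=> gb; rewrite mulrBr mulrBl stab_mx_comm // rscale_comm.
have beta_tr k : rtr (beta k * pi k) = 0.
  by rewrite mulrBl rtrB rscale_mull mul1r rtr_rscale (rtr_stab_pi piM momentE pi_x) subrr.
have st k s := @stable_trace _ _ _ _ _ _ _ _ _ piM pi_neq0 momentE pi_x memX k s (stab k).
have [G [G' [GG' G'G Ge tri]]] := @flow_triangular _ _ _ _ _ al X0 Phi (fun k => pi k) lam M%:R^-1 e beta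
  (flow_line_rmx line) (limit_rmx lim) piM pi_sum pi_neq0 momentE M0 lam_gap pi_x
  (fun k s => esym (pi_graded k s)) (fun k l => beta_comm _ l (pi_graded k))
  (fun t s => esym (gr_moment t s)) (fun t l => beta_comm _ l (gr_moment t)) beta_tr st.
have grG : graded e G by move=> i.
have grG' : graded e G'.
  move=> i; apply: (@nc_lincomb _ _ _ (G' * (G * e i - e i * G) * G'
    - (G' * G - 1) * e i * G' + G' * e i * (G * G' - 1))).
    by rewrite Ge GG' G'G !subrr; ncring.
  by ncring.
pose g i := block G i; pose g' i := block G' i.
have gK i : g i *m g' i = 1%:M by rewrite -block_mulmx // GG' block1.
have g'K i : g' i *m g i = 1%:M by rewrite -block_mulmx // G'G block1.
apply: (@has_filtration_triangular _ _ _ _ _ _ _ p_mul p_sum memX y g g' gK g'K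
  (fun a => g (hd a) *m y a *m g' (tl a))).
  by move=> a; rewrite -[RHS]mulmxA g'K mulmx1.
have y0 a : Phi 0 a = rmx (y a) by rewrite /Phi line.1.
move=> a k l lk; rewrite -(rmxK (p k (hd a) *m _ *m p l (tl a))).
have -> : rmx (p k (hd a) *m (g (hd a) *m y a *m g' (tl a)) *m p l (tl a)) =
    pi k * (G * Phi 0 a * G') * pi l.
  by rewrite y0 -{1}(graded_gmx grG) -{1}(graded_gmx grG') gmx_rmx rmx_gmx gmx_rmx rmx_gmx.
rewrite tri //; case: eqP => _; first by rewrite /X0 rmx_gmx rmxK.
by rewrite /unrmx mulmx0 mul0mx.
Qed.

Lemma has_filtration_unstable y : nu0 rels y -> has_filtration (qrep_of y) (fun k => sub_qrep (X k)) ->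
  exists g : forall i, 'M[C]_(v i), in_G g /\ unstable_set rels alpha x (gact g y).
Proof.
move=> ynu /(triangular_has_filtration p_mul p_sum memX)[b [b' [bK b'K tri]]].
pose z a := b' (hd a) *m y a *m b (tl a).
have ztri a (k l : 'I_n) : (l <= k)%N -> pi k * rmx (z a) * pi l = if k == l then X0 a * pi k else 0.
  move=> lk; rewrite gmx_rmx rmx_gmx tri //; case: ifP => _; rewrite ?rmx0 //.
  by rewrite /X0 rmx_gmx.
(* Conjugating [z] by [\sum_k s^(c k) pi_k] multiplies the block [(k, l)] by [s^(c l - c k)], and
   [y_ j] collects the blocks with exponent [j]. The condition [k <= l] keeps the truncated
   subtraction exact; the blocks below the diagonal of [z] vanish. *)
pose y_ j a := \sum_(k < n) \sum_(l < n | (k <= l)%N && ((c l - c k)%N == j)) pi k * rmx (z a) * pi l.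
pose j0 := (\sum_(l < n) c l).+1.
have y_0 a : y_ 0%N a = X0 a.
  rewrite -[RHS]mulr1 -pi_sum mulr_sumr; apply: eq_bigr => k _.
  rewrite (big_pred1 k) ?ztri ?eqxx // => l; apply/idP/eqP => [/andP[kl]|->]; last by rewrite leqnn subnn eqxx.
  rewrite subn_eq0 => cl; apply/eqP; rewrite eq_sym; apply: contraLR cl => kl'; rewrite -ltnNge c_lt //.
  by rewrite ltn_neqAle kl kl'.
have y_fin j a : (j0 <= j)%N -> y_ j a = 0.
  move=> jj; rewrite /y_ big1 // => k _; rewrite big1 // => l /andP[_ /eqP cl]; move: jj.
  rewrite -cl /j0 (bigD1 l) //= => h; have := leq_ltn_trans (leq_trans (leq_subr (c k) (c l)) (leq_addr _ _)) h.
  by rewrite ltnn.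
have y_hom j a : homog e (@hd Q) (@tl Q) a (y_ j a).
  apply: homog_sum => k _; apply: homog_sum => l _.
  by apply: homogMr; [exact: pi_graded | apply: homogMl; [exact: pi_graded | exact: rmx_homog]].
have MR : M%:R != 0 :> R by rewrite pnatr_eq0 -lt0n.
(* A block from the summand [l] to the summand [k] is an eigenvector of the bracket with the moment,
   with eigenvalue [lam l - lam k], which is [j / M]. *)
have y_H j a : rscale (j%:R / M%:R) 1 * y_ j a = y_ j a * moment al X0 - moment al X0 * y_ j a.
  have lH l : pi l * moment al X0 = rscale (lam l) (pi l).
    rewrite momentE mulr_sumr (bigD1 l) //= rscale_mulr piM eqxx big1 ?addr0 // => i il.
    by rewrite rscale_mulr piM eq_sym (negPf il) /rscale scaler0.
  have Hk k : moment al X0 * pi k = rscale (lam k) (pi k).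
    rewrite momentE mulr_suml (bigD1 k) //= rscale_mull piM eqxx big1 ?addr0 // => i ik.
    by rewrite rscale_mull piM (negPf ik) /rscale scaler0.
  move: (moment al X0) lH Hk => H lH Hk.
  rewrite /y_ mulr_sumr mulr_suml mulr_sumr -sumrB; apply: eq_bigr => k _.
  rewrite [LHS]mulr_sumr [X in _ = X - _]mulr_suml [X in _ = _ - X]mulr_sumr -sumrB; apply: eq_bigr => l /andP[kl /eqP <-].
  have kl' : (c k <= c l)%N by move: kl; rewrite leq_eqVlt => /orP[/eqP/val_inj -> //|/c_lt/ltnW].
  rewrite -[pi k * _ * pi l * H]mulrA lH !mulrA Hk rscale_mulr !rscale_mull mul1r /rscale -scalerBl -rmorphB.
  by congr ((_ %:C)%C *: _); rewrite !lamE natrB // mulrBl; ring.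
have [z0 [G [phi [[z00 Gu Ge GY] [phi_hom [phiD phi_lim]]]]]] :=
  flow_series (stab_mx_adj R v alpha) (vproj_adj R v) xE Xe (@stab_mx_comm R Q v alpha) (stab_mx_graded R v alpha)
    y_0 y_fin y_hom M_gt0 y_H.
pose D := \sum_k rscale (z0 ^+ c k) (pi k); pose D' := \sum_k rscale (z0 ^- c k) (pi k).
have zk k : z0 ^+ c k != 0 by rewrite expf_neq0 // gt_eqF.
have piDD (s1 s2 : 'I_n -> R) : (forall k, s1 k * s2 k = 1) ->
    (\sum_k rscale (s1 k) (pi k)) * (\sum_k rscale (s2 k) (pi k)) = 1.
  move=> s12; rewrite -pi_sum mulr_suml; apply: eq_bigr => k _.
  rewrite mulr_sumr (bigD1 k) //= rscale_mull rscale_mulr piM eqxx big1 ?addr0.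
    by rewrite /rscale scalerA -rmorphM s12 rmorph1 scale1r.
  by move=> l lk; rewrite rscale_mull rscale_mulr piM eq_sym (negPf lk) /rscale !scaler0.
have DD' : D * D' = 1 by apply: piDD => k; rewrite mulfV.
have D'D : D' * D = 1 by apply: piDD => k; rewrite mulVf.
have grD' : graded e D' by apply: graded_sum => k _; apply: graded_rscale; exact: pi_graded.
have YE a : \sum_(0 <= j < j0) rscale (z0 ^+ j) (y_ j a) = D' * rmx (z a) * D.
  transitivity (\sum_(k < n) \sum_(l < n | (k <= l)%N) rscale (z0 ^+ (c l - c k)) (pi k * rmx (z a) * pi l)).
    under eq_bigr do rewrite /y_ /rscale scaler_sumr.
    rewrite exchange_big /=; apply: eq_bigr => k _; under eq_bigr do rewrite scaler_sumr.
    rewrite big_mkord (exchange_big_dep (fun l : 'I_n => (k <= l)%N)) /=; last by move=> j l _ /andP[].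
    apply: eq_bigr => l kl; have lj : (c l - c k < j0)%N.
      by rewrite ltnS (leq_trans (leq_subr _ _)) // (bigD1 l) //= leq_addr.
    rewrite (big_pred1 (Ordinal lj)) // => j; rewrite kl /=.
    by rewrite -val_eqE /= eq_sym.
  rewrite /D' /D mulr_suml mulr_suml; apply: eq_bigr => k _.
  rewrite mulr_sumr [RHS](bigID (fun l : 'I_n => (k <= l)%N)) /= [X in _ = _ + X]big1 ?addr0.
    apply: eq_bigr => l kl; have kl' : (c k <= c l)%N.
      by move: kl; rewrite leq_eqVlt => /orP[/eqP/val_inj -> //|/c_lt/ltnW].
    rewrite !rscale_mull rscale_mulr /rscale scalerA -rmorphM; congr ((_ %:C)%C *: _).
    by rewrite expfB_cond ?gt_eqF // mulrC.
  move=> l; rewrite -ltnNge => lk; rewrite !rscale_mull rscale_mulr ztri ?(ltnW lk) //.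
  by case: eqP => [kl|_]; [rewrite kl ltnn in lk | rewrite /rscale !scaler0].
(* [b'] and [D'] conjugate [y] to the value at [z0] of the polynomial curve, and [G] conjugates this
   value to [phi 0]. *)
pose Gam := G * D' * gmx b'; pose g i := block Gam i.
have grGam : graded e Gam by apply: gradedM; [apply: gradedM | exact: gmx_graded].
have [GV VG] := unitmx_ring Gu.
have bb : gmx b * gmx b' = 1 by rewrite gmxM -gmx1; apply: eq_bigr => i _; rewrite bK.
have b'b : gmx b' * gmx b = 1 by rewrite gmxM -gmx1; apply: eq_bigr => i _; rewrite b'K.
pose Gam' := gmx b * D * invmx G.
have GG' : Gam * Gam' = 1.
  apply: (@nc_lincomb _ _ _ (G * D' * (gmx b' * gmx b - 1) * D * invmx G + G * (D' * D - 1) * invmx G + (G * invmx G - 1))).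
    by rewrite b'b D'D GV !subrr; ncring.
  by rewrite /Gam /Gam'; ncring.
have G'G : Gam' * Gam = 1.
  apply: (@nc_lincomb _ _ _ (gmx b * D * (invmx G * G - 1) * D' * gmx b' + gmx b * (D * D' - 1) * gmx b' + (gmx b * gmx b' - 1))).
    by rewrite bb DD' VG !subrr; ncring.
  by rewrite /Gam /Gam'; ncring.
have gG : in_G g.
  move=> i; have h : g i *m block Gam' i = 1%:M by rewrite -block_mulmx // GG' block1.
  exact: (mulmx1_unit h).1.
exists g; split=> //; split; first exact: gact_nu0.
have zb a : rmx (z a) * gmx b' = gmx b' * rmx (y a).
  by rewrite gmx_rmx rmx_gmx /z -mulmxA bK mulmx1.
have phi0 a : phi 0 a = rmx (gact g y a).
  have h1 : phi 0 a * Gam = Gam * rmx (y a).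
    rewrite /Gam; apply: (@nc_lincomb _ _ _ ((phi 0 a * G - G * (D' * rmx (z a) * D)) * D' * gmx b'
      + G * D' * rmx (z a) * (D * D' - 1) * gmx b' + G * D' * (rmx (z a) * gmx b' - gmx b' * rmx (y a)))).
      by rewrite GY YE DD' zb !subrr; ncring.
    by ncring.
  have h2 : rmx (gact g y a) * Gam = Gam * rmx (y a).
    by rewrite -(graded_gmx grGam) rmx_gmx gmx_rmx; congr rmx; exact: gactE.
  apply: (@nc_lincomb _ _ _ ((phi 0 a * Gam - rmx (gact g y a) * Gam) * Gam' - (phi 0 a - rmx (gact g y a)) * (Gam * Gam' - 1))).
    by rewrite h1 h2 GG' !subrr; ncring.
  by ncring.
pose psi t : Rep R v := fun a => unrmx a (phi t a).
have phiE t : t <= 0 -> phi t = fun a => rmx (psi t a).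
  by move=> t0; apply/funext => a; rewrite /psi homog_rmx //; exact: phi_hom.
exists psi; split; first split.
- by move=> a; rewrite /psi phi0 rmxK.
- move=> t t0 a r s dphi; have [r' [s' E]] := unrmx_entry R r s.
  have [D1 D2] := phiD t a r' s' t0.
  have dE : (phi t a * moment al (phi t) - moment al (phi t) * phi t a) r' s' = dphi r s.
    by rewrite -E phiE // flow_rmx rmxK.
  rewrite dE in D1 D2.
  by split; under eq_fun do rewrite /psi E.
move=> a r s; have [r' [s' E]] := unrmx_entry R r s; have [L1 L2] := phi_lim a r' s'.
have xrs : x a r s = X0 a r' s' by rewrite -E rmxK.
by rewrite xrs; split; under eq_fun do rewrite /psi E.
Qed.
End Main.

Theorem theorem1p2 (R : realType) (Q : quiver) (v : vert Q -> nat)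
    (m : nat) (rels : 'I_m -> qrelation Q R[i]) (alpha : vert Q -> int)
    (x : Rep R v) (n : nat) (X : 'I_n -> subrep (qrep_of x)) :
  admissible v alpha ->
  nu0 rels x ->
  critical alpha x ->
  critical_decomposition alpha X ->
  (forall k, stable alpha (sub_qrep (X k))) ->
  (forall j k : 'I_n, (j < k)%N ->
     slope alpha (sub_qrep (X j)) < slope alpha (sub_qrep (X k))) ->
  (forall y : Rep R v, unstable_set rels alpha x y ->
     has_filtration (qrep_of y) (fun k => sub_qrep (X k))) /\
  (forall y : Rep R v, nu0 rels y ->
     has_filtration (qrep_of y) (fun k => sub_qrep (X k)) ->
     exists g : forall i, 'M[R[i]]_(v i),
       in_G g /\ unstable_set rels alpha x (gact g y)).
Proof.
move=> _ _ crit dec stab slopes.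
have [p [lam [[piM pi_sum pi_neq0 HE] [pi_x memX]]]] := critical_projections crit dec.
have momentE : moment (stab_mx R v alpha) (fun a => rmx (x a)) = \sum_k rscale (lam k) (gmx (p k)).
  by rewrite moment_rmx.
have lam_lt (k l : 'I_n) : (k < l)%N -> lam k < lam l.
  by move=> kl; rewrite -!(slope_lam piM pi_neq0 momentE pi_x memX) ltr_rat slopes.
(* A slope is an integer divided by the total dimension of the summand; these fractions are brought
   to a common denominator below. *)
have lam_dim k : lam k * (\sum_i \dim (X k i))%:R = (\sum_i alpha i * (\dim (X k i))%:Z)%:~R.
  rewrite -(rtr_stab_dim alpha (pi_block_mem piM memX k) (@pi_block_fix _ _ _ _ _ _ _ memX k)).
  by rewrite (rtr_stab_pi piM momentE pi_x) (rtr_pi piM memX).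
have [M [c0 [c [M0 lamE]]]] := common_denominator (dim_X_gt0 piM pi_neq0 memX) lam_dim.
split=> y; first exact: (unstable_has_filtration piM pi_sum pi_neq0 momentE pi_x memX M0 lamE lam_lt).
exact: (has_filtration_unstable piM pi_sum momentE memX M0 lamE lam_lt).
Qed.
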